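(* Let $q$ be a non-zero complex number which is not a root of unity, let $U^+=U_q^+(B_2)$, and let the torus $\mathcal{H}=(\mathbb{C}^* )^2$ act on $U^+$ by automorphisms via $(h_1,h_2).e_i=h_ie_i$ for $i\in\{1,2\}$. The $\mathcal{H}$-strata of the set $\mathrm{Prim}(U^+)$ of (left) primitive ideals of $U^+$ are $$\begin{aligned} \mathrm{Prim}_{\langle 0\rangle}(U^+)&=\{\langle z-\alpha,z'-\beta\rangle\mid\alpha,\beta\in\mathbb{C}^*\},\\ \mathrm{Prim}_{\langle z'\rangle}(U^+)&=\{\langle z-\alpha,z'\rangle\mid\alpha\in\mathbb{C}^*\},\\ \mathrm{Prim}_{\langle z\rangle}(U^+)&=\{\langle z,z'-\beta\rangle\mid\beta\in\mathbb{C}^*\},\\ \mathrm{Prim}_{\langle e_3\rangle}(U^+)&=\{\langle e_3\rangle\},\\ \mathrm{Prim}_{\langle\overline{e_3}\rangle}(U^+)&=\{\langle\overline{e_3}\rangle\},\\ \mathrm{Prim}_{\langle e_1\rangle}(U^+)&=\{\langle e_1,e_2-\beta\rangle\mid\beta\in\mathbb{C}^*\},\\ \mathrm{Prim}_{\langle e_2\rangle}(U^+)&=\{\langle e_1-\alpha,e_2\rangle\mid\alpha\in\mathbb{C}^*\},\\ \mathrm{Prim}_{\langle e_1,e_2\rangle}(U^+)&=\{\langle e_1,e_2\rangle\}. \end{aligned}$$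
   Context: $U^+=U_q^+(B_2)$ is the unital associative $\mathbb{C}$-algebra generated by $e_1,e_2$ subject to the quantum Serre relations $e_1^2e_2-(q^2+q^{-2})e_1e_2e_1+e_2e_1^2=0$ and $e_2^3e_1-(q^2+1+q^{-2})e_2^2e_1e_2+(q^2+1+q^{-2})e_2e_1e_2^2-e_1e_2^3=0$. Set $e_3=e_1e_2-q^2e_2e_1$, $\overline{e_3}=e_1e_2-q^{-2}e_2e_1$, $z=e_2e_3-q^2e_3e_2$ and $z'=(1-q^{-2})\left(e_3\overline{e_3}+(1+q^{-2})ze_1\right)$; the center of $U^+$ is the polynomial ring $\mathbb{C}[z,z']$. $\langle\cdots\rangle$ denotes the two-sided ideal of $U^+$ generated by the listed elements. An ideal $I$ is $\mathcal{H}$-invariant if $h.I=I$ for all $h\in\mathcal{H}$. For an $\mathcal{H}$-invariant prime ideal $J$, the $\mathcal{H}$-stratum is $\mathrm{Spec}_J(U^+)=\{P\in\mathrm{Spec}(U^+)\mid\bigcap_{h\in\mathcal{H}}h.P=J\}$, and $\mathrm{Prim}_J(U^+)=\mathrm{Spec}_J(U^+)\cap\mathrm{Prim}(U^+)$. There are exactly eight $\mathcal{H}$-invariant prime ideals: $\langle0\rangle,\langle z\rangle,\langle z'\rangle,\langle e_3\rangle,\langle\overline{e_3}\rangle,\langle e_1\rangle,\langle e_2\rangle,\langle e_1,e_2\rangle$. *)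

(* Defs.v *)
From HB Require Import structures.
From mathcomp Require Import all_boot all_order all_algebra.
From mathcomp Require Import generic_quotient ring_quotient.
From mathcomp Require Import boolp classical_sets reals complex.
From mathcomp Require Import finmap monalg.
From mathcomp Require Import ring.

Set Implicit Arguments.
Unset Strict Implicit.
Unset Printing Implicit Defensive.

Import GRing.Theory.

Local Open Scope classical_set_scope.
Local Open Scope ring_scope.
Local Open Scope quotient_scope.

Section Ideals.
Variable A : nzRingType.
Implicit Types I J P S : set A.

Definition two_sided_ideal I : Prop :=
  [/\ I 0, forall x y, I x -> I y -> I (x + y),
      forall a x, I x -> I (a * x) & forall a x, I x -> I (x * a)].

Definition ideal_gen S : set A := smallest two_sided_ideal S.

Lemma ideal_gen_ideal S : two_sided_ideal (ideal_gen S).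
Proof.
split.
- by move=> I [[I0 _ _ _] _].
- move=> x y Sx Sy I SI; have [[_ ID _ _] _] := SI.
  by apply: ID; [apply: Sx | apply: Sy].
- by move=> a x Sx I SI; have [[_ _ IMl _] _] := SI; apply: IMl; apply: Sx.
- by move=> a x Sx I SI; have [[_ _ _ IMr] _] := SI; apply: IMr; apply: Sx.
Qed.

(* The third clause says I J `<=` P -> I `<=` P \/ J `<=` P: as P is closed
   under sums, it contains the ideal product I J iff it contains every x * y. *)
Definition prime_ideal P : Prop :=
  [/\ two_sided_ideal P, P <> setT &
      forall I J, two_sided_ideal I -> two_sided_ideal J ->
        (forall x y, I x -> J y -> P (x * y)) -> I `<=` P \/ J `<=` P].

Definition submodule (M : lmodType A) (N : set M) : Prop :=
  [/\ N 0, forall u v, N u -> N v -> N (u + v) &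
      forall (a : A) v, N v -> N (a *: v)].

Definition simple_module (M : lmodType A) : Prop :=
  [set: M] <> [set 0] /\
  forall N : set M, submodule N -> N = [set 0] \/ N = setT.

Definition annihilator (M : lmodType A) : set A :=
  [set a | forall v : M, a *: v = 0].

(* An lmodType is a left module: a *: (b *: v) = (a * b) *: v. *)
Definition left_primitive P : Prop :=
  exists2 M : lmodType A, simple_module M & P = annihilator M.

Definition Spec : set (set A) := [set P | prime_ideal P].
Definition Prim : set (set A) := [set P | left_primitive P].

Structure proper_ideal := ProperTwoSidedIdeal {
  ideal_set : set A;
  ideal_setP : two_sided_ideal ideal_set;
  ideal_set1 : ~ ideal_set 1
}.

End Ideals.

(* ring_quotient only gives ring structures on quotients of commutative rings;
   the additive structure of its {quot _} is reused here. *)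
Section QuotientRing.
Variables (A : nzRingType) (I : proper_ideal A).

Definition ideal_pred (J : proper_ideal A) : {pred A} := fun x => `[< ideal_set J x >].

Lemma ideal_predE x : (x \in ideal_pred I) = `[< ideal_set I x >].
Proof. by []. Qed.

Fact ideal_pred_zmod_closed : zmod_closed (ideal_pred I).
Proof.
have [I0 ID IMl _] := ideal_setP I.
split; first exact/asboolP.
move=> x y /asboolP Ix /asboolP Iy; apply/asboolP; apply: (ID x) => //.
by rewrite -mulN1r; apply: IMl.
Qed.
HB.instance Definition _ :=
  GRing.isZmodClosed.Build A (ideal_pred I) ideal_pred_zmod_closed.

Definition quot_ring : Type := Quotient.quot (ideal_pred I : zmodClosed A).

HB.instance Definition _ := GRing.Zmodule.on quot_ring.
HB.instance Definition _ := EqQuotient.on quot_ring.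

Definition to_quot (x : A) : quot_ring := \pi_quot_ring x.

Lemma to_quot_eq x y : to_quot x = to_quot y <-> ideal_set I (x - y).
Proof.
split=> [/eqP|Ixy]; last apply/eqP.
  by rewrite -Quotient.idealrBE => /asboolP.
by rewrite -Quotient.idealrBE; apply/asboolP.
Qed.

Lemma to_quot_repr (x : quot_ring) : to_quot (repr x) = x.
Proof. exact: reprK. Qed.

Fact to_quot_is_zmod_morphism : zmod_morphism to_quot.
Proof. by move=> x y; rewrite /to_quot !piE. Qed.
HB.instance Definition _ :=
  GRing.isZmodMorphism.Build A quot_ring to_quot to_quot_is_zmod_morphism.

Definition quot_one : quot_ring := to_quot 1.
Definition quot_mul (x y : quot_ring) : quot_ring := to_quot (repr x * repr y).

Lemma quot_mul_pi x y : quot_mul (to_quot x) (to_quot y) = to_quot (x * y).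
Proof.
have [_ ID IMl IMr] := ideal_setP I.
apply/to_quot_eq; set x' := repr _; set y' := repr _.
have -> : x' * y' - x * y = x' * (y' - y) + (x' - x) * y.
  by rewrite mulrBr mulrBl addrA subrK.
by apply: ID; [apply: IMl | apply: IMr];
  apply/to_quot_eq; rewrite to_quot_repr.
Qed.

Fact quot_mulA : associative quot_mul.
Proof.
move=> x y z; rewrite -(to_quot_repr x) -(to_quot_repr y) -(to_quot_repr z).
by rewrite !quot_mul_pi mulrA.
Qed.

Fact quot_mul1 : left_id quot_one quot_mul.
Proof. by move=> x; rewrite -(to_quot_repr x) quot_mul_pi mul1r. Qed.

Fact quot_mulr1 : right_id quot_one quot_mul.
Proof. by move=> x; rewrite -(to_quot_repr x) quot_mul_pi mulr1. Qed.

Fact quot_mulDl : left_distributive quot_mul +%R.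
Proof.
move=> x y z; rewrite -(to_quot_repr x) -(to_quot_repr y) -(to_quot_repr z).
by rewrite -raddfD !quot_mul_pi -raddfD mulrDl.
Qed.

Fact quot_mulDr : right_distributive quot_mul +%R.
Proof.
move=> x y z; rewrite -(to_quot_repr x) -(to_quot_repr y) -(to_quot_repr z).
by rewrite -raddfD !quot_mul_pi -raddfD mulrDr.
Qed.

Fact quot_one_neq0 : quot_one != 0.
Proof.
apply/eqP; rewrite -[0](raddf0 to_quot) => /to_quot_eq.
by rewrite subr0; apply: ideal_set1.
Qed.

HB.instance Definition _ := GRing.Zmodule_isNzRing.Build quot_ring
  quot_mulA quot_mul1 quot_mulr1 quot_mulDl quot_mulDr quot_one_neq0.

Fact to_quot_is_monoid_morphism : monoid_morphism to_quot.
Proof. by split=> // x y; rewrite -quot_mul_pi. Qed.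
HB.instance Definition _ := GRing.isMonoidMorphism.Build A quot_ring to_quot
  to_quot_is_monoid_morphism.

End QuotientRing.

Section QuotientAlgebra.
Variables (K : comNzRingType) (A : algType K) (I : proper_ideal A).
Local Notation Q := (quot_ring I).

Definition quot_scale (k : K) (x : Q) : Q := to_quot I (k *: repr x).

Lemma quot_scale_pi k x : quot_scale k (to_quot I x) = to_quot I (k *: x).
Proof.
apply/to_quot_eq; rewrite -scalerBr -mulr_algl.
have [_ _ IMl _] := ideal_setP I; apply: IMl.
by apply/to_quot_eq; rewrite to_quot_repr.
Qed.

Fact quot_scaleA a b x : quot_scale a (quot_scale b x) = quot_scale (a * b) x.
Proof. by rewrite -(to_quot_repr x) !quot_scale_pi scalerA. Qed.

Fact quot_scale1 : left_id 1 quot_scale.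
Proof. by move=> x; rewrite -(to_quot_repr x) quot_scale_pi scale1r. Qed.

Fact quot_scaleDr : right_distributive quot_scale +%R.
Proof.
move=> a x y; rewrite -(to_quot_repr x) -(to_quot_repr y).
by rewrite -raddfD !quot_scale_pi -raddfD scalerDr.
Qed.

Fact quot_scaleDl x : {morph quot_scale^~ x : a b / a + b}.
Proof.
move=> a b; rewrite -(to_quot_repr x).
by rewrite !quot_scale_pi -raddfD scalerDl.
Qed.

HB.instance Definition _ := GRing.Zmodule_isLmodule.Build K Q
  quot_scaleA quot_scale1 quot_scaleDr quot_scaleDl.

Fact quot_scaleAl (k : K) (x y : Q) : k *: (x * y) = k *: x * y.
Proof.
rewrite -(to_quot_repr x) -(to_quot_repr y) -rmorphM.
by rewrite /GRing.scale/= !quot_scale_pi -rmorphM scalerAl.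
Qed.
HB.instance Definition _ := GRing.Lmodule_isLalgebra.Build K Q quot_scaleAl.

Fact quot_scaleAr (k : K) (x y : Q) : k *: (x * y) = x * (k *: y).
Proof.
rewrite -(to_quot_repr x) -(to_quot_repr y) -rmorphM.
by rewrite /GRing.scale/= !quot_scale_pi -rmorphM scalerAr.
Qed.
HB.instance Definition _ := GRing.Lalgebra_isAlgebra.Build K Q quot_scaleAr.

Fact to_quot_is_scalable : scalable (to_quot I).
Proof. by move=> k x; rewrite -quot_scale_pi. Qed.
HB.instance Definition _ := GRing.isScalable.Build K A Q *:%R (to_quot I)
  to_quot_is_scalable.

End QuotientAlgebra.

Definition free_algebra (K : comNzRingType) (n : nat) : Type :=
  {malg K[{fmonom 'I_n}]}.

Section FreeAlgebra.
Variables (K : comNzRingType) (n : nat).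
Local Notation F := (free_algebra K n).

HB.instance Definition _ := GRing.Lalgebra.on F.

Definition free_gen (i : 'I_n) : F := mkmalgU (fmu i) (1 : K).

Fact free_scaleAr (k : K) (x y : F) : k *: (x * y) = x * (k *: y).
Proof.
rewrite -!mul_malgC !mulrA; congr (_ * y).
rewrite !malgM_def fgmulUg fgmulgU; apply: eq_bigr => m _.
by rewrite mul1m mulm1 mulrC.
Qed.
HB.instance Definition _ := GRing.Lalgebra_isAlgebra.Build K F free_scaleAr.

Lemma free_algebraE (x : F) :
  x = \sum_(m <- msupp x) x@_m *: \prod_(i <- (m : {fmonom 'I_n})) free_gen i.
Proof.
rewrite {1}[x]monalgE; apply: eq_bigr => m _.
have -> : \prod_(i <- m) free_gen i = << m >> :> {malg K[{fmonom 'I_n}]}.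
  rewrite -[m in RHS]fmK; elim: (fmonom_val m) => [|i s IHs].
    by rewrite big_nil -fmoneE.
  rewrite big_cons IHs malgM_def fgmulUU mulr1; congr << _ >>.
  by apply/val_inj; rewrite /= fmM fmuE.
by rewrite malgZ_def /fgscale msuppU1 big_seq_fset1 mcoeffUU mulr1.
Qed.

Section Lift.
Variables (A : algType K) (a : 'I_n -> A).

Definition free_mon (m : {fmonom 'I_n}) : A := \prod_(i <- m) a i.

Fact free_mon_mmorphism : mmorphism free_mon.
Proof.
by split=> [m1 m2|]; rewrite /free_mon ?fmM ?fm1 ?big_cat ?big_nil.
Qed.
HB.instance Definition _ :=
  isMultiplicative.Build {fmonom 'I_n} A free_mon free_mon_mmorphism.

Definition free_lift (x : F) : A := mmap (in_alg A) free_mon x.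

Fact free_lift_is_zmod_morphism : zmod_morphism free_lift.
Proof. by move=> x y; rewrite /free_lift raddfB. Qed.
HB.instance Definition _ :=
  GRing.isZmodMorphism.Build F A free_lift free_lift_is_zmod_morphism.

Fact free_lift_is_monoid_morphism : monoid_morphism free_lift.
Proof.
have cf (g : {malg K[{fmonom 'I_n}]}) m m' :
    GRing.comm (in_alg A g@_m) (free_mon m').
  by rewrite /GRing.comm /= mulr_algl mulr_algr.
by have [fM f1] := commr_mmap_is_multiplicative cf; split.
Qed.
HB.instance Definition _ :=
  GRing.isMonoidMorphism.Build F A free_lift free_lift_is_monoid_morphism.

Fact free_lift_is_scalable : scalable free_lift.
Proof. by move=> k x; rewrite /free_lift mmapZ mulr_algl. Qed.
HB.instance Definition _ :=
  GRing.isScalable.Build K F A *:%R free_lift free_lift_is_scalable.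

Lemma free_liftE i : free_lift (free_gen i) = a i.
Proof.
by rewrite /free_lift mmapU /= scale1r mul1r /free_mon fmU big_seq1.
Qed.

End Lift.
End FreeAlgebra.

Section Uplus.
Variables (K : fieldType) (q : K).

Definition serre1 (A : algType K) (a : 'I_2 -> A) : A :=
  let x := a 0 in let y := a 1 in
  x ^+ 2 * y - (q ^+ 2 + q ^- 2) *: (x * y * x) + y * x ^+ 2.

Definition serre2 (A : algType K) (a : 'I_2 -> A) : A :=
  let x := a 0 in let y := a 1 in
  y ^+ 3 * x - (q ^+ 2 + 1 + q ^- 2) *: (y ^+ 2 * x * y)
    + (q ^+ 2 + 1 + q ^- 2) *: (y * x * y ^+ 2) - x * y ^+ 3.

Lemma serre1_morph (A B : algType K) (f : {lrmorphism A -> B}) a :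
  f (serre1 a) = serre1 (f \o a).
Proof.
by rewrite /serre1 rmorphD rmorphB /= [X in _ - X]linearZ /= !rmorphM. Qed.

Lemma serre2_morph (A B : algType K) (f : {lrmorphism A -> B}) a :
  f (serre2 a) = serre2 (f \o a).
Proof.
rewrite /serre2 rmorphB rmorphD rmorphB /= [X in _ - X + _]linearZ /=.
by rewrite [X in _ + X - _]linearZ /= !rmorphM.
Qed.

Lemma serre1_scale (A : algType K) (c : 'I_2 -> K) (a : 'I_2 -> A) :
  serre1 (fun i => c i *: a i) = (c 0 ^+ 2 * c 1) *: serre1 a.
Proof.
rewrite /serre1 scalerDr scalerBr !exprZn.
rewrite -!(scalerAl, scalerAr) !scalerA.
by congr (_ *: _ - _ *: _ + _ *: _); ring.
Qed.

Lemma serre2_scale (A : algType K) (c : 'I_2 -> K) (a : 'I_2 -> A) :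
  serre2 (fun i => c i *: a i) = (c 0 * c 1 ^+ 3) *: serre2 a.
Proof.
rewrite /serre2 scalerBr scalerDr scalerBr !exprZn.
rewrite -!(scalerAl, scalerAr) !scalerA.
by congr (_ *: _ - _ *: _ + _ *: _ - _ *: _); ring.
Qed.

Definition serre_relators : set (free_algebra K 2) :=
  [set serre1 (@free_gen K 2); serre2 (@free_gen K 2)].

Lemma free_lift_relators (A : algType K) (a : 'I_2 -> A) :
  serre1 a = 0 -> serre2 a = 0 ->
  ideal_gen serre_relators `<=` [set x | free_lift a x = 0].
Proof.
have la : free_lift a \o @free_gen K 2 = a by apply/funext => i; exact: free_liftE.
move=> a1 a2; apply: smallest_sub => [|x [] ->]; last 2 first.
- by rewrite /= serre1_morph la.
- by rewrite /= serre2_morph la.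
split=> [|x y /= x0 y0|b x /= x0|b x /= x0]; first exact: rmorph0.
- by rewrite rmorphD /= x0 y0 addr0.
- by rewrite rmorphM /= x0 mulr0.
- by rewrite rmorphM /= x0 mul0r.
Qed.

Fact serre_ideal1 : ~ ideal_gen serre_relators 1.
Proof.
move/(@free_lift_relators K^o (fun=> 0)) => /=; rewrite rmorph1 => h.
have /eqP : (1 : K) = 0 by apply: h; rewrite /serre1 /serre2 !mul0r ?mulr0 ?scaler0 ?(subr0, addr0).
by rewrite oner_eq0.
Qed.

Definition serre_ideal : proper_ideal (free_algebra K 2) :=
  ProperTwoSidedIdeal (ideal_gen_ideal serre_relators) serre_ideal1.

Definition Uplus : Type := quot_ring serre_ideal.
HB.instance Definition _ := GRing.Algebra.on Uplus.

Definition Ugen (i : 'I_2) : Uplus := to_quot serre_ideal (free_gen K i).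
Definition e1 : Uplus := Ugen 0.
Definition e2 : Uplus := Ugen 1.

Definition e3 : Uplus := e1 * e2 - q ^+ 2 *: (e2 * e1).
Definition e3bar : Uplus := e1 * e2 - q ^- 2 *: (e2 * e1).
Definition z : Uplus := e2 * e3 - q ^+ 2 *: (e3 * e2).
Definition z' : Uplus :=
  (1 - q ^- 2) *: (e3 * e3bar + (1 + q ^- 2) *: (z * e1)).

Lemma Ugen_serre1 : serre1 Ugen = 0.
Proof.
have -> : Ugen = to_quot serre_ideal \o @free_gen K 2 by [].
rewrite -(serre1_morph (to_quot serre_ideal)) -(raddf0 (to_quot serre_ideal)).
by apply/to_quot_eq; rewrite subr0; apply: sub_gen_smallest; left.
Qed.

Lemma Ugen_serre2 : serre2 Ugen = 0.
Proof.
have -> : Ugen = to_quot serre_ideal \o @free_gen K 2 by [].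
rewrite -(serre2_morph (to_quot serre_ideal)) -(raddf0 (to_quot serre_ideal)).
by apply/to_quot_eq; rewrite subr0; apply: sub_gen_smallest; right.
Qed.

Section Lift.
Variables (A : algType K) (a : 'I_2 -> A).

(* The algebra morphism sending e_i to a i; only meaningful when a satisfies
   the Serre relations. *)
Definition Uplus_lift (x : Uplus) : A := free_lift a (repr x).

Hypotheses (a1 : serre1 a = 0) (a2 : serre2 a = 0).

Lemma Uplus_lift_pi x : Uplus_lift (to_quot serre_ideal x) = free_lift a x.
Proof.
apply/eqP; rewrite -subr_eq0 -rmorphB; apply/eqP.
apply: (free_lift_relators a1 a2).
by apply/(to_quot_eq serre_ideal); rewrite to_quot_repr.
Qed.

Lemma Uplus_liftE i : Uplus_lift (Ugen i) = a i.
Proof. by rewrite Uplus_lift_pi free_liftE. Qed.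

Lemma Uplus_lift_zmod_morphism : zmod_morphism Uplus_lift.
Proof.
move=> x y; rewrite -(to_quot_repr x) -(to_quot_repr y).
by rewrite -raddfB !Uplus_lift_pi raddfB.
Qed.

Lemma Uplus_lift_monoid_morphism : monoid_morphism Uplus_lift.
Proof.
split=> [|x y].
  by rewrite -(rmorph1 (to_quot serre_ideal)) Uplus_lift_pi rmorph1.
rewrite -(to_quot_repr x) -(to_quot_repr y).
by rewrite -rmorphM !Uplus_lift_pi rmorphM.
Qed.

Lemma Uplus_lift_scalable : scalable Uplus_lift.
Proof.
move=> k x; rewrite -(to_quot_repr x).
by rewrite -linearZ !Uplus_lift_pi linearZ.
Qed.

End Lift.

Definition torus : set (K * K) := [set h | h.1 != 0 /\ h.2 != 0].

Definition torus_gen (h : K * K) (i : 'I_2) : Uplus :=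
  (if i == 0 then h.1 else h.2) *: Ugen i.

Definition torus_act (h : K * K) : Uplus -> Uplus := Uplus_lift (torus_gen h).

Lemma torus_gen_serre1 h : serre1 (torus_gen h) = 0.
Proof. by rewrite serre1_scale Ugen_serre1 scaler0. Qed.

Lemma torus_gen_serre2 h : serre2 (torus_gen h) = 0.
Proof. by rewrite serre2_scale Ugen_serre2 scaler0. Qed.

HB.instance Definition _ h := GRing.isZmodMorphism.Build Uplus Uplus
  (torus_act h)
  (Uplus_lift_zmod_morphism (torus_gen_serre1 h) (torus_gen_serre2 h)).
HB.instance Definition _ h := GRing.isMonoidMorphism.Build Uplus Uplus
  (torus_act h)
  (Uplus_lift_monoid_morphism (torus_gen_serre1 h) (torus_gen_serre2 h)).
HB.instance Definition _ h := GRing.isScalable.Build K Uplus Uplus *:%R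
  (torus_act h)
  (Uplus_lift_scalable (torus_gen_serre1 h) (torus_gen_serre2 h)).

Lemma torus_act_e1 h : torus_act h e1 = h.1 *: e1.
Proof. exact: Uplus_liftE (torus_gen_serre1 h) (torus_gen_serre2 h) 0. Qed.

Lemma torus_act_e2 h : torus_act h e2 = h.2 *: e2.
Proof. exact: Uplus_liftE (torus_gen_serre1 h) (torus_gen_serre2 h) 1. Qed.

Lemma Uplus_ext (B : algType K) (f g : {lrmorphism Uplus -> B}) :
  f e1 = g e1 -> f e2 = g e2 -> f =1 g.
Proof.
move=> fg1 fg2 x; rewrite -(to_quot_repr x) [repr x]free_algebraE !linear_sum.
apply: eq_bigr => m _; rewrite !linearZ /=; congr (_ *: _).
rewrite !rmorph_prod; apply: eq_bigr => i _ /=.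
have [i0|i1] : i = 0 \/ i = 1.
  by case: i => [[|[|//]] lti]; [left|right]; apply/val_inj.
- by rewrite i0.
- by rewrite i1.
Qed.

Lemma torus_act1 : torus_act (1, 1) =1 id.
Proof.
apply: (@Uplus_ext Uplus (torus_act (1, 1)) idfun).
- by rewrite /= torus_act_e1 scale1r.
- by rewrite /= torus_act_e2 scale1r.
Qed.

Lemma torus_actM g h :
  torus_act (g.1 * h.1, g.2 * h.2) =1 torus_act g \o torus_act h.
Proof.
apply: (@Uplus_ext Uplus (torus_act _) (torus_act g \o torus_act h)) => /=.
- by rewrite !torus_act_e1 [RHS]linearZ /= torus_act_e1 scalerA mulrC.
- by rewrite !torus_act_e2 [RHS]linearZ /= torus_act_e2 scalerA mulrC.
Qed.

Lemma torus_act_bij h : torus h -> bijective (torus_act h).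
Proof.
move=> [h1 h2]; exists (torus_act (h.1^-1, h.2^-1)) => x.
- by rewrite -[LHS]torus_actM /= !mulVf // torus_act1.
- by rewrite -[LHS]torus_actM /= !mulfV // torus_act1.
Qed.

Definition Spec_stratum (J : set Uplus) : set (set Uplus) :=
  [set P | Spec P /\ \bigcap_(h in torus) (torus_act h @` P) = J].

Definition Prim_stratum (J : set Uplus) : set (set Uplus) :=
  Spec_stratum J `&` @Prim Uplus.

End Uplus.

(* Main.v *)
(* z and z' are central, and U^+ is spanned over K[z, z'] by the monomials
   e1^c e3^eps e2^d with eps = 0, 1.  For (alpha, beta) <> (0, 0) there is a
   representation on functions Z -> K in which e1 is diagonal, e3 and e3bar are
   weighted shifts, z = alpha and z' = beta; it keeps these monomials linearly
   independent.  Hence P = <z - alpha, z' - beta> is proper, is the kernel of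
   that representation, and has all intersections over (alpha, beta) computed by
   comparing coefficients.  P is maximal: multiplying an element of a larger
   ideal by a power of e1 e3 brings it into the quantum plane K<e1, e3>, where
   eigenvalue arguments extract a monomial e1^i e3^j, and the commutation
   relations with e2 and e3bar turn that monomial into 1.  Maximal ideals are
   primitive by Zorn's lemma.  Conversely the uncountability of K forces central
   elements to act by scalars on simple modules, so every primitive ideal contains
   some <z - alpha, z' - beta>; which of alpha, beta vanish is dictated by the
   stratum, because z and z' are eigenvectors of the torus.  Modulo e3 or e3bar
   the algebra is a quantum plane, whose only primitive ideal containing neither
   e1 nor e2 is 0; modulo e1 or e2 it is a polynomial ring. *)

From HB Require Import structures.
Require Import Defs.
From mathcomp Require Import all_boot all_order all_algebra.
From mathcomp Require Import boolp classical_sets reals complex.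
From mathcomp Require Import generic_quotient ring_quotient.
From mathcomp Require Import functions cardinality.
From mathcomp Require Import finmap monalg ring zify.
From mathcomp Require lebesgue_measure.

Set Implicit Arguments.
Unset Strict Implicit.
Unset Printing Implicit Defensive.

Import GRing.Theory.
Local Open Scope classical_set_scope.
Local Open Scope ring_scope.

(** * Deciding identities between noncommutative polynomials *)

(** No basis of the algebra is taken for granted: rewriting shows that the monomials span, and the
    representation supplies their independence. There the powers of [e2] are told apart by how far
    they carry a point mass in both directions, so no value of [rep_coef] may vanish. For (alpha,
    beta) = (0, 0) all of them do, which is why this pair is excluded throughout and the remaining
    strata go through quantum planes and characters. In maximality the obstacle is that nothing can
    be cancelled in the quotient by a larger ideal. Each elimination by eigenvalues costs extra
    factors, and the outcome is a monomial with larger exponents than expected. This is harmless,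
    since every equation e1^i e3^j = 0 is contradictory. The torus multiplies z by h1 h2^2 and z' by
    (h1 h2)^2. It is therefore transitive on the parameters of each family, square roots being
    required for beta. Hence the intersection of the translates of one ideal is the intersection of
    the whole family, and an element of it has coefficients that are polynomials in the parameters
    vanishing at all non-zero values. *)

Section NoncommutativeExpressions.
Variables (K : comNzRingType) (A : algType K).

Inductive ncexpr :=
  | NCvar of nat | NC0 | NC1
  | NCadd of ncexpr & ncexpr | NCopp of ncexpr
  | NCmul of ncexpr & ncexpr | NCscale of K & ncexpr
  | NCexp of ncexpr & nat.

Fixpoint nceval (env : seq A) e : A :=
  match e with
  | NCvar i => nth 0 env i
  | NC0 => 0
  | NC1 => 1
  | NCadd a b => nceval env a + nceval env b
  | NCopp a => - nceval env a
  | NCmul a b => nceval env a * nceval env b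
  | NCscale k a => k *: nceval env a
  | NCexp a n => nceval env a ^+ n
  end.

Fixpoint ncmul1 (p : K * seq nat) (t : seq (K * seq nat)) :=
  match t with
  | [::] => [::]
  | r :: t' => (p.1 * r.1, p.2 ++ r.2) :: ncmul1 p t'
  end.

Fixpoint ncmul (s t : seq (K * seq nat)) :=
  match s with [::] => [::] | p :: s' => ncmul1 p t ++ ncmul s' t end.

Fixpoint ncscale (k : K) (t : seq (K * seq nat)) :=
  match t with
  | [::] => [::]
  | r :: t' => (k * r.1, r.2) :: ncscale k t'
  end.

Fixpoint ncpow (s : seq (K * seq nat)) n :=
  match n with 0%N => [:: (1, [::])] | n'.+1 => ncmul s (ncpow s n') end.

Fixpoint ncnorm e : seq (K * seq nat) :=
  match e with
  | NCvar i => [:: (1, [:: i])]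
  | NC0 => [::]
  | NC1 => [:: (1, [::])]
  | NCadd a b => ncnorm a ++ ncnorm b
  | NCopp a => ncscale (-1) (ncnorm a)
  | NCmul a b => ncmul (ncnorm a) (ncnorm b)
  | NCscale k a => ncscale k (ncnorm a)
  | NCexp a n => ncpow (ncnorm a) n
  end.

(** Words are compared by plain recursion, so that [cbv] can run the whole normalization without
    unfolding anything in [K]. *)
Fixpoint eqword (v w : seq nat) : bool :=
  match v, w with
  | [::], [::] => true
  | i :: v', j :: w' => if eqn i j then eqword v' w' else false
  | _, _ => false
  end.

Fixpoint ncinsert (p : K * seq nat) s :=
  match s with
  | [::] => [:: p]
  | r :: s' => if eqword p.2 r.2 then (p.1 + r.1, r.2) :: s'
               else r :: ncinsert p s'
  end.

Fixpoint nccollect (s : seq (K * seq nat)) :=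
  match s with [::] => [::] | p :: s' => ncinsert p (nccollect s') end.

(** A proposition instead of a boolean test: coefficients are not decided by computation but handed
    over as equations, to be closed by [field]. *)
Fixpoint ncall0 (s : seq (K * seq nat)) : Prop :=
  match s with [::] => True | p :: s' => p.1 = 0 /\ ncall0 s' end.

Definition ncword (env : seq A) (w : seq nat) : A := \prod_(i <- w) nth 0 env i.

Definition ncsum env (s : seq (K * seq nat)) : A :=
  \sum_(p <- s) p.1 *: ncword env p.2.

Lemma ncsum_cons env p s :
  ncsum env (p :: s) = p.1 *: ncword env p.2 + ncsum env s.
Proof. exact: big_cons. Qed.

Lemma ncsum_cat env s t : ncsum env (s ++ t) = ncsum env s + ncsum env t.
Proof. exact: big_cat. Qed.

Lemma ncsum_scale env k s : ncsum env (ncscale k s) = k *: ncsum env s.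
Proof.
elim: s => [|p s IH]; first by rewrite /ncsum !big_nil scaler0.
by rewrite !ncsum_cons IH /= scalerDr scalerA.
Qed.

Lemma ncsum_mul env s t : ncsum env (ncmul s t) = ncsum env s * ncsum env t.
Proof.
elim: s => [|p s IH] /=; first by rewrite /ncsum !big_nil mul0r.
rewrite ncsum_cat ncsum_cons IH mulrDl; congr (_ + _).
elim: t {s IH} => [|r t IH] /=; first by rewrite /ncsum !big_nil mulr0.
rewrite !ncsum_cons IH mulrDr; congr (_ + _).
by rewrite /ncword big_cat /= -scalerAl -scalerAr scalerA.
Qed.

Lemma ncnormP env e : nceval env e = ncsum env (ncnorm e).
Proof.
have one : ncsum env [:: (1, [::])] = 1.
  by rewrite /ncsum big_seq1 /ncword big_nil scale1r.
elim: e => [i|||a IHa b IHb|a IHa|a IHa b IHb|k a IHa|a IHa n] /=.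
- by rewrite /ncsum big_seq1 /ncword big_seq1 scale1r.
- by rewrite /ncsum big_nil.
- by rewrite one.
- by rewrite ncsum_cat IHa IHb.
- by rewrite ncsum_scale IHa scaleN1r.
- by rewrite ncsum_mul IHa IHb.
- by rewrite ncsum_scale IHa.
- by elim: n => [|n IH]; rewrite ?one // exprS /= ncsum_mul IH IHa.
Qed.

Lemma ncsum_insert env p s :
  ncsum env (ncinsert p s) = p.1 *: ncword env p.2 + ncsum env s.
Proof.
have eqwordP v w : eqword v w -> v = w.
  elim: v w => [|i v IH] [|j w] //=.
  by case: ifP => // /eqnP -> /IH ->.
elim: s => [|r s IH] /=; first exact: ncsum_cons.
case: ifP => [/eqwordP e|_]; last by rewrite !ncsum_cons IH addrCA.
by rewrite !ncsum_cons /= e scalerDl addrA.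
Qed.

Lemma nc_eq env a b :
  ncall0 (nccollect (ncnorm (NCadd a (NCopp b)))) ->
  nceval env a = nceval env b.
Proof.
move=> h; apply/eqP; rewrite -subr_eq0.
rewrite -[_ - _]/(nceval env (NCadd a (NCopp b))) ncnormP; apply/eqP.
have -> s : ncsum env s = ncsum env (nccollect s).
  elim: s => [|p s IH] //=; by rewrite ncsum_insert ncsum_cons IH.
elim: (nccollect _) h => [|p s IH] /=; first by rewrite /ncsum big_nil.
by case=> p0 /IH h; rewrite ncsum_cons h p0 scale0r addr0.
Qed.
End NoncommutativeExpressions.

Ltac nc_index env x :=
  lazymatch env with
  | x :: _ => constr:(0%N)
  | _ :: ?env' => let n := nc_index env' x in constr:(S n)
  end.

Ltac nc_reify K env t :=
  lazymatch t with
  | @GRing.zero _ => constr:(@NC0 K)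
  | @Algebra.zero _ => constr:(@NC0 K)
  | @GRing.one _ => constr:(@NC1 K)
  | @GRing.add _ ?a ?b =>
    let a' := nc_reify K env a in let b' := nc_reify K env b in
    constr:(@NCadd K a' b')
  | @GRing.opp _ ?a => let a' := nc_reify K env a in constr:(@NCopp K a')
  | @GRing.mul _ ?a ?b =>
    let a' := nc_reify K env a in let b' := nc_reify K env b in
    constr:(@NCmul K a' b')
  | @GRing.exp _ ?a ?n => let a' := nc_reify K env a in constr:(@NCexp K a' n)
  | @GRing.scale _ _ ?k ?a =>
    let a' := nc_reify K env a in constr:(@NCscale K k a')
  | _ => let n := nc_index env t in constr:(@NCvar K n)
  end.

(* Proves an equality of noncommutative polynomials in the elements of [env] by
   comparing the coefficients of all words, which are left as goals over [K]. *)
Ltac noncomm K env :=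
  lazymatch goal with
  | |- ?a = ?b =>
    let a' := nc_reify K env a in
    let b' := nc_reify K env b in
    apply: (@nc_eq K _ env a' b');
    cbv [ncall0 nccollect ncnorm ncinsert ncmul ncmul1 ncscale ncpow eqword
         eqn cat fst snd]; do ?split
  end.

(** * Quantum planes *)

Section LinearSpan.
Variables (K : nzRingType).

Definition subspace (V : lmodType K) (S : set V) : Prop :=
  S 0 /\ forall (k : K) x y, S x -> S y -> S (k *: x + y).

(** An inductive span makes every decomposition below an induction on the linear combination. *)
Inductive lspan (V : lmodType K) (S : set V) : set V :=
  | lspan0 : lspan S 0
  | lspanD k x y : S x -> lspan S y -> lspan S (k *: x + y).

Variables (V : lmodType K) (S : set V).

Lemma lspan_gen x : S x -> lspan S x.
Proof.
by move=> Sx; rewrite -[x]addr0 -[x]scale1r; apply: lspanD => //; apply: lspan0.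
Qed.

Lemma lspan_subspace : subspace (lspan S).
Proof.
split=> [|k x y Sx Sy]; first exact: lspan0.
elim: Sx => [|l u v Su _ IH]; first by rewrite scaler0 add0r.
by rewrite scalerDr scalerA -addrA; apply: lspanD.
Qed.

Lemma lspan_sub (T : set V) : subspace T -> S `<=` T -> lspan S `<=` T.
Proof. by move=> [T0 TD] ST x; elim=> // k u y /ST Tu _ Ty; apply: TD. Qed.

End LinearSpan.

Section Subspace.
Variables (K : nzRingType) (V : lmodType K) (S : set V).
Hypothesis subS : subspace S.

Lemma subspaceZ k x : S x -> S (k *: x).
Proof. by case: subS => S0 SD Sx; rewrite -[_ *: _]addr0; apply: SD. Qed.

Lemma subspaceD x y : S x -> S y -> S (x + y).
Proof. by case: subS => S0 SD Sx Sy; rewrite -[x]scale1r; apply: SD. Qed.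

Lemma subspaceN x : S x -> S (- x).
Proof. by move=> Sx; rewrite -scaleN1r; apply: subspaceZ. Qed.

Lemma subspaceB x y : S x -> S y -> S (x - y).
Proof. by move=> Sx Sy; apply: subspaceD => //; apply: subspaceN. Qed.

Lemma subspace_sum I r (P : pred I) F :
  (forall i, P i -> S (F i)) -> S (\sum_(i <- r | P i) F i).
Proof.
by move=> SF; apply: big_ind => //; [case: subS | apply: subspaceD].
Qed.

End Subspace.

Section SubspaceMultiples.
Variables (K : nzRingType) (A : algType K) (S T : set A).
Hypothesis subT : subspace T.

Lemma subspace_mull a : subspace [set x | T (a * x)].
Proof.
case: subT => T0 TD; split=> /= [|k x y Tx Ty]; first by rewrite mulr0.
by rewrite mulrDr -scalerAr; apply: TD.
Qed.

Lemma subspace_mulr a : subspace [set x | T (x * a)].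
Proof.
case: subT => T0 TD; split=> /= [|k x y Tx Ty]; first by rewrite mul0r.
by rewrite mulrDl -scalerAl; apply: TD.
Qed.

Lemma lspan_mull a : (forall x, S x -> T (a * x)) ->
  forall x, lspan S x -> T (a * x).
Proof. by move=> h; apply: (lspan_sub (subspace_mull a) h). Qed.

Lemma lspan_mulr a : (forall x, S x -> T (x * a)) ->
  forall x, lspan S x -> T (x * a).
Proof. by move=> h; apply: (lspan_sub (subspace_mulr a) h). Qed.

End SubspaceMultiples.

Section QuantumPlane.
Variables (K : fieldType) (lam : K).
Hypotheses (lam0 : lam != 0) (lamX : forall n, (0 < n)%N -> lam ^+ n != 1).

Lemma expf_nonroot_inj : injective (fun n => lam ^+ n).
Proof.
move=> m n; wlog lemn : m n / (m <= n)%N.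
  by move=> h; case: (leqP m n) => [|/ltnW] /h // + /esym e => /(_ e) ->.
move=> /= e; apply/eqP; rewrite eqn_leq lemn leqNgt; apply/negP => ltmn.
have /lamX/eqP[] : (0 < n - m)%N by rewrite subn_gt0.
apply: (mulfI (expf_neq0 m lam0)).
by rewrite -exprD subnKC // mulr1.
Qed.

(** A Vandermonde argument with vector coefficients: subtracting [lam ^+ n] times the identity at
    [t] from the one at [lam * t] removes the top term and multiplies [v j] by
    [lam ^+ j - lam ^+ n], which is non-zero. *)
Lemma vanishing_polynomial_map (V : lmodType K) n (v : nat -> V) :
  (forall t, t != 0 -> \sum_(i < n) t ^+ i *: v i = 0) ->
  forall i, (i < n)%N -> v i = 0.
Proof.
elim: n v => [|n IH] v h i //.
have v0 j : (j < n)%N -> v j = 0.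
  move=> ltj; have: (lam ^+ j - lam ^+ n) *: v j = 0.
    apply: (IH (fun j => (lam ^+ j - lam ^+ n) *: v j)) => // t t0.
    have := h (lam * t) (mulf_neq0 lam0 t0).
    have /(congr1 ( *:%R (lam ^+ n))) := h t t0.
    rewrite scaler0 scaler_sumr => e1 e2.
    have := congr2 (fun a b => a - b) e2 e1; rewrite /= subr0 -sumrB.
    rewrite big_ord_recr /= scalerA exprMn subrr addr0 => {}e2.
    rewrite -[RHS]e2; apply: eq_bigr => k _.
    by rewrite exprMn !scalerA -scalerBl; congr (_ *: _); ring.
  move/eqP; rewrite scaler_eq0 subr_eq0 => /orP[/eqP/expf_nonroot_inj e|/eqP//].
  by rewrite e ltnn in ltj.
rewrite ltnS leq_eqVlt => /orP[/eqP->|/v0//].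
have := h 1 (oner_neq0 _); rewrite big_ord_recr /= expr1n scale1r big1 ?add0r //.
by move=> j _; rewrite v0 ?scaler0.
Qed.

Variable A : algType K.
Implicit Types s x y : A.

(* Left minus weighted right multiplication by [s] kills one summand at a time. *)
Lemma eigen_sum0 s n (u : nat -> A) (l : nat -> K) :
  (forall i, s * u i = l i *: (u i * s)) ->
  {in gtn n &, injective l} -> \sum_(i < n) u i = 0 ->
  forall i, (i < n)%N -> u i * s ^+ n = 0.
Proof.
elim: n u => [|n IH] u su linj u0 i //.
have ui j : (j < n)%N -> u j * s ^+ n.+1 = 0.
  (* The new summands are multiples of [u j * s]: each elimination costs one factor [s], whence the
     power in the conclusion. *)
  move=> ltj; have: (l j - l n) *: (u j * s) * s ^+ n = 0.
    apply: (IH (fun j => (l j - l n) *: (u j * s))) => // [k|a b an bn|].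
    - by rewrite -scalerAr mulrA su -!scalerAl !scalerA mulrC.
    - by apply: linj; rewrite inE leqW.
    have: s * (\sum_(i < n.+1) u i) - l n *: ((\sum_(i < n.+1) u i) * s) = 0.
      by rewrite u0 mulr0 mul0r scaler0 subr0.
    rewrite mulr_sumr mulr_suml scaler_sumr -sumrB big_ord_recr /= su subrr addr0.
    by move=> e; rewrite -[RHS]e; apply: eq_bigr => k _; rewrite su -scalerBl.
  rewrite -scalerAl -mulrA -exprS => /eqP; rewrite scaler_eq0 subr_eq0.
  case/orP=> [/eqP e|/eqP//]; have := linj j n; rewrite !inE ltnS (ltnW ltj) leqnn.
  by move=> /(_ isT isT e) ej; rewrite ej ltnn in ltj.
rewrite ltnS leq_eqVlt => /orP[/eqP->|/ui//].
have: (\sum_(i < n.+1) u i) * s ^+ n.+1 = 0 by rewrite u0 mul0r.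
rewrite big_ord_recr /= mulrDl mulr_suml big1 ?add0r // => j _; exact: ui.
Qed.

Lemma qcommuteX x y : x * y = lam *: (y * x) ->
  forall i j, x ^+ i * y ^+ j = lam ^+ (i * j) *: (y ^+ j * x ^+ i).
Proof.
move=> xy; have xyn j : x * y ^+ j = lam ^+ j *: (y ^+ j * x).
  elim: j => [|j IH]; first by rewrite !expr0 mul1r mulr1 scale1r.
  by rewrite exprS mulrA xy -scalerAl -(mulrA _ x) IH -scalerAr scalerA mulrA -!exprS.
elim=> [|i IH] j; first by rewrite !expr0 mul1r mulr1 scale1r.
rewrite exprS -(mulrA x) IH -scalerAr (mulrA x) xyn -scalerAl scalerA -(mulrA _ x).
by rewrite mulSn exprD mulrC.
Qed.

(** Normally ordered evaluation: powers of [x], given by the inner polynomials, stand to the left of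
    powers of [y]. It is linear but in general not multiplicative. *)
Definition qplane_eval x y (F : {poly {poly K}}) : A :=
  (map_poly (horner_alg x) F).[y].

Lemma qplane_evalE x y F :
  qplane_eval x y F = \sum_(i < size F) horner_alg x F`_i * y ^+ i.
Proof.
rewrite /qplane_eval (@horner_coef_wide _ (size F)) ?size_poly //.
by apply: eq_bigr => i _; rewrite coef_map.
Qed.

Lemma qplane_eval_is_linear x y :
  forall (k : K) (F G : {poly {poly K}}),
    qplane_eval x y (k%:P *: F + G)
              = k *: qplane_eval x y F + qplane_eval x y G.
Proof.
move=> k F G; rewrite /qplane_eval rmorphD hornerD; congr (_ + _).
by rewrite -mul_polyC rmorphM /= map_polyC /= horner_algC hornerCM mulr_algl.
Qed.

Lemma qplane_eval_mon x y i j :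
  qplane_eval x y ('X^i *: 'X^j) = x ^+ i * y ^+ j.
Proof.
rewrite /qplane_eval -mul_polyC rmorphM /= map_polyC map_polyXn hornerCM hornerXn.
by rewrite /= rmorphXn /= horner_algX.
Qed.

(** Comparing left and right multiplication by [x] separates the powers of [y]; doing the same with
    [y] separates the powers of [x] inside the leading coefficient. What is left is one monomial
    times the powers picked up on the way. *)
Lemma qplane_eval_eq0 x y F : x * y = lam *: (y * x) -> F != 0 ->
  qplane_eval x y F = 0 -> exists i j, x ^+ i * y ^+ j = 0.
Proof.
move=> xy F0; rewrite qplane_evalE => e.
set n := size F in e; pose k := n.-1.
have ltk : (k < n)%N by rewrite prednK // lt0n size_poly_eq0.
have xf (f : {poly K}) : x * horner_alg x f = horner_alg x f * x.
  by rewrite -[X in X * _](horner_algX x) -[X in _ = _ * X](horner_algX x)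
     -!rmorphM mulrC.
have {}e : horner_alg x F`_k * y ^+ k * x ^+ n = 0.
  apply: (@eigen_sum0 x n (fun i => horner_alg x F`_i * y ^+ i)
    (fun i => lam ^+ i)) => // [i|]; last exact: in2W expf_nonroot_inj.
  have := qcommuteX xy 1 i; rewrite mul1n !expr1 => xyi.
  by rewrite mulrA xf -(mulrA _ x) xyi -!scalerAr mulrA.
pose f := F`_k; have f0 : f != 0 by rewrite -[f]/(lead_coef F) lead_coef_eq0.
have {}e : \sum_(i < size f) f`_i *: (x ^+ i * y ^+ k * x ^+ n) = 0.
  rewrite -[RHS]e -/f -[in RHS](coefK f) poly_def linear_sum !mulr_suml.
  apply: eq_bigr => i _; rewrite linearZ /= rmorphXn /= horner_algX.
  by rewrite mulr_algl -!scalerAl.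
pose m := (size f).-1.
have ltm : (m < size f)%N by rewrite prednK // lt0n size_poly_eq0.
(* The eigenvalues are now [lam^-1 ^+ (i + n)]; the shift by [n] comes from the factor [x ^+ n]
   gained in the first elimination. *)
have {}e : f`_m *: (x ^+ m * y ^+ k * x ^+ n) * y ^+ size f = 0.
  apply: (@eigen_sum0 y (size f) (fun i => f`_i *: (x ^+ i * y ^+ k * x ^+ n))
    (fun i => lam^-1 ^+ (i + n))) => // [i|i j _ _ /eqP].
    have yx a : y * x ^+ a = lam^-1 ^+ a *: (x ^+ a * y).
      have := qcommuteX xy a 1; rewrite muln1 !expr1 => ->.
      by rewrite scalerA -exprMn mulVf // expr1n scale1r.
    rewrite -scalerAr -scalerAl !scalerA [_ * f`_i]mulrC -scalerA.
    congr (_ *: _); rewrite !mulrA yx -!scalerAl -(mulrA _ y) -exprS exprSr.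
    by rewrite -!mulrA yx -!scalerAr scalerA -exprD.
  rewrite !exprVn (inj_eq invr_inj) => /eqP/expf_nonroot_inj.
  exact: addIn.
move/eqP: e; rewrite -scalerAl -[f`_m]/(lead_coef f) scaler_eq0 lead_coef_eq0 (negPf f0) /= => /eqP {}e.
(* Restores the normal order in the factor [y ^+ k * x ^+ n], up to a non-zero scalar. *)
have ynx a b : y ^+ a * x ^+ b = lam^-1 ^+ (b * a) *: (x ^+ b * y ^+ a).
  by rewrite (qcommuteX xy) scalerA -exprMn mulVf // expr1n scale1r.
exists (m + n)%N, (k + size f)%N; apply/eqP.
rewrite -(inj_eq (scalerI (expf_neq0 (n * k) (invr_neq0 lam0)))) scaler0 -[X in _ == X]e.
rewrite -(mulrA (x ^+ m)) ynx -!scalerAr -!scalerAl; apply/eqP; congr (_ *: _).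
by rewrite !exprD !mulrA.
Qed.

End QuantumPlane.

(** * Simple modules and primitive ideals *)

Section LinearEndomorphisms.
Variable K : fieldType.
Local Notation V := (int -> K^o).

(** Arbitrary functions on the integers are allowed, so weighted shifts need no support condition.
    Linearity is stored as a boolean, hence endomorphisms with the same values are equal. *)
Record lin_end := LinEnd { lin_fun :> V -> V; lin_funP : `[< linear lin_fun >] }.
HB.instance Definition _ := [isSub for lin_fun].
HB.instance Definition _ := [Choice of lin_end by <:].
Implicit Types f g h : lin_end.

Lemma lin_endP f k u v : f (k *: u + v) = k *: f u + f v.
Proof. by have /asboolP := lin_funP f; apply. Qed.

Lemma lin_end0 f : f 0 = 0.
Proof. by have := lin_endP f (-1) 0 0; rewrite scaler0 addr0 scaleN1r addNr. Qed.

Lemma lin_endD f u v : f (u + v) = f u + f v.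
Proof. by have := lin_endP f 1 u v; rewrite !scale1r. Qed.

Lemma lin_endZ f k u : f (k *: u) = k *: f u.
Proof. by have := lin_endP f k u 0; rewrite lin_end0 !addr0. Qed.

Lemma lin_end_eq f g : (forall u, f u = g u) -> f = g.
Proof. by move=> fg; apply/val_inj/funext => u; apply: fg. Qed.

Fact lin_end_zero_proof : `[< linear (fun _ : V => 0 : V) >].
Proof. by apply/asboolP => k u v; rewrite scaler0 addr0. Qed.

Fact lin_end_opp_proof f : `[< linear (fun u => - f u) >].
Proof.
by apply/asboolP => k u v; rewrite lin_endP opprD scalerN.
Qed.

Fact lin_end_add_proof f g : `[< linear (fun u => f u + g u) >].
Proof.
by apply/asboolP => k u v; rewrite !lin_endP scalerDr addrACA.
Qed.

Fact lin_end_one_proof : `[< linear (@id V) >].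
Proof. exact/asboolP. Qed.

Fact lin_end_mul_proof f g : `[< linear (fun u => f (g u)) >].
Proof. by apply/asboolP => k u v; rewrite !lin_endP. Qed.

Fact lin_end_scale_proof k f : `[< linear (fun u => k *: f u) >].
Proof.
by apply/asboolP => l u v; rewrite lin_endP scalerDr !scalerA mulrC.
Qed.

Let addf f g := LinEnd (lin_end_add_proof f g).
Let mulf f g := LinEnd (lin_end_mul_proof f g).
Let scalef k f := LinEnd (lin_end_scale_proof k f).

Fact lin_end_addA : associative addf.
Proof. by move=> f g h; apply: lin_end_eq => u; apply: addrA. Qed.
Fact lin_end_addC : commutative addf.
Proof. by move=> f g; apply: lin_end_eq => u; apply: addrC. Qed.
Fact lin_end_add0 : left_id (LinEnd lin_end_zero_proof) addf.
Proof. by move=> f; apply: lin_end_eq => u; apply: add0r. Qed.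
Fact lin_end_addN :
  left_inverse (LinEnd lin_end_zero_proof) (fun f => LinEnd (lin_end_opp_proof f)) addf.
Proof. by move=> f; apply: lin_end_eq => u; apply: addNr. Qed.

HB.instance Definition _ := GRing.isZmodule.Build lin_end
  lin_end_addA lin_end_addC lin_end_add0 lin_end_addN.

Fact lin_end_mulA : associative mulf.
Proof. by move=> f g h; apply: lin_end_eq. Qed.
Fact lin_end_mul1 : left_id (LinEnd lin_end_one_proof) mulf.
Proof. by move=> f; apply: lin_end_eq. Qed.
Fact lin_end_mulr1 : right_id (LinEnd lin_end_one_proof) mulf.
Proof. by move=> f; apply: lin_end_eq. Qed.
Fact lin_end_mulDl : left_distributive mulf addf.
Proof. by move=> f g h; apply: lin_end_eq. Qed.
Fact lin_end_mulDr : right_distributive mulf addf.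
Proof. by move=> f g h; apply: lin_end_eq => u; apply: lin_endD. Qed.
Fact lin_end_one_neq0 : LinEnd lin_end_one_proof != LinEnd lin_end_zero_proof.
Proof.
apply/eqP => /(congr1 (fun f => lin_fun f (fun=> 1) 0)) /eqP.
by rewrite /= oner_eq0.
Qed.

HB.instance Definition _ := GRing.Zmodule_isNzRing.Build lin_end
  lin_end_mulA lin_end_mul1 lin_end_mulr1 lin_end_mulDl lin_end_mulDr
  lin_end_one_neq0.

Fact lin_end_scaleA a b f : scalef a (scalef b f) = scalef (a * b) f.
Proof. by apply: lin_end_eq => u; apply: scalerA. Qed.
Fact lin_end_scale1 : left_id 1 scalef.
Proof. by move=> f; apply: lin_end_eq => u; apply: scale1r. Qed.
Fact lin_end_scaleDr : right_distributive scalef +%R.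
Proof. by move=> a f g; apply: lin_end_eq => u; apply: scalerDr. Qed.
Fact lin_end_scaleDl f : {morph scalef^~ f : a b / a + b}.
Proof. by move=> a b; apply: lin_end_eq => u; apply: scalerDl. Qed.

HB.instance Definition _ := GRing.Zmodule_isLmodule.Build K lin_end
  lin_end_scaleA lin_end_scale1 lin_end_scaleDr lin_end_scaleDl.

Fact lin_end_scaleAl (k : K) f g : k *: (f * g) = k *: f * g.
Proof. exact: lin_end_eq. Qed.
HB.instance Definition _ := GRing.Lmodule_isLalgebra.Build K lin_end lin_end_scaleAl.

Fact lin_end_scaleAr (k : K) f g : k *: (f * g) = f * (k *: g).
Proof. by apply: lin_end_eq => u; apply/esym/lin_endZ. Qed.
HB.instance Definition _ := GRing.Lalgebra_isAlgebra.Build K lin_end lin_end_scaleAr.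

Lemma lin_end_mulE f g u : (f * g) u = f (g u). Proof. by []. Qed.
Lemma lin_end_addE f g u : (f + g) u = f u + g u. Proof. by []. Qed.
Lemma lin_end_oppE f u : (- f) u = - f u. Proof. by []. Qed.
Lemma lin_end_scaleE k f u : (k *: f) u = k *: f u. Proof. by []. Qed.
Lemma lin_end_zeroE u : (0 : lin_end) u = 0. Proof. by []. Qed.
Lemma lin_end_oneE u : (1 : lin_end) u = u. Proof. by []. Qed.

End LinearEndomorphisms.

(** * Quotients by left ideals and existence of simple modules *)

Section LeftIdeals.
Variable A : nzRingType.
Implicit Types (L : set A).

Definition left_ideal L : Prop :=
  [/\ L 0, forall x y, L x -> L y -> L (x + y) & forall a x, L x -> L (a * x)].

Section Quotient.
Variables (L : set A) (idL : left_ideal L).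

(** The proof is an argument so that the closure instance can be inferred from the term
    [left_pred idL] alone. *)
Definition left_pred of left_ideal L : {pred A} := fun x => `[< L x >].

Fact left_pred_zmod_closed : zmod_closed (left_pred idL).
Proof.
have [L0 LD LM] := idL; split; first exact/asboolP.
move=> x y /asboolP Lx /asboolP Ly; apply/asboolP; apply: (LD x) => //.
by rewrite -mulN1r; apply: LM.
Qed.
HB.instance Definition _ :=
  GRing.isZmodClosed.Build A (left_pred idL) left_pred_zmod_closed.

Definition left_quot : Type := Quotient.quot (left_pred idL : zmodClosed A).
HB.instance Definition _ := GRing.Zmodule.on left_quot.

Definition to_left_quot (x : A) : left_quot := (\pi_left_quot x)%qT.

Lemma to_left_quot_eq x y : to_left_quot x = to_left_quot y <-> L (x - y).
Proof.
split=> [/eqP|Lxy]; last apply/eqP.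
  by rewrite -Quotient.idealrBE => /asboolP.
by rewrite -Quotient.idealrBE; apply/asboolP.
Qed.

Lemma to_left_quot_repr (x : left_quot) : to_left_quot (repr x) = x.
Proof. exact: reprK. Qed.

Fact to_left_quot_is_zmod_morphism : zmod_morphism to_left_quot.
Proof. by move=> x y; rewrite /to_left_quot !piE. Qed.
HB.instance Definition _ := GRing.isZmodMorphism.Build A left_quot to_left_quot
  to_left_quot_is_zmod_morphism.

Definition left_quot_scale (a : A) (x : left_quot) := to_left_quot (a * repr x).

Lemma left_quot_scale_pi a x :
  left_quot_scale a (to_left_quot x) = to_left_quot (a * x).
Proof.
apply/to_left_quot_eq; rewrite -mulrBr.
have [_ _ LM] := idL; apply: LM.
by apply/to_left_quot_eq; rewrite to_left_quot_repr.
Qed.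

Fact left_quot_scaleA a b x :
  left_quot_scale a (left_quot_scale b x) = left_quot_scale (a * b) x.
Proof. by rewrite -(to_left_quot_repr x) !left_quot_scale_pi mulrA. Qed.

Fact left_quot_scale1 : left_id 1 left_quot_scale.
Proof. by move=> x; rewrite -(to_left_quot_repr x) left_quot_scale_pi mul1r. Qed.

Fact left_quot_scaleDr : right_distributive left_quot_scale +%R.
Proof.
move=> a x y; rewrite -(to_left_quot_repr x) -(to_left_quot_repr y).
by rewrite -raddfD !left_quot_scale_pi -raddfD mulrDr.
Qed.

Fact left_quot_scaleDl x : {morph left_quot_scale^~ x : a b / a + b}.
Proof.
move=> a b; rewrite -(to_left_quot_repr x).
by rewrite !left_quot_scale_pi -raddfD mulrDl.
Qed.

HB.instance Definition _ := GRing.Zmodule_isLmodule.Build A left_quot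
  left_quot_scaleA left_quot_scale1 left_quot_scaleDr left_quot_scaleDl.

Lemma to_left_quotM a x : to_left_quot (a * x) = a *: to_left_quot x.
Proof. by rewrite -left_quot_scale_pi. Qed.

End Quotient.

Lemma maximal_left_ideal L0 : left_ideal L0 -> ~ L0 1 ->
  exists L, [/\ left_ideal L, ~ L 1, L0 `<=` L &
    forall L', left_ideal L' -> L `<=` L' -> ~ L' 1 -> L' `<=` L].
Proof.
move=> [L00 L0D L0M] L01.
pose good (L : set A) := [/\ left_ideal L, ~ L 1 & L0 `<=` L].
have [|L [PL maxL]] := @Zorn_bigcup _ (fun L => L = set0 \/ good L).
  move=> F FP Ftot.
  have [[X [FX gX]]|noX] := pselect (exists X, F X /\ good X); last first.
    left; rewrite -subset0 => x [X FX Xx]; case: (FP X FX) => [X0|gX].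
      by rewrite X0 in Xx.
    by case: noX; exists X.
  have gF Y y : F Y -> Y y -> good Y.
    by move=> FY; case: (FP Y FY) => // ->.
  right; have [_ _ L0X] := gX; split=> [|[Y FY Y1]|x /L0X Xx]; last by exists X.
    split=> [|x y [Y FY Yx] [Z FZ Zy]|a x [Y FY Yx]].
    - by exists X => //; apply: L0X.
    - have [YZ|ZY] := Ftot _ _ FY FZ.
        by have [[_ D _] _ _] := gF _ _ FZ Zy; exists Z => //; apply: D => //; apply: YZ.
      by have [[_ D _] _ _] := gF _ _ FY Yx; exists Y => //; apply: D => //; apply: ZY.
    - by have [[_ _ M] _ _] := gF _ _ FY Yx; exists Y => //; apply: M.
  by have [_] := gF _ _ FY Y1.
have gL0 : good L0 by do !split.
have {PL}[idL L1 L0L] : good L.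
  case: PL => // e; case: (maxL L0); last by right.
  by rewrite e; split=> // /(_ _ L00).
exists L; split=> // L' idL' LL' L'1; apply: contrapT => L'L.
case: (maxL L'); last by right; split=> //; apply: subset_trans LL'.
by split.
Qed.

(** The module is the quotient by a maximal left ideal above [L0], and [v] is the class of 1.
    Choosing [L0] thus prescribes relations for a vector of a simple module. *)
Lemma exists_simple_module L0 : left_ideal L0 -> ~ L0 1 ->
  exists2 M : lmodType A, simple_module M &
    exists2 v : M, v != 0 & forall a, L0 a -> a *: v = 0.
Proof.
move=> /maximal_left_ideal h /h [L [idL L1 L0L maxL]].
have [L00 LD LM] := idL.
have piE a : to_left_quot idL a = a *: to_left_quot idL 1.
  by rewrite -to_left_quotM mulr1.
have pi0 a : to_left_quot idL a = 0 <-> L a.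
  by rewrite -(raddf0 (to_left_quot idL)) to_left_quot_eq subr0.
have v0 : to_left_quot idL 1 != 0 by apply/eqP => /pi0.
exists (left_quot idL); last first.
  by exists (to_left_quot idL 1) => // a /L0L La; rewrite -piE; apply/pi0.
split=> [e|N [N0 ND NM]].
  by move/eqP: v0; apply; have := I : [set: left_quot idL] (to_left_quot idL 1); rewrite e.
have [N1|N1] := pselect (N (to_left_quot idL 1)); [right|left].
  apply/seteqP; split=> // x _; rewrite -(to_left_quot_repr x) piE.
  exact: NM.
apply/seteqP; split=> [x Nx|x ->//]; rewrite -(to_left_quot_repr x).
apply/pi0; apply: (maxL [set a | N (to_left_quot idL a)]) => //=; last first.
- by rewrite to_left_quot_repr.
- by move=> a La /=; rewrite (pi0 a).2.
split=> [|a b Na Nb|a b Nb] /=; first by rewrite raddf0.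
  by rewrite raddfD; apply: ND.
by rewrite to_left_quotM; apply: NM.
Qed.

End LeftIdeals.

Section PrimitiveIdeals.
Variable A : nzRingType.
Implicit Types (P I : set A) (M : lmodType A).

Lemma two_sided_left I : two_sided_ideal I -> left_ideal I.
Proof. by case. Qed.

Lemma simple_cyclic M (v w : M) : simple_module M -> v != 0 -> exists a, w = a *: v.
Proof.
move=> [_ sM] v0; have [||e] := sM [set w | exists a, w = a *: v].
- split=> [|_ _ [a ->] [b ->]|a _ [b ->]].
  + by exists 0; rewrite scale0r.
  + by exists (a + b); rewrite scalerDl.
  + by exists (a * b); rewrite scalerA.
- move/seteqP => [/(_ v)] h _; case/eqP: v0; apply: h.
  by exists 1; rewrite scale1r.
- by have := I : [set: M] w; rewrite -e.
Qed.

Lemma simple_neq0 M : simple_module M -> exists v : M, v != 0.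
Proof.
move=> [M0 _]; apply: contrapT => h; apply: M0; apply/seteqP; split=> // v _ /=.
by apply: contrapT => v0; apply: h; exists v; apply/eqP.
Qed.

Lemma annihilator_ideal M : two_sided_ideal (annihilator M).
Proof.
split=> [v|x y x0 y0 v|a x x0 v|a x x0 v]; first exact: scale0r.
- by rewrite scalerDl x0 y0 addr0.
- by rewrite -scalerA x0 scaler0.
- by rewrite -scalerA x0.
Qed.

Lemma annihilator1 M : simple_module M -> ~ annihilator M 1.
Proof. by move/simple_neq0 => [v /eqP v0] /(_ v); rewrite scale1r. Qed.

(** If [y] in [J] has [y *: v != 0], this vector generates [M], so an [x] in [I] acts on [M] through
    elements [x * a * y] of the product ideal. *)
Lemma primitive_prime P : left_primitive P -> prime_ideal P.
Proof.
move=> [M sM ->]; split; first exact: annihilator_ideal.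
  by move=> e; have := annihilator1 sM; rewrite e; apply.
move=> I J [_ _ _ IMr] _ IJ.
have [?|JM] := pselect (J `<=` annihilator M); [by right|left].
have [y [v [Jy yv0]]] : exists y (v : M), J y /\ y *: v != 0.
  apply: contrapT => h; apply: JM => y Jy v; apply: contrapT => yv.
  by apply: h; exists y, v; split=> //; apply/eqP.
move=> x Ix w; have [a ->] := simple_cyclic w sM yv0.
by rewrite !scalerA -mulrA mulrA; apply: IJ => //; apply: IMr.
Qed.

(** Take a simple module with a generator killed by [P]. As [P] is two-sided it kills the whole
    module, and maximality leaves no larger annihilator. *)
Lemma maximal_primitive P : two_sided_ideal P -> ~ P 1 ->
  (forall I, two_sided_ideal I -> P `<=` I -> ~ I 1 -> I `<=` P) ->
  left_primitive P.
Proof.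
move=> idP P1 maxP.
have [M sM [v v0 Pv]] := exists_simple_module (two_sided_left idP) P1.
have PA : P `<=` annihilator M.
  move=> x Px w; have [a ->] := simple_cyclic w sM v0.
  by rewrite scalerA; apply: Pv; have [_ _ _ PM] := idP; apply: PM.
exists M => //; apply/seteqP; split=> //.
by apply: maxP => //; [apply: annihilator_ideal | apply: annihilator1].
Qed.

End PrimitiveIdeals.

(** * Central elements acting on simple modules over an uncountable field *)

Section Schur.
Variables (K : closedFieldType) (A : algType K).
Hypothesis uncountableK : ~ countable [set: K].
Variable w : nat -> A.
Hypothesis spanw : forall x, lspan (range w) x.

(** Polynomials serve as finitely supported sequences of coefficients, their size bounding which
    [w i] occur. *)
Definition seq_comb (p : {poly K}) : A := \sum_(i < size p) p`_i *: w i.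

Lemma seq_comb_wide n (p : {poly K}) : (size p <= n)%N ->
  seq_comb p = \sum_(i < n) p`_i *: w i.
Proof.
move=> le; rewrite /seq_comb (big_ord_widen n (fun i => p`_i *: w i) le) big_mkcond.
apply: eq_bigr => i _; case: ltnP => // h; by rewrite nth_default // scale0r.
Qed.

Lemma seq_comb_surj x : exists p, x = seq_comb p.
Proof.
elim: (spanw x) => [|k y z [n _ <-] _ [p ->]].
  by exists 0; rewrite /seq_comb size_poly0 big_ord0.
pose N := maxn n.+1 (size p); exists (k *: 'X^n + p).
rewrite !(@seq_comb_wide N) ?leq_maxr //; last first.
  rewrite (leq_trans (size_polyD _ _)) // geq_max leq_maxr andbT.
  by rewrite (leq_trans (size_scale_leq _ _)) // size_polyXn leq_maxl.
have ltn : (n < N)%N by rewrite leq_maxl.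
rewrite [in RHS](eq_bigr (fun i : 'I_N => (k *: 'X^n)`_i *: w i + p`_i *: w i)).
  rewrite [RHS]big_split [in RHS](bigD1 (Ordinal ltn)) //= coefZ coefXn eqxx mulr1.
  rewrite [X in _ + X + _]big1 ?addr0 // => i /eqP ne; rewrite coefZ coefXn.
  case: eqP => [e|_]; last by rewrite mulr0 scale0r.
  by case: ne; apply/val_inj.
by move=> i _; rewrite coefD scalerDl.
Qed.

(** A matrix with [n.+1] rows and [n] columns has a non-zero left kernel vector. *)
Lemma dependent_comb n (p : 'I_n.+1 -> {poly K}) : (forall i, size (p i) <= n)%N ->
  exists2 k : 'I_n.+1 -> K, exists i, k i != 0 & \sum_i k i *: seq_comb (p i) = 0.
Proof.
move=> sp; pose M : 'M[K]_(n.+1, n) := \matrix_(i, j) (p i)`_j.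
have : kermx M != 0.
  by rewrite kermx_eq0 /row_free neq_ltn ltnS rank_leq_col.
move=> /rowV0Pn[v /sub_kermxP vM v0]; exists (fun i => v 0 i).
  apply: contrapT => h; move/eqP: v0; apply; apply/rowP => i; rewrite mxE.
  by apply: contrapT => vi; apply: h; exists i; apply/eqP.
under eq_bigr => i _ do rewrite (seq_comb_wide (sp i)) scaler_sumr.
rewrite exchange_big big1 // => j _.
have := congr1 (fun u : 'rV_n => u 0 j) vM; rewrite !mxE => e.
rewrite -[RHS](scale0r (w j)) -[in RHS]e scaler_suml; apply: eq_bigr => i _.
by rewrite scalerA mxE.
Qed.

(* Otherwise [M] is a vector space over the field of rational functions in [c]:
   the vectors [(c - a)^-1 v] are linearly independent, and there are too many. *)
Lemma central_acts_by_scalar (M : lmodType A) (c : A) : simple_module M ->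
  (forall x (v : M), c *: (x *: v) = x *: (c *: v)) ->
  exists a : K, forall v : M, c *: v = a%:A *: v.
Proof.
move=> sM cC; apply: contrapT => noa.
have polC p x (v : M) : horner_alg c p *: (x *: v) = x *: (horner_alg c p *: v).
  elim/poly_ind: p v => [|p k IH] v; first by rewrite !raddf0 !scale0r scaler0.
  rewrite rmorphD rmorphM /= horner_algX horner_algC !scalerDl -!scalerA.
  rewrite scalerDr -(IH (c *: v)) -cC; congr (_ + _).
  by rewrite !scalerA mulr_algl mulr_algr.
have nz a : exists v : M, horner_alg c ('X - a%:P) *: v <> 0.
  apply: contrapT => h; apply: noa; exists a => v; apply/eqP.
  rewrite -subr_eq0 -scalerBl; apply/eqP; apply: contrapT => va.
  by apply: h; exists v; rewrite rmorphB /= horner_algX horner_algC.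
have inj1 a (v : M) : horner_alg c ('X - a%:P) *: v = 0 -> v = 0.
  move=> va; apply: contrapT => /eqP v0; have [u ua] := nz a; apply: ua.
  by have [x ->] := simple_cyclic u sM v0; rewrite polC va scaler0.
(* As [K] is algebraically closed, [p] is a product of linear factors, each of them injective on
   [M]. *)
have injp p (v : M) : p != 0 -> horner_alg c p *: v = 0 -> v = 0.
  move=> p0; have [r ->] := closed_field_poly_normal p.
  have lcV : (lead_coef p)^-1%:A * (lead_coef p)%:A = 1 :> A.
    by rewrite mulr_algl scalerA mulVf ?lead_coef_eq0 // scale1r.
  rewrite -mul_polyC rmorphM /= horner_algC -scalerA.
  move=> /(congr1 ( *:%R (lead_coef p)^-1%:A)); 
  rewrite scaler0 (scalerA (lead_coef p)^-1%:A) lcV scale1r.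
  elim: r v => [|a r IH] v; first by rewrite big_nil rmorph1 scale1r.
  by rewrite big_cons rmorphM /= -scalerA => /inj1/IH.
have surj1 a (v : M) : exists x, horner_alg c ('X - a%:P) *: (x *: v) = v \/ v = 0.
  have [->|v0] := eqVneq v 0; first by exists 0; right.
  have [x e] : exists x, v = x *: (horner_alg c ('X - a%:P) *: v).
    apply: simple_cyclic => //; apply/eqP => /inj1 e; by rewrite e eqxx in v0.
  by exists x; left; rewrite polC -e.
have [v v0] := simple_neq0 sM.
have /choice[p pE] : forall a, exists p : {poly K},
    horner_alg c ('X - a%:P) *: (seq_comb p *: v) = v.
  move=> a; have [x [e|e]] := surj1 a v; last by rewrite e eqxx in v0.
  by have [p xE] := seq_comb_surj x; exists p; rewrite -xE.
(* [K] is uncountable and sizes are natural numbers, so one bound [n] serves infinitely many [a], in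
   particular [n.+1] of them. *)
have [n infn] : exists n, infinite_set [set a | (size (p a) <= n)%N].
  apply: contrapT => h; apply: uncountableK.
  have -> : [set: K] = \bigcup_n [set a | (size (p a) <= n)%N].
    by apply/seteqP; split=> // a _; exists (size (p a)) => /=.
  apply: bigcup_countable => // n _; apply: finite_set_countable.
  by apply: contrapT => inf; apply: h; exists n.
have [B BE leB] := infinite_set_fset n.+1 infn.
pose a (i : 'I_n.+1) : K := nth 0 (enum_fset B) i.
have aB i : (size (p (a i)) <= n)%N.
  by apply: BE; apply: mem_nth; apply: leq_trans leB.
have ainj : injective a.
  move=> i j /eqP; rewrite nth_uniq ?fset_uniq ?(leq_trans _ leB) //.
  by move=> /eqP e; apply/val_inj.
have [k [i0 ki0] k0] := dependent_comb aB.
(* The numerator of the sum of the fractions [k i / ('X - a i)]. It is non-zero because only the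
   summand [i0] survives at [a i0]. *)
pose f := \sum_i k i *: \prod_(j | j != i) ('X - (a j)%:P).
have f0 : f != 0.
  apply/eqP => /(congr1 (fun g => g.[a i0])); rewrite horner0 horner_sum.
  rewrite (bigD1 i0) //= hornerZ horner_prod.
  rewrite [X in _ + X]big1 ?addr0 => [/eqP|i ne]; last first.
    by rewrite hornerZ horner_prod (bigD1 i0) 1?eq_sym //= hornerXsubC subrr mul0r mulr0.
  rewrite mulf_eq0 (negPf ki0) /= => /prodf_eq0[j ne].
  rewrite hornerXsubC subr_eq0 => /eqP/ainj e; by rewrite e eqxx in ne.
move/eqP: v0; apply; apply: (injp f) => //.
rewrite /f rmorph_sum scaler_suml.
have := congr1 (fun x => horner_alg c (\prod_j ('X - (a j)%:P)) *: (x *: v)) k0.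
rewrite scale0r scaler0 scaler_suml scaler_sumr => e; rewrite -[RHS]e.
apply: eq_bigr => i _; rewrite [in RHS](bigD1 i) //= [in RHS]mulrC.
rewrite -mul_polyC !rmorphM /= horner_algC -!scalerA -[k i *: seq_comb _]mulr_algl.
by rewrite -scalerA (polC _ (k i)%:A) pE polC.
Qed.

End Schur.

(** * Commutation relations and spanning monomials *)

(* The six elements are kept abstract, rather than being those of [Uplus q], as
   the relations are needed in every quotient of [Uplus q]. *)
Record serre_elements (K : fieldType) (q : K) (A : algType K)
    (x y e3 e3bar z z' : A) : Prop := SerreElements {
  serre1_eq : x ^+ 2 * y - (q ^+ 2 + q ^- 2) *: (x * y * x) + y * x ^+ 2 = 0;
  serre2_eq : y ^+ 3 * x - (q ^+ 2 + 1 + q ^- 2) *: (y ^+ 2 * x * y)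
    + (q ^+ 2 + 1 + q ^- 2) *: (y * x * y ^+ 2) - x * y ^+ 3 = 0;
  e3_eq : e3 = x * y - q ^+ 2 *: (y * x);
  e3bar_eq : e3bar = x * y - q ^- 2 *: (y * x);
  z_eq : z = y * e3 - q ^+ 2 *: (e3 * y);
  z'_eq : z' = (1 - q ^- 2) *: (e3 * e3bar + (1 + q ^- 2) *: (z * x))
}.

Section Relations.
Variables (K : fieldType) (q : K) (A : algType K) (x y e3 e3bar z z' : A).
Hypotheses (q0 : q != 0) (qX : forall n, (0 < n)%N -> q ^+ n != 1).
Hypothesis rels : serre_elements q x y e3 e3bar z z'.

Let serre1_xy := serre1_eq rels.
Let serre2_xy := serre2_eq rels.
Let e3E := e3_eq rels.
Let e3barE := e3bar_eq rels.
Let zE := z_eq rels.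
Let z'E := z'_eq rels.

Lemma sub1q2_neq0 : 1 - q ^- 2 != 0.
Proof. by rewrite subr_eq0 eq_sym invr_eq1 qX. Qed.

Lemma sub1q4_neq0 : 1 - q ^- 4 != 0.
Proof. by rewrite subr_eq0 eq_sym invr_eq1 qX. Qed.

Lemma subq2_neq0 : q ^+ 2 - q ^- 2 != 0.
Proof.
have -> : q ^+ 2 - q ^- 2 = q ^+ 2 * (1 - q ^- 4) by field.
by rewrite mulf_neq0 ?sub1q4_neq0 // expf_neq0.
Qed.

Lemma add1q2_neq0 : 1 + q ^- 2 != 0.
Proof.
have: (1 - q ^- 2) * (1 + q ^- 2) != 0.
  have -> : (1 - q ^- 2) * (1 + q ^- 2) = 1 - q ^- 4 by field.
  exact: sub1q4_neq0.
by rewrite mulf_eq0 negb_or => /andP[].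
Qed.

Lemma rel_yx : y * x = q ^- 2 *: (x * y) - q ^- 2 *: e3.
Proof. by rewrite e3E; noncomm K [:: x; y] => //; field. Qed.

Lemma rel_e3bar : e3bar = e3 + (q ^+ 2 - q ^- 2) *: (y * x).
Proof. by rewrite e3barE e3E; noncomm K [:: x; y] => //; field. Qed.

(** The difference of the two sides is exactly the first Serre relator. *)
Lemma rel_x_e3 : x * e3 = q ^- 2 *: (e3 * x).
Proof.
rewrite -[RHS]addr0 -serre1_xy e3E.
by noncomm K [:: x; y] => //; field.
Qed.

Lemma rel_e3_x : e3 * x = q ^+ 2 *: (x * e3).
Proof. by rewrite rel_x_e3 scalerA mulfV ?scale1r // expf_neq0. Qed.

Lemma rel_x_e3bar : x * e3bar = q ^+ 2 *: (e3bar * x).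
Proof.
rewrite -[RHS]addr0 -serre1_xy e3barE.
by noncomm K [:: x; y] => //; field.
Qed.

Lemma rel_y_e3 : y * e3 = q ^+ 2 *: (e3 * y) + z.
Proof. by rewrite zE addrC subrK. Qed.

Lemma rel_y_e3bar : y * e3bar = q ^- 2 *: (e3bar * y) + q ^- 4 *: z.
Proof. by rewrite zE e3barE e3E; noncomm K [:: x; y] => //; field. Qed.

Lemma rel_x_z : x * z = z * x.
Proof.
(* The commutator of [x] and [z] is [q ^+ 2] times the commutator of [y] with the first Serre
   relator, inserted here in place of zeros. *)
rewrite -[RHS]addr0 -(scaler0 _ (q ^+ 2)) -(subrr (0 : A)) -{1}(mulr0 y).
rewrite -{2}(mul0r y) -serre1_xy zE e3E.
by noncomm K [:: x; y] => //; field.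
Qed.

(** The commutator of [y] and [z] is [- q ^+ 2] times the second Serre relator. *)
Lemma rel_y_z : y * z = z * y.
Proof.
rewrite -[RHS]addr0 -(scaler0 _ (- q ^+ 2)) -serre2_xy zE e3E.
by noncomm K [:: x; y] => //; field.
Qed.

Lemma rel_e3_z : e3 * z = z * e3.
Proof.
have xyz : x * y * z = z * (x * y) by rewrite -mulrA rel_y_z mulrA rel_x_z mulrA.
have yxz : y * x * z = z * (y * x) by rewrite -mulrA rel_x_z mulrA rel_y_z mulrA.
by rewrite e3E mulrBl mulrBr -scalerAl -scalerAr xyz yxz.
Qed.

Lemma rel_e3_e3bar :
  e3 * e3bar = (1 - q ^- 2)^-1 *: z' - (1 + q ^- 2) *: (z * x).
Proof. by rewrite z'E scalerA mulVf ?scale1r ?addrK // sub1q2_neq0. Qed.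

Lemma rel_e3bar_e3 :
  e3bar * e3 = (1 - q ^- 2)^-1 *: z' - (q ^- 2 * (1 + q ^- 2)) *: (z * x).
Proof.
have -> : e3bar * e3 = e3 * e3bar + (1 - q ^- 4) *: (z * x).
  rewrite rel_e3bar mulrDl mulrDr -[RHS]addrA; congr (_ + _).
  rewrite -scalerAl -mulrA rel_x_e3 -scalerAr mulrA rel_y_e3.
  by noncomm K [:: x; y; e3; z] => //; field.
rewrite rel_e3_e3bar -addrA; congr (_ + _); rewrite -scaleNr -scalerDl -scaleNr.
by congr (_ *: _); field.
Qed.

(** Solving the definition of [z'] for [e3 * e3] trades a square of [e3] for a multiple of [z'] and
    terms of degree at most one in [e3]; hence the exponent of [e3] in [q_mon] can be a boolean. *)
Lemma rel_e3_sqr :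
  e3 * e3 = (q ^+ 4 / (1 - q ^- 2)) *: z' - ((q ^+ 4 - 1) * q ^+ 2) *: (x * (e3 * y))
    - (q ^+ 4 * (1 + q ^- 2)) *: (z * x).
Proof.
rewrite z'E scalerA mulfVK ?sub1q2_neq0 // rel_e3bar mulrDr rel_yx mulrA rel_x_e3.
by noncomm K [:: x; y; e3; z] => //; field.
Qed.

Lemma rel_x_z' : x * z' = z' * x.
Proof.
rewrite z'E -scalerAl -scalerAr; congr (_ *: _); rewrite mulrDr mulrDl.
rewrite mulrA rel_x_e3 -scalerAl -mulrA rel_x_e3bar -scalerAr scalerA.
rewrite mulVf ?expf_neq0 //.
by rewrite scale1r mulrA -scalerAl -scalerAr mulrA rel_x_z.
Qed.

Lemma rel_y_z' : y * z' = z' * y.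
Proof.
rewrite z'E -scalerAl -scalerAr; congr (_ *: _); rewrite mulrDr mulrDl.
rewrite mulrA rel_y_e3 mulrDl -scalerAl -(mulrA e3) rel_y_e3bar.
rewrite -scalerAr (mulrA y) rel_y_z mulrDr -!scalerAr rel_e3_z e3barE e3E.
by noncomm K [:: x; y; z] => //; field.
Qed.

(** A quantum integer up to a power of [q]: the coefficient of the correction term when [y] moves
    past [x ^+ m]. It vanishes for no positive [m], as [q] is not a root of unity. *)
Definition q_gamma m : K := q ^- 2 * \sum_(i < m) q ^- 4 ^+ i.

Lemma q_gamma_neq0 m : q_gamma m.+1 != 0.
Proof.
rewrite mulf_neq0 ?invr_neq0 ?expf_neq0 //.
have: 1 - (q ^- 4) ^+ m.+1 != 0.
  by rewrite subr_eq0 eq_sym exprVn invr_eq1 -exprM qX.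
rewrite -[X in X - _](expr1n _ m.+1) subrXX mulf_eq0 negb_or => /andP[_].
by congr (_ != 0); apply: eq_bigr => i _; rewrite expr1n mul1r.
Qed.

Lemma rel_e3_xn i : e3 * x ^+ i = q ^+ 2 ^+ i *: (x ^+ i * e3).
Proof. by have := qcommuteX rel_e3_x 1 i; rewrite mul1n !expr1. Qed.

Lemma rel_y_xn m :
  y * x ^+ m.+1 = q ^- 2 ^+ m.+1 *: (x ^+ m.+1 * y) - q_gamma m.+1 *: (e3 * x ^+ m).
Proof.
elim: m => [|m IH].
  by rewrite /q_gamma big_ord1 !expr0 !expr1 !mulr1 rel_yx.
rewrite exprSr mulrA IH mulrBl -!scalerAl -(mulrA _ y) rel_yx -(mulrA e3) -exprSr.
rewrite mulrBr -!scalerAr mulrA -exprSr scalerBr !scalerA -exprSr -addrA -opprD.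
congr (_ - _); have := rel_e3_xn m.+1.
move=> /(congr1 ( *:%R (q ^- 2 ^+ m.+1))); rewrite scalerA -exprMn mulVf ?expf_neq0 //.
rewrite expr1n scale1r => <-.
rewrite scalerA -scalerDl; congr (_ *: _).
rewrite /q_gamma [in RHS]big_ord_recr /= mulrDr addrC; congr (_ + _).
by rewrite exprS -mulrA -exprMn -invfM -exprD.
Qed.

(** At [j = 0] the truncated [j.-1] does no harm, the sum in front of it being empty. *)
Lemma rel_y_e3n j :
  y * e3 ^+ j = q ^+ 2 ^+ j *: (e3 ^+ j * y)
    + (\sum_(i < j) q ^+ 2 ^+ i) *: (e3 ^+ j.-1 * z).
Proof.
elim: j => [|j IH]; first by rewrite big_ord0 scale0r addr0 !expr0 mulr1 mul1r scale1r.
rewrite [in LHS]exprSr mulrA IH mulrDl -!scalerAl -(mulrA _ y) rel_y_e3 mulrDr scalerDr.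
rewrite -scalerAr scalerA -(exprSr (q ^+ 2)) (mulrA _ e3) -(exprSr e3) -addrA.
congr (_ + _); rewrite -(mulrA _ z) -rel_e3_z mulrA -(exprSr e3).
rewrite big_ord_recr /= scalerDl addrC; congr (_ + _).
by case: j {IH} => [|j] //=; rewrite big_ord0 !scale0r.
Qed.

End Relations.

Section Spanning.
Variables (K : fieldType) (q : K) (A : algType K) (x y e3 e3bar z z' : A).
Hypotheses (q0 : q != 0) (qX : forall n, (0 < n)%N -> q ^+ n != 1).
Hypothesis rels : serre_elements q x y e3 e3bar z z'.
Hypothesis gen : forall T : set A, subspace T -> T 1 ->
  (forall w, T w -> T (x * w)) -> (forall w, T w -> T (y * w)) -> forall w, T w.

Lemma central_of_gens (c : A) : x * c = c * x -> y * c = c * y ->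
  forall w, w * c = c * w.
Proof.
move=> c1 c2; apply: gen => [||w|w].
- split=> [|k u v uc vc]; first by rewrite mul0r mulr0.
  by rewrite mulrDl mulrDr -scalerAl -scalerAr uc vc.
- by rewrite mul1r mulr1.
- by rewrite -mulrA => ->; rewrite !mulrA c1.
- by rewrite -mulrA => ->; rewrite !mulrA c2.
Qed.

Definition q_mon : set A :=
  [set w | exists c (eps : bool) d, w = x ^+ c * (e3 ^+ eps * y ^+ d)].

Definition q_zmon : set A :=
  [set w | exists v i j, q_mon v /\ w = v * (z ^+ i * z' ^+ j)].

(** It suffices that the span is stable under left multiplication by [x] and [y]. Moving [y] past
    [x ^+ c] creates a factor [e3], which either stays or meets another [e3] and is removed by
    [rel_e3_sqr]; the central [z] and [z'] move to the right. *)
Lemma zmon_span w : lspan q_zmon w.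
Proof.
have zC := central_of_gens (rel_x_z q0 rels) (rel_y_z q0 rels).
have z'C := central_of_gens (rel_x_z' q0 rels) (rel_y_z' q0 rels).
have sub := lspan_subspace q_zmon.
have Sx v : lspan q_zmon v -> lspan q_zmon (x * v).
  apply: lspan_mull => // _ [_ [i [j [[c [eps [d ->]]] ->]]]].
  apply: lspan_gen; exists (x ^+ c.+1 * (e3 ^+ eps * y ^+ d)), i, j.
  by split; [exists c.+1, eps, d | rewrite exprS !mulrA].
have Sxn n v : lspan q_zmon v -> lspan q_zmon (x ^+ n * v).
  move=> Sv; elim: n => [|n IH]; first by rewrite mul1r.
  by rewrite exprS -mulrA; apply: Sx.
have Szz eps d i j : lspan q_zmon (e3 ^+ (eps : bool) * y ^+ d * (z ^+ i * z' ^+ j)).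
  apply: lspan_gen; exists (e3 ^+ eps * y ^+ d), i, j; split=> //.
  by exists 0%N, eps, d; rewrite mul1r.
have S0 d i j : lspan q_zmon (y ^+ d * (z ^+ i * z' ^+ j)).
  by have := Szz false d i j; rewrite mul1r.
have S1 d i j : lspan q_zmon (e3 * (y ^+ d * (z ^+ i * z' ^+ j))).
  by have := Szz true d i j; rewrite expr1 -mulrA.
have zS d i j : z * (y ^+ d * (z ^+ i * z' ^+ j)) = y ^+ d * (z ^+ i.+1 * z' ^+ j).
  by rewrite exprS -(mulrA z) mulrA -zC -mulrA.
have z'S d i j : z' * (y ^+ d * (z ^+ i * z' ^+ j)) = y ^+ d * (z ^+ i * z' ^+ j.+1).
  by rewrite -z'C -!mulrA -exprSr.
have Se3 eps d i j :
    lspan q_zmon (e3 * (e3 ^+ (eps : bool) * (y ^+ d * (z ^+ i * z' ^+ j)))).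
  case: eps; last by rewrite mul1r.
  rewrite expr1 mulrA (rel_e3_sqr q0 qX rels) !mulrBl -!scalerAl z'S.
  rewrite -(zC x) -!mulrA (mulrA y) -exprS zS.
  apply: subspaceB => //; last by apply: subspaceZ => //; apply: Sx.
  apply: subspaceB => //; first by apply: subspaceZ.
  by apply: subspaceZ => //; apply: Sx.
have Sy eps d i j :
    lspan q_zmon (y * (e3 ^+ (eps : bool) * (y ^+ d * (z ^+ i * z' ^+ j)))).
  case: eps; last by rewrite mul1r mulrA -exprS.
  rewrite expr1 mulrA (rel_y_e3 rels) mulrDl -scalerAl -mulrA (mulrA y) -exprS zS.
  by apply: subspaceD => //; apply: subspaceZ.
move: w; apply: gen => // [|w].
  by have := S0 0%N 0%N 0%N; rewrite !expr0 !mulr1.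
apply: lspan_mull => // _ [_ [i [j [[c [eps [d ->]]] ->]]]].
rewrite -!mulrA; case: c => [|c]; first by rewrite mul1r.
rewrite (mulrA y) (rel_y_xn q0 rels) mulrBl -!scalerAl.
apply: subspaceB => //; apply: subspaceZ => //; first by rewrite -mulrA; apply: Sxn.
rewrite (rel_e3_xn q0 rels) -scalerAl -mulrA; apply: subspaceZ => //.
exact: Sxn.
Qed.

(** Allowing every large bound [N] lets two decompositions be added over a common range. *)
Lemma zmon_decomposition w : exists2 X : nat -> nat -> A,
  forall i j, lspan q_mon (X i j) &
  exists n, forall N, (n <= N)%N ->
    w = \sum_(i < N) \sum_(j < N) X i j * (z ^+ i * z' ^+ j).
Proof.
elim: {w} (zmon_span w) => [|k u v [m [i0 [j0 [Sm ->]]]] _ [X SX [n vE]]].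
  exists (fun _ _ => 0) => [i j|]; first exact: lspan0.
  by exists 0%N => N _; rewrite big1 // => i _; rewrite big1 // => j _; rewrite mul0r.
exists (fun i j => (if (i == i0) && (j == j0) then k *: m else 0) + X i j).
  move=> i j; apply: subspaceD; [exact: lspan_subspace| |exact: SX].
  case: ifP => _; last exact: lspan0.
  by apply: subspaceZ; [exact: lspan_subspace|exact: lspan_gen].
exists (maxn n (maxn i0 j0).+1) => N; rewrite geq_max => /andP[leN ltN].
have [lti ltj] : (i0 < N)%N /\ (j0 < N)%N by lia.
under eq_bigr => i _ do rewrite (eq_bigr _ (fun j _ => mulrDl _ _ _)) big_split /=.
rewrite big_split /= -vE //; congr (_ + _).
rewrite (bigD1 (Ordinal lti)) //= [X in _ + X]big1 ?addr0 => [|i /eqP ne]; last first.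
  rewrite big1 // => j _; case: eqP => [e|_] /=; last by rewrite mul0r.
  by case: ne; apply/val_inj.
rewrite (bigD1 (Ordinal ltj)) //= !eqxx [X in _ + X]big1 ?addr0 => [|j /eqP ne].
  by rewrite scalerAl.
case: eqP => [e|_] /=; last by rewrite mul0r.
by case: ne; apply/val_inj.
Qed.

End Spanning.

Section MonomialSpan.
Variables (K : fieldType) (A : algType K) (x y e3 : A).

(** Sorted by the power of [y], with [F] collecting the monomials without [e3] and [G] those with
    it. *)
Lemma mon_decomposition w : lspan (q_mon x y e3) w ->
  exists F G : nat -> {poly K}, exists n, forall N, (n <= N)%N ->
    w = \sum_(d < N) (horner_alg x (F d) + horner_alg x (G d) * e3) * y ^+ d.
Proof.
have hZ k c : horner_alg x (k *: 'X^c) = k *: x ^+ c.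
  by rewrite -mul_polyC rmorphM rmorphXn /= horner_algC horner_algX mulr_algl.
elim=> [|k u v [c [eps [d0 ->]]] _ [F [G [n vE]]]].
  exists (fun=> 0), (fun=> 0), 0%N => N _; rewrite big1 // => d _.
  by rewrite !rmorph0 mul0r addr0 mul0r.
exists (fun d => (if ~~ eps && (d == d0) then k *: 'X^c else 0) + F d).
exists (fun d => (if eps && (d == d0) then k *: 'X^c else 0) + G d).
exists (maxn n d0.+1) => N; rewrite geq_max => /andP[leN ltN].
under eq_bigr => d _ do rewrite !rmorphD (mulrDl _ _ e3) addrACA mulrDl.
rewrite big_split /= -vE //; congr (_ + _).
rewrite (bigD1 (Ordinal ltN)) //= eqxx [X in _ + X]big1 ?addr0 => [|d /eqP ne].
  rewrite !andbT; case: eps; rewrite !rmorph0 ?add0r ?mul0r ?addr0.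
    by rewrite hZ -!scalerAl mulrA.
  by rewrite hZ -scalerAl mul1r.
have [e|_] := eqVneq (d : nat) d0; first by case: ne; apply/val_inj.
by rewrite !andbF !rmorph0 mul0r addr0 mul0r.
Qed.

End MonomialSpan.

(** Once [e3] and [z] are expanded, the two commutation rules are the Serre relations up to a
    scalar; they are much shorter to check in a concrete algebra. *)
Lemma serre_elements_intro (K : fieldType) (q : K) (A : algType K)
    (x y e3 e3bar z z' : A) : q != 0 ->
  e3 = x * y - q ^+ 2 *: (y * x) -> e3bar = x * y - q ^- 2 *: (y * x) ->
  z = y * e3 - q ^+ 2 *: (e3 * y) ->
  z' = (1 - q ^- 2) *: (e3 * e3bar + (1 + q ^- 2) *: (z * x)) ->
  x * e3 = q ^- 2 *: (e3 * x) -> y * z = z * y ->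
  serre_elements q x y e3 e3bar z z'.
Proof.
move=> q0 e3E e3barE zE z'E xe3 yz; split=> //.
  have /eqP := xe3; rewrite -subr_eq0 => /eqP <-; rewrite e3E.
  by noncomm K [:: x; y] => //; field.
have /eqP := yz; rewrite -subr_eq0 => /eqP/(congr1 ( *:%R (- q ^- 2))).
rewrite scaler0 => <-; rewrite zE e3E.
by noncomm K [:: x; y] => //; field.
Qed.

(** * A representation with prescribed central character *)

(* [e1] has eigenvalue [rep_weight n] at [n], [e3] is the shift, and [e3bar] goes
   back with coefficient [rep_coef], the value of [e3 e3bar = b - a e1]; then
   [rep_e2] is forced by [e3bar - e3 = (q^2 - q^-2) e2 e1]. *)
Section Representation.
Variables (K : fieldType) (q al be mu : K).
Hypotheses (q0 : q != 0) (qX : forall n, (0 < n)%N -> q ^+ n != 1).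
Hypothesis (mu0 : mu != 0).
Local Notation V := (int -> K^o).

Fact band_proof (l c r : int -> K) :
  `[< linear (fun (u : V) n => l n * u (n - 1) + c n * u n + r n * u (n + 1) : K^o) >].
Proof.
apply/asboolP => k u v; apply/funext => n.
by rewrite !fctE /GRing.scale /=; ring.
Qed.

(** A tridiagonal operator. Since [l] multiplies the value at [n - 1], it carries a point mass at
    [k] to [k + 1], and [r] carries it to [k - 1]. *)
Definition band l c r : lin_end K := LinEnd (band_proof l c r).

Lemma bandE l c r u n :
  band l c r u n = l n * u (n - 1) + c n * u n + r n * u (n + 1).
Proof. by []. Qed.

Definition rep_weight (n : int) : K := mu * (q ^- 2) ^ n.

Definition rep_coef (n : int) : K :=
  (1 - q ^- 2)^-1 * be - (1 + q ^- 2) * al * rep_weight n.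

Let kap := q ^+ 2 - q ^- 2.
Definition rep_e1 := band (fun=> 0) rep_weight (fun=> 0).
Definition rep_e3 := band (fun=> 1) (fun=> 0) (fun=> 0).
Definition rep_e3bar := band (fun=> 0) (fun=> 0) (fun n => rep_coef (n + 1)).
Definition rep_e2 := band (fun n => - (kap * rep_weight (n - 1))^-1) (fun=> 0)
  (fun n => rep_coef (n + 1) / (kap * rep_weight (n + 1))).

Lemma rep_weight_neq0 n : rep_weight n != 0.
Proof. by rewrite mulf_neq0 // expfz_neq0 // invr_neq0 // expf_neq0. Qed.

Lemma rep_weightS n : rep_weight (n + 1) = q ^- 2 * rep_weight n.
Proof.
by rewrite /rep_weight expfzDr ?invr_neq0 ?expf_neq0 // expr1z mulrA mulrC.
Qed.

Lemma rep_weightP n : rep_weight (n - 1) = q ^+ 2 * rep_weight n.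
Proof. by rewrite -{2}(subrK 1 n) rep_weightS mulrA mulfV ?mul1r // expf_neq0. Qed.

Lemma rep_elements :
  serre_elements q rep_e1 rep_e2 rep_e3 rep_e3bar al%:A be%:A.
Proof.
have q4 : (q * q) ^+ 2 - 1 != 0 by rewrite -expr2 -exprM subr_eq0 qX.
have q2 : q * q - 1 != 0 by rewrite -expr2 subr_eq0 qX.
have w0 := rep_weight_neq0.
have e3E : rep_e3 = rep_e1 * rep_e2 - q ^+ 2 *: (rep_e2 * rep_e1).
  apply: lin_end_eq => u; apply/funext => n.
  rewrite !(lin_end_addE, lin_end_oppE, lin_end_scaleE, lin_end_mulE) !fctE !bandE.
  rewrite !(addrK, subrK) /GRing.scale /= !(rep_weightS, rep_weightP) /kap.
  by field; rewrite ?w0 ?q4 ?q2 ?q0.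
have e3barE : rep_e3bar = rep_e1 * rep_e2 - q ^- 2 *: (rep_e2 * rep_e1).
  apply: lin_end_eq => u; apply/funext => n.
  rewrite !(lin_end_addE, lin_end_oppE, lin_end_scaleE, lin_end_mulE) !fctE !bandE.
  rewrite !(addrK, subrK) /GRing.scale /= !(rep_weightS, rep_weightP) /kap.
  by field; rewrite ?w0 ?q4 ?q2 ?q0.
have zE : al%:A = rep_e2 * rep_e3 - q ^+ 2 *: (rep_e3 * rep_e2) :> lin_end K.
  apply: lin_end_eq => u; apply/funext => n.
  rewrite !(lin_end_addE, lin_end_oppE, lin_end_scaleE, lin_end_mulE) !fctE !bandE.
  rewrite !(addrK, subrK) /GRing.scale /= /rep_coef !(rep_weightS, rep_weightP) /kap.
  by field; rewrite ?w0 ?q4 ?q2 ?q0.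
apply: serre_elements_intro => //; last first.
- by rewrite mulr_algl mulr_algr.
- apply: lin_end_eq => u; apply/funext => n.
  rewrite !(lin_end_scaleE, lin_end_mulE) !fctE !bandE.
  rewrite /GRing.scale /= rep_weightP.
  by field.
apply: lin_end_eq => u; apply/funext => n.
rewrite !(lin_end_addE, lin_end_scaleE, lin_end_mulE) lin_end_oneE !fctE !bandE.
have -> : n - 1 + 1 = n by rewrite subrK.
rewrite /GRing.scale /= /rep_coef.
by field; rewrite ?q4 ?q2 ?q0.
Qed.

End Representation.

Section Independence.
Variables (K : fieldType) (q al be mu : K).
Hypotheses (q0 : q != 0) (qX : forall n, (0 < n)%N -> q ^+ n != 1).
Hypothesis (mu0 : mu != 0).
Hypothesis coef0 : forall n, rep_coef q al be mu n != 0.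
Local Notation V := (int -> K^o).
Local Notation rep_e1 := (rep_e1 q mu).
Local Notation rep_e2 := (rep_e2 q al be mu).
Local Notation rep_e3 := (rep_e3 K).
Local Notation rep_weight := (rep_weight q mu).
Local Notation rep_coef := (rep_coef q al be mu).

Lemma horner_rep_e1 (p : {poly K}) (u : V) n :
  horner_alg rep_e1 p u n = p.[rep_weight n] * u n.
Proof.
elim/poly_ind: p u => [|p c IH] u.
  by rewrite rmorph0 lin_end_zeroE horner0 mul0r.
rewrite rmorphD rmorphM /= horner_algX horner_algC hornerMXaddC.
rewrite fctE IH bandE; have -> : (c%:A : lin_end K) u n = c * u n by [].
by ring.
Qed.

Definition delta (k : int) : V := fun n => (n == k)%:R.

Lemma rep_e3E (u : V) n : rep_e3 u n = u (n - 1).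
Proof. by rewrite bandE mul1r !mul0r !addr0. Qed.

Lemma rep_e2_expS d (u : V) n : (rep_e2 ^+ d.+1) u n =
  - ((q ^+ 2 - q ^- 2) * rep_weight (n - 1))^-1 * (rep_e2 ^+ d) u (n - 1)
  + rep_coef (n + 1) / ((q ^+ 2 - q ^- 2) * rep_weight (n + 1))
    * (rep_e2 ^+ d) u (n + 1).
Proof. by rewrite exprS lin_end_mulE bandE mul0r addr0. Qed.

Lemma rep_e2_exp_out d k n : (d < `|(n - k)%R|)%N -> (rep_e2 ^+ d) (delta k) n = 0.
Proof.
elim: d n => [|d IH] n ltd.
  rewrite expr0 lin_end_oneE /delta; case: eqP => // e.
  by move: ltd; rewrite e subrr.
by rewrite rep_e2_expS !IH ?mulr0 ?addr0 //; lia.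
Qed.

(** Only the path going up at every step reaches this point, so the value is a product of non-zero
    coefficients. *)
Lemma rep_e2_exp_top d k : (rep_e2 ^+ d) (delta k) (k + d%:Z) != 0.
Proof.
elim: d => [|d IH]; first by rewrite expr0 lin_end_oneE /delta addr0 eqxx oner_neq0.
rewrite rep_e2_expS (@rep_e2_exp_out d k (_ + 1)) ?mulr0 ?addr0; last by lia.
have -> : k + d.+1%:Z - 1 = k + d%:Z by lia.
by rewrite mulf_neq0 // oppr_eq0 invr_neq0 // mulf_neq0 ?subq2_neq0 // rep_weight_neq0.
Qed.

(** Downward steps carry the factors [rep_coef]; this is where [coef0] enters. *)
Lemma rep_e2_exp_bot d k : (rep_e2 ^+ d) (delta k) (k - d%:Z) != 0.
Proof.
elim: d => [|d IH]; first by rewrite expr0 lin_end_oneE /delta subr0 eqxx oner_neq0.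
rewrite rep_e2_expS (@rep_e2_exp_out d k (_ - 1)) ?mulr0 ?add0r; last by lia.
have -> : k - d.+1%:Z + 1 = k - d%:Z by lia.
rewrite mulf_neq0 // mulf_neq0 //.
by rewrite invr_neq0 // mulf_neq0 ?subq2_neq0 // rep_weight_neq0.
Qed.

Lemma rep_weight_root_eq0 (p : {poly K}) : (forall n, p.[rep_weight n] = 0) -> p = 0.
Proof.
move=> p0; apply/eqP; apply: contraT => pn0.
pose rs := [seq rep_weight (i : nat)%:Z | i <- iota 0 (size p)].
have := @max_poly_roots _ p rs pn0; rewrite size_map size_iota ltnn; apply.
  by apply/allP => _ /mapP[i _ ->]; apply/eqP/p0.
rewrite map_inj_uniq ?iota_uniq // => i j /(mulfI mu0) h.
have : q ^- 2 ^+ i = q ^- 2 ^+ j := h; rewrite !exprVn => /invr_inj; rewrite -!exprM => e.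
by have /eqP := expf_nonroot_inj q0 qX e; rewrite eqn_mul2l => /eqP.
Qed.

(** Applied to a point mass at [k], only the top term with [e3] reaches [k + n + 1], which kills
    [G n] at every weight. Then only the top term without [e3] reaches [k - n], which kills [F n]. A
    polynomial vanishing at all weights is zero. *)
Lemma rep_independent n (F G : nat -> {poly K}) :
  \sum_(d < n) (horner_alg rep_e1 (F d) + horner_alg rep_e1 (G d) * rep_e3)
     * rep_e2 ^+ d = 0 ->
  forall d, (d < n)%N -> F d = 0 /\ G d = 0.
Proof.
elim: n => // n IH e.
have sumE k m : 0 = \sum_(d < n.+1) ((F d).[rep_weight m] * (rep_e2 ^+ d) (delta k) m
    + (G d).[rep_weight m] * (rep_e2 ^+ d) (delta k) (m - 1)).
  pose ev (f : lin_end K) : K := f (delta k) m.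
  have evD : {morph ev : f g / f + g} by [].
  transitivity (ev 0); first by [].
  rewrite -e (big_morph ev evD (erefl : ev 0 = 0)).
  apply: eq_bigr => d _; rewrite /ev lin_end_mulE lin_end_addE lin_end_mulE fctE.
  by rewrite !horner_rep_e1 rep_e3E.
have out d k m : (d < n)%N -> (n < `|(m - k)%R|)%N ->
    (F d).[rep_weight m] * (rep_e2 ^+ d) (delta k) m
    + (G d).[rep_weight m] * (rep_e2 ^+ d) (delta k) (m - 1) = 0.
  move=> ltd ltn; rewrite !rep_e2_exp_out ?mulr0 ?addr0 //; lia.
have Gn0 : G n = 0.
  (* The point mass is placed so that [m] is the highest point reached. *)
  apply: rep_weight_root_eq0 => m; have := sumE (m - 1 - n%:Z) m.
  rewrite big_ord_recr big1 /= => [|d _]; last by apply: out => //; lia.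
  rewrite add0r (@rep_e2_exp_out n _ m) ?mulr0 ?add0r; last by lia.
  move/esym/eqP; rewrite mulf_eq0 => /orP[/eqP //|].
  have {2}-> : m - 1 = m - 1 - n%:Z + n%:Z by lia.
  by rewrite (negPf (rep_e2_exp_top _ _)).
have Fn0 : F n = 0.
  apply: rep_weight_root_eq0 => m; have := sumE (m + n%:Z) m.
  rewrite big_ord_recr big1 /= => [|d _].
    rewrite add0r Gn0 horner0 mul0r addr0.
    move/esym/eqP; rewrite mulf_eq0 => /orP[/eqP //|].
    have {2}-> : m = m + n%:Z - n%:Z by lia.
    by rewrite (negPf (rep_e2_exp_bot _ _)).
  have ltd := ltn_ord d.
  by rewrite !rep_e2_exp_out ?mulr0 ?addr0 //; lia.
move=> d; rewrite ltnS leq_eqVlt => /orP[/eqP->//|]; apply: IH.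
by move: e; rewrite big_ord_recr /= Fn0 Gn0 !rmorph0 mul0r addr0 mul0r addr0.
Qed.

(** Both factors are invertible; [g] is the backward shift composed with division by the weights. *)
Lemma rep_e1e3_cancel (f : lin_end K) : f * (rep_e1 * rep_e3) = 0 -> f = 0.
Proof.
move=> f0.
pose g := band (fun=> 0) (fun=> 0) (fun=> 1) * band (fun=> 0) (fun n => (rep_weight n)^-1) (fun=> 0).
have <- : f * (rep_e1 * rep_e3) * g = f; last by rewrite f0 mul0r.
rewrite -mulrA; have -> : rep_e1 * rep_e3 * g = 1; last by rewrite mulr1.
apply: lin_end_eq => u; apply/funext => n.
rewrite !lin_end_mulE lin_end_oneE !bandE.
have -> : n - 1 + 1 = n by rewrite subrK.
rewrite !(mul0r, add0r, addr0, mul1r) mulrA mulfV ?mul1r //.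
exact: rep_weight_neq0.
Qed.

End Independence.

Section UplusRepresentation.
Variables (K : fieldType) (q : K).
Hypotheses (q0 : q != 0) (qX : forall n, (0 < n)%N -> q ^+ n != 1).
Local Notation U := (Uplus q).

Lemma serre_elements_Uplus :
  serre_elements q (e1 q) (e2 q) (e3 q) (e3bar q) (z q) (z' q).
Proof. by split=> //; [exact: Ugen_serre1 | exact: Ugen_serre2]. Qed.

Lemma serre_elements_morph (A B : algType K) (f : {lrmorphism A -> B})
    (x y e3 e3bar z z' : A) :
  serre_elements q x y e3 e3bar z z' ->
  serre_elements q (f x) (f y) (f e3) (f e3bar) (f z) (f z').
Proof.
case=> s1 s2 e3E e3barE zE z'E; split.
- by rewrite -(rmorph0 f) -s1 rmorphD rmorphB /= [X in _ = _ - X + _]linearZ /= !rmorphM.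
- rewrite -(rmorph0 f) -s2 rmorphB rmorphD rmorphB /=.
  by rewrite [X in _ = _ - X + _ - _]linearZ /= [X in _ = _ + X - _]linearZ /= !rmorphM.
- by rewrite e3E rmorphB [X in _ - X]linearZ /= !rmorphM.
- by rewrite e3barE rmorphB [X in _ - X]linearZ /= !rmorphM.
- by rewrite zE rmorphB [X in _ - X]linearZ /= !rmorphM.
- by rewrite z'E [LHS]linearZ rmorphD /= [X in _ *: (_ + X)]linearZ /= !rmorphM.
Qed.

Lemma Uplus_universal (B : algType K) (x y e3 e3bar z z' : B) :
  serre_elements q x y e3 e3bar z z' ->
  exists f : {lrmorphism U -> B},
    [/\ f (e1 q) = x, f (e2 q) = y, f (Defs.e3 q) = e3, f (Defs.e3bar q) = e3bar
      & f (Defs.z q) = z /\ f (Defs.z' q) = z'].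
Proof.
move=> rels; pose a (i : 'I_2) := if i == 0 then x else y.
have a1 : serre1 q a = 0 := serre1_eq rels.
have a2 : serre2 q a = 0 := serre2_eq rels.
have [f [f1 f2]] : exists f : {lrmorphism U -> B}, f (e1 q) = x /\ f (e2 q) = y.
  (* The lift is a morphism only because of [a1] and [a2], so its structure is assembled locally. *)
  pose f : {lrmorphism U -> B} := HB.pack (Uplus_lift a : U -> B)
    (GRing.isZmodMorphism.Build _ _ _ (Uplus_lift_zmod_morphism a1 a2))
    (GRing.isMonoidMorphism.Build _ _ _ (Uplus_lift_monoid_morphism a1 a2))
    (GRing.isScalable.Build _ _ _ _ _ (Uplus_lift_scalable a1 a2)).
  exists f; split; first exact: (Uplus_liftE a1 a2 0).
  exact: (Uplus_liftE a1 a2 1).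
have [_ _ e3E e3barE zE z'E] := rels.
have [_ _ fe3 fe3bar fz fz'] := serre_elements_morph f serre_elements_Uplus.
have h3 : f (Defs.e3 q) = e3.
  by apply: (etrans fe3); rewrite f1 f2 e3E.
have h3bar : f (Defs.e3bar q) = e3bar.
  by apply: (etrans fe3bar); rewrite f1 f2 e3barE.
have hz : f (Defs.z q) = z by apply: (etrans fz); rewrite h3 f2 zE.
exists f; split=> //; split=> //; apply: (etrans fz'); rewrite z'E.
have eqz' (b b' c c' d d' u u' : B) : b = b' -> c = c' -> d = d' -> u = u' ->
    (1 - q ^- 2) *: (b * c + (1 + q ^- 2) *: (d * u))
    = (1 - q ^- 2) *: (b' * c' + (1 + q ^- 2) *: (d' * u')).
  by move=> -> -> -> ->.
exact: eqz'.
Qed.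

End UplusRepresentation.

Lemma horner_alg_morph (K : fieldType) (A B : algType K) (f : {lrmorphism A -> B})
    x p : f (horner_alg x p) = horner_alg (f x) p.
Proof.
elim/poly_ind: p => [|p c IH]; first by rewrite !rmorph0.
rewrite !rmorphD !rmorphM /= !horner_algX !horner_algC IH.
by rewrite rmorph_alg.
Qed.

Lemma qplane_eval_morph (K : fieldType) (A B : algType K) (f : {lrmorphism A -> B})
    x y F : f (qplane_eval x y F) = qplane_eval (f x) (f y) F.
Proof.
rewrite !qplane_evalE rmorph_sum; apply: eq_bigr => i _.
by rewrite rmorphM rmorphXn /= horner_alg_morph.
Qed.

Lemma ideal_subspace (K : fieldType) (A : algType K) (I : set A) :
  two_sided_ideal I -> subspace I.
Proof.
case=> I0 ID IM _; split=> // k x y Ix Iy; apply: ID => //.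
by rewrite -mulr_algl; apply: IM.
Qed.

(** * Maximality of the ideals generated by a central character *)

(* [y (x e3) = (e3bar e3 - e3 e3) / (q^2 - q^-2)], and [e3bar e3] is a polynomial
   in [x] modulo [P], so a factor [x e3] on the right absorbs each [y]. *)
Section QuantumPlaneReduction.
Variables (K : fieldType) (q al be : K) (A : algType K) (x y e3 e3bar z z' : A).
Hypotheses (q0 : q != 0) (qX : forall n, (0 < n)%N -> q ^+ n != 1).
Hypothesis rels : serre_elements q x y e3 e3bar z z'.
Hypothesis gen : forall T : set A, subspace T -> T 1 ->
  (forall w, T w -> T (x * w)) -> (forall w, T w -> T (y * w)) -> forall w, T w.
Variable P : set A.
Hypotheses (idP : two_sided_ideal P) (Pz : P (z - al%:A)) (Pz' : P (z' - be%:A)).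

Let subP := ideal_subspace idP.

(** The elements congruent modulo [P] to a combination of monomials in [x] and [e3]. *)
Let C : set A := lspan [set w | P w \/ exists i j, w = x ^+ i * e3 ^+ j].

Let subC : subspace C. Proof. exact: lspan_subspace. Qed.

Let C_P w : P w -> C w.
Proof. by move=> Pw; apply: lspan_gen; left. Qed.

Let C_mon i j : C (x ^+ i * e3 ^+ j).
Proof. by apply: lspan_gen; right; exists i, j. Qed.

Let PMl a w : P w -> P (a * w). Proof. by case: idP => _ _ h _; apply: h. Qed.
Let PMr a w : P w -> P (w * a). Proof. by case: idP => _ _ _ h; apply: h. Qed.

Let Cx w : C w -> C (x * w).
Proof.
apply: lspan_mull => // u [Pu|[i [j ->]]]; first exact/C_P/PMl.
by rewrite mulrA -exprS.
Qed.

Let Ce3 w : C w -> C (e3 * w).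
Proof.
apply: lspan_mull => // u [Pu|[i [j ->]]]; first exact/C_P/PMl.
rewrite mulrA (rel_e3_xn q0 rels) -scalerAl -mulrA -exprS.
exact: subspaceZ.
Qed.

Let e3nx j : e3 ^+ j * x = q ^+ 2 ^+ j *: (x * e3 ^+ j).
Proof. by have := qcommuteX (rel_e3_x q0 rels) j 1; rewrite muln1 !expr1. Qed.

Let mon_t i j : x ^+ i * e3 ^+ j * (x * e3) = q ^+ 2 ^+ j *: (x ^+ i.+1 * e3 ^+ j.+1).
Proof.
rewrite mulrA -(mulrA _ _ x) e3nx -scalerAr -scalerAl.
by rewrite (exprSr x) (exprSr e3) !mulrA.
Qed.

Let t_mon i j : x * e3 * (x ^+ i * e3 ^+ j) = q ^+ 2 ^+ i *: (x ^+ i.+1 * e3 ^+ j.+1).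
Proof.
rewrite mulrA -(mulrA _ _ (x ^+ i)) (rel_e3_xn q0 rels) -scalerAr -scalerAl.
by rewrite (exprS x) (exprS e3) !mulrA.
Qed.

Let Ct w : C w -> C (w * (x * e3)).
Proof.
apply: lspan_mulr => // u [Pu|[i [j ->]]]; first exact/C_P/PMr.
by rewrite mon_t; apply: subspaceZ.
Qed.

Let Cz w : C w -> C (z * w).
Proof.
move=> Cw; rewrite -(subrK al%:A z) mulrDl mulr_algl.
apply: subspaceD => //; last exact: subspaceZ.
by apply: C_P; apply: PMr.
Qed.

Let Cz' w : C w -> C (z' * w).
Proof.
move=> Cw; rewrite -(subrK be%:A z') mulrDl mulr_algl.
apply: subspaceD => //; last exact: subspaceZ.
by apply: C_P; apply: PMr.
Qed.

Let yxe3 : y * x * e3 = (q ^+ 2 - q ^- 2)^-1 *: (e3bar * e3 - e3 * e3).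
Proof.
rewrite (rel_e3bar q0 rels) mulrDl addrAC subrr add0r -scalerAl scalerA.
by rewrite mulVf ?scale1r // subq2_neq0.
Qed.

Let Cyt w : C w -> C (y * w * (x * e3)).
Proof.
rewrite -[C (_ * _)]/([set w | C (w * (x * e3))] (y * w)).
apply: lspan_mull => [|u [Pu|[i [j ->]]]] /=; first exact: subspace_mulr.
  by apply: C_P; apply: PMr; apply: PMl.
rewrite -mulrA mon_t -scalerAr; apply: subspaceZ => //.
(* Brings the factor [x * e3] to the left, next to [y], where [yxe3] applies. *)
have -> : x ^+ i.+1 * e3 ^+ j.+1 = (q ^+ 2 ^+ i)^-1 *: (x * e3 * (x ^+ i * e3 ^+ j)).
  by rewrite t_mon scalerA mulVf ?scale1r // !expf_neq0.
rewrite -scalerAr; apply: subspaceZ => //.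
have Cv := C_mon i j; move: (x ^+ i * _) Cv => v Cv.
rewrite !mulrA yxe3 -!scalerAl; apply: subspaceZ => //.
rewrite mulrBl; apply: subspaceB => //; last by rewrite -mulrA; do 2!apply: Ce3.
rewrite (rel_e3bar_e3 q0 qX rels) mulrBl -!scalerAl.
apply: subspaceB => //; apply: subspaceZ => //; first exact: Cz'.
by rewrite -mulrA; apply: Cz; apply: Cx.
Qed.

Lemma qplane_reduction w :
  exists N F, P (w * (x * e3) ^+ N - qplane_eval x e3 F).
Proof.
pose t := x * e3.
have CtN N v : C v -> C (v * t ^+ N).
  move=> Cv; elim: N => [|N IH]; first by rewrite mulr1.
  by rewrite exprSr mulrA; apply: Ct.
have CP v : C v -> exists F, P (v - qplane_eval x e3 F).
  have [P0 _ _ _] := idP; elim=> [|k u v' [Pu|[i [j ->]]] _ [F PF]].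
  - by exists 0; rewrite /qplane_eval rmorph0 horner0 subrr.
  - by exists F; rewrite -addrA; apply: subspaceD => //; apply: subspaceZ.
  - exists (k%:P *: ('X^i *: 'X^j) + F).
    by rewrite qplane_eval_is_linear qplane_eval_mon opprD addrACA subrr add0r.
suff: exists N, C (w * t ^+ N) by case=> N /CP[F PF]; exists N, F.
move: w; apply: gen => [|||].
- split=> [|k u v [M Cu] [N Cv]].
    by exists 0%N; rewrite mul0r; case: subC.
  (* Membership in [C] survives further factors [x * e3], so both exponents can be raised to a
     common one. *)
  exists (M + N)%N; rewrite mulrDl -scalerAl; apply: subspaceD => //.
    by apply: subspaceZ => //; rewrite exprD mulrA; apply: CtN.
  by rewrite addnC exprD mulrA; apply: CtN.
- by exists 0%N; have := C_mon 0 0; rewrite !expr0 mulr1.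
- by move=> u [N Cu]; exists N; rewrite -mulrA; apply: Cx.
- move=> u [N Cu]; exists N.+1; rewrite exprSr mulrA -(mulrA y).
  exact: Cyt.
Qed.

End QuantumPlaneReduction.

Section NoNilpotent.
Variables (K : fieldType) (q al be : K) (A : algType K) (x y e3 e3bar : A).
Hypotheses (q0 : q != 0) (qX : forall n, (0 < n)%N -> q ^+ n != 1).
Hypothesis rels : serre_elements q x y e3 e3bar al%:A be%:A.

Let sum_neq0 j : \sum_(i < j.+1) q ^+ 2 ^+ i != 0.
Proof.
have: 1 - (q ^+ 2) ^+ j.+1 != 0 by rewrite subr_eq0 eq_sym -exprM qX.
rewrite -[X in X - _](expr1n _ j.+1) subrXX mulf_eq0 negb_or => /andP[_].
by congr (_ != 0); apply: eq_bigr => i _; rewrite expr1n mul1r.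
Qed.

(** Commuting [y] with a vanishing power of [e3] leaves [al] times a non-zero quantum integer times
    the preceding power. *)
Lemma e3_not_nilpotent j : al != 0 -> e3 ^+ j <> 0.
Proof.
move=> al0; elim: j => [|j IH] ej; first by move/eqP: ej; rewrite oner_eq0.
have := rel_y_e3n q0 rels j.+1; rewrite ej mulr0 mul0r scaler0 add0r mulr_algr scalerA.
move=> /esym/eqP; rewrite scaler_eq0 mulf_eq0 (negPf al0) (negPf (sum_neq0 j)) /=.
by move/eqP.
Qed.

(* For [al != 0], commuting [e3^j x^i = 0] with [y] gives [e3^(j+2) x^(i-1) = 0];
   for [al = 0], [e3] is invertible with inverse proportional to [e3bar]. *)
Lemma no_monomial_zero i j : (al != 0) || (be != 0) -> x ^+ i * e3 ^+ j <> 0.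
Proof.
have [al0 be0|al0 _] := eqVneq al 0; last first.
  have {}ind m : forall j, e3 ^+ j * x ^+ m <> 0.
    elim: m => [|m IH] k e; first by apply: (@e3_not_nilpotent k al0); rewrite mulr1 in e.
    apply: (IH k.+2).
    have := congr1 (fun w => e3 * (y * w)) e; rewrite !mulr0 (mulrA y).
    rewrite (rel_y_e3n q0 rels) mulrDl -!scalerAl -(mulrA _ y) (rel_y_xn q0 rels).
    rewrite mulrBr -!scalerAr (mulrA (e3 ^+ k)) e mul0r scaler0 sub0r.
    rewrite mulr1 -scalerAl mulrDr -!scalerAr mulrN.
    have -> : (\sum_(i0 < k) q ^+ 2 ^+ i0) *: (al *: (e3 * (e3 ^+ k.-1 * x ^+ m.+1))) = 0.
      case: k {IH} e => [|k] e; first by rewrite big_ord0 scale0r.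
      by rewrite mulrA -exprS e !scaler0.
    rewrite addr0 -!scalerAr scalerN => /eqP; rewrite oppr_eq0 scalerA scaler_eq0.
    rewrite mulf_eq0 (negPf (q_gamma_neq0 q0 qX m)) orbF !expf_eq0 (negPf q0) !andbF /=.
    by rewrite !mulrA -exprS -exprSr => /eqP.
  move=> e; apply: (@ind i j).
  by have := qcommuteX (rel_e3_x q0 rels) j i; rewrite e scaler0.
rewrite /= in be0.
have b0 : (1 - q ^- 2)^-1 * be != 0 by rewrite mulf_neq0 ?invr_neq0 ?sub1q2_neq0.
have ee : e3 * e3bar = ((1 - q ^- 2)^-1 * be)%:A.
  by rewrite (rel_e3_e3bar qX rels) al0 scale0r mul0r scaler0 subr0 scalerA.
have ee' : e3bar * e3 = ((1 - q ^- 2)^-1 * be)%:A.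
  by rewrite (rel_e3bar_e3 q0 qX rels) al0 scale0r mul0r scaler0 subr0 scalerA.
(* Commuting [y] with a vanishing [x ^+ m.+1] gives [e3 * x ^+ m = 0], from which [e3bar] removes
   [e3]. *)
have x0 m : x ^+ m <> 0.
  elim: m => [|m IH] e; first by move/eqP: e; rewrite oner_eq0.
  apply: IH; have := rel_y_xn q0 rels m; rewrite e mulr0 mul0r scaler0 sub0r.
  move=> /esym/(congr1 (fun w => e3bar * w)); rewrite mulrN -scalerAr mulrA ee' mulr0.
  move/eqP; rewrite oppr_eq0 mulr_algl scalerA scaler_eq0 mulf_eq0.
  by rewrite (negPf b0) (negPf (q_gamma_neq0 q0 qX m)) => /eqP.
elim: j => [|j IH]; first by rewrite mulr1; apply: x0.
move=> /(congr1 (fun w => w * e3bar)); rewrite mul0r exprSr -!mulrA ee mulr_algr.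
by rewrite -scalerAr => /eqP; rewrite scaler_eq0 (negPf b0) => /eqP.
Qed.

End NoNilpotent.

Section RepParameter.
Variables (K : fieldType) (q : K).
Hypotheses (q0 : q != 0) (qX : forall n, (0 < n)%N -> q ^+ n != 1).
Hypothesis (two0 : 2%:R != 0 :> K).

Lemma rep_parameter al be : (al != 0) || (be != 0) ->
  exists2 mu : K, mu != 0 & forall n, rep_coef q al be mu n != 0.
Proof.
move=> ab0; rewrite /rep_coef.
set b := _^-1 * be; set a := _ * al.
have w0 n : (q ^- 2) ^ n != 0 by rewrite expfz_neq0 // invr_neq0 // expf_neq0.
have [al0|al0] := eqVneq al 0.
  have be0 : be != 0 by move: ab0; rewrite al0 eqxx.
  exists 1; rewrite ?oner_neq0 // => n; rewrite /a al0 mulr0 mul0r subr0.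
  by rewrite mulf_neq0 ?invr_neq0 ?sub1q2_neq0.
have a0 : a != 0 by rewrite mulf_neq0 // add1q2_neq0.
have [be0|be0] := eqVneq be 0.
  exists 1; rewrite ?oner_neq0 // => n; rewrite /b be0 mulr0 sub0r oppr_eq0.
  by rewrite /rep_weight mul1r mulf_neq0.
have b0 : b != 0 by rewrite mulf_neq0 ?invr_neq0 ?sub1q2_neq0.
(* [-b/a] is not [b/a] times a power of [q^-2], since [-1] is no power of [q^2]. *)
exists (- b / a) => [|n]; first by rewrite mulf_neq0 ?oppr_eq0 // invr_neq0.
have -> : b - a * rep_weight q (- b / a) n = b * (1 + (q ^- 2) ^ n).
  by rewrite /rep_weight; field.
rewrite mulf_neq0 // addrC -[1]opprK subr_eq0; apply/eqP => e.
have nonroot m : q ^- 2 ^+ m.+1 * q ^- 2 ^+ m.+1 != 1.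
  by rewrite -exprMn -invfM -exprD exprVn invr_eq1 -exprM qX.
(* At exponent 0 the equation says 1 = -1, excluded by [two0]; at any other exponent squaring it
   would make [q] a root of unity. *)
case: n e => [[|m]|m] e.
- by move/eqP: two0; apply; rewrite (natrD _ 1 1) -[X in X + _]opprK -e expr0z addNr.
- by have /eqP := nonroot m; rewrite -[_ ^+ _]/((q ^- 2) ^ m.+1%:Z) e mulrNN mulr1.
- have eV : ((q ^- 2) ^+ m.+1)^-1 = -1 := e.
  by have /eqP := nonroot m; rewrite -[_ ^+ _]invrK eV invrN1 mulrNN mulr1.
Qed.

End RepParameter.

Lemma ideal_genS (A : nzRingType) (S : set A) x : S x -> ideal_gen S x.
Proof. exact: sub_gen_smallest. Qed.

Lemma ideal_gen_sub (A : nzRingType) (S I : set A) :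
  two_sided_ideal I -> S `<=` I -> ideal_gen S `<=` I.
Proof. exact: smallest_sub. Qed.

Section CentralQuotients.
Variables (K : fieldType) (A : algType K) (z z' : A).

Lemma central_specialization (P : set A) al be (X : nat -> nat -> A) n :
  two_sided_ideal P -> P (z - al%:A) -> P (z' - be%:A) ->
  P (\sum_(i < n) \sum_(j < n) X i j * (z ^+ i * z' ^+ j)
     - \sum_(i < n) \sum_(j < n) (al ^+ i * be ^+ j) *: X i j).
Proof.
move=> idP Pz Pz'; have subP := ideal_subspace idP.
have [_ _ PMl PMr] := idP.
have PX (c : A) k i : P (c - k%:A) -> P (c ^+ i - (k ^+ i)%:A).
  move=> Pc; elim: i => [|i IH]; first by rewrite !expr0 scale1r subrr; case: idP.
  have -> : c ^+ i.+1 - (k ^+ i.+1)%:A = c * (c ^+ i - (k ^+ i)%:A) + (c - k%:A) * (k ^+ i)%:A.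
    by rewrite mulrBr mulrBl mulr_algl scalerA -exprS -exprS addrA subrK.
  by apply: subspaceD => //; [apply: (PMl _ _) | apply: (PMr _ _)].
rewrite -sumrB; apply: subspace_sum => // i _; rewrite -sumrB.
apply: subspace_sum => // j _; rewrite -mulr_algr -mulrBr; apply: (PMl _ _).
have -> : z ^+ i * z' ^+ j - (al ^+ i * be ^+ j)%:A =
    z ^+ i * (z' ^+ j - (be ^+ j)%:A) + (z ^+ i - (al ^+ i)%:A) * (be ^+ j)%:A.
  by rewrite mulrBr mulrBl mulr_algl scalerA addrA subrK.
by apply: subspaceD => //; [apply: (PMl _ _) | apply: (PMr _ _)]; apply: PX.
Qed.

End CentralQuotients.

(* These two properties determine [Uplus q] up to isomorphism, and nothing else
   about its construction is used. *)
Record serre_algebra (K : fieldType) (q : K) (A : algType K)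
    (x y e3 e3bar z z' : A) : Prop := SerreAlgebra {
  serre_alg_rels :> serre_elements q x y e3 e3bar z z';
  serre_alg_gen : forall T : set A, subspace T -> T 1 ->
    (forall w, T w -> T (x * w)) -> (forall w, T w -> T (y * w)) ->
    forall w, T w;
  serre_alg_univ : forall (B : algType K) (x' y' e3' e3bar' zB zB' : B),
    serre_elements q x' y' e3' e3bar' zB zB' ->
    exists f : {lrmorphism A -> B},
      [/\ f x = x', f y = y', f e3 = e3', f e3bar = e3bar'
        & f z = zB /\ f z' = zB']
}.

Section UplusGenerators.
Variables (K : fieldType) (q : K).
Local Notation U := (Uplus q).

Lemma Uplus_ind (T : set U) : subspace T -> T 1 ->
  (forall w, T w -> T (e1 q * w)) -> (forall w, T w -> T (e2 q * w)) ->
  forall w, T w.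
Proof.
move=> sT T1 Te1 Te2 w; rewrite -(to_quot_repr w) [repr w]free_algebraE linear_sum.
apply: subspace_sum => // m _; rewrite linearZ /=; apply: subspaceZ => //.
rewrite rmorph_prod; elim: (fmonom_val m) => [|i s IH]; first by rewrite big_nil.
rewrite big_cons; have [->|->] : i = 0 \/ i = 1.
  by case: i => [[|[|//]] lti]; [left|right]; apply/val_inj.
- exact: Te1.
- exact: Te2.
Qed.

Lemma Uplus_serre_algebra :
  serre_algebra q (e1 q) (e2 q) (e3 q) (e3bar q) (z q) (z' q).
Proof.
split; first exact: serre_elements_Uplus.
- exact: Uplus_ind.
- move=> B x y e3 e3bar z z' rels.
  have [f fP] := Uplus_universal rels.
  by exists f.
Qed.

End UplusGenerators.

Section Maximality.
Variables (K : fieldType) (q : K) (A : algType K) (x y e3 e3bar z z' : A).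
Hypotheses (q0 : q != 0) (qX : forall n, (0 < n)%N -> q ^+ n != 1).
Hypothesis (two0 : 2%:R != 0 :> K).
Hypothesis algA : serre_algebra q x y e3 e3bar z z'.

Let rels := serre_alg_rels algA.
Let gen := serre_alg_gen algA.

Definition central_ideal (al be : K) : set A :=
  ideal_gen [set z - al%:A; z' - be%:A].

Lemma central_ideal_ideal al be : two_sided_ideal (central_ideal al be).
Proof. exact: ideal_gen_ideal. Qed.

Lemma central_ideal_z al be : central_ideal al be (z - al%:A).
Proof. by apply: ideal_genS; left. Qed.

Lemma central_ideal_z' al be : central_ideal al be (z' - be%:A).
Proof. by apply: ideal_genS; right. Qed.

Lemma morph_ker_ideal (B : algType K) (f : {lrmorphism A -> B}) :
  two_sided_ideal [set x | f x = 0].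
Proof.
split=> [|u v /= fu fv|u v /= fv|u v /= fv]; first exact: rmorph0.
- by rewrite rmorphD /= fu fv addr0.
- by rewrite rmorphM /= fv mulr0.
- by rewrite rmorphM /= fv mul0r.
Qed.

Lemma central_ideal_ker (B : algType K) (f : {lrmorphism A -> B}) al be :
  f z = al%:A -> f z' = be%:A ->
  forall x, central_ideal al be x -> f x = 0.
Proof.
move=> fz fz'; apply: ideal_gen_sub; first exact: morph_ker_ideal.
by move=> _ [->|->] /=; rewrite rmorphB /= ?fz ?fz' rmorph_alg subrr.
Qed.

(** Injectivity can only hold on the span of [q_mon], as [z] and [z'] go to scalars. This span
    represents every class modulo [central_ideal al be]. *)
Lemma faithful_representation al be : (al != 0) || (be != 0) ->
  exists f : {lrmorphism A -> lin_end K},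
    [/\ f z = al%:A, f z' = be%:A,
        (forall w, lspan (q_mon x y e3) w -> f w = 0 -> w = 0) &
        forall g, g * f (x * e3) = 0 -> g = 0].
Proof.
move=> /(rep_parameter q0 qX two0)[mu mu0 coef0].
have [f [f1 f2 f3 _ [fz fz']]] := serre_alg_univ algA (rep_elements al be q0 qX mu0).
exists f; split=> // [w Sw fw|g]; last first.
  by rewrite rmorphM /= f1 f3; apply: rep_e1e3_cancel.
have [F [G [n wE]]] := mon_decomposition Sw.
have := fw; rewrite (wE n) // rmorph_sum => e.
have {}e : \sum_(d < n) (horner_alg (rep_e1 q mu) (F d)
    + horner_alg (rep_e1 q mu) (G d) * rep_e3 K) * rep_e2 q al be mu ^+ d = 0.
  rewrite -[RHS]e; apply: eq_bigr => d _.
  by rewrite rmorphM rmorphXn rmorphD rmorphM /= !horner_alg_morph f1 f2 f3.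
apply: big1 => d _.
have [-> ->] := rep_independent q0 qX mu0 coef0 e (ltn_ord d).
by rewrite !rmorph0 mul0r addr0 mul0r.
Qed.

Lemma central_idealN1 al be : (al != 0) || (be != 0) -> ~ central_ideal al be 1.
Proof.
move=> /faithful_representation[f [fz fz' _ _]] /(central_ideal_ker fz fz').
by rewrite rmorph1 => /eqP; rewrite oner_eq0.
Qed.

Lemma central_ideal_mon0 al be w : (al != 0) || (be != 0) ->
  lspan (q_mon x y e3) w -> central_ideal al be w -> w = 0.
Proof.
move=> /faithful_representation[f [fz fz' finj _]] Sw /(central_ideal_ker fz fz').
exact: finj.
Qed.

Lemma serre_zC w : w * z = z * w.
Proof.
exact: (central_of_gens gen (rel_x_z q0 rels) (rel_y_z q0 rels)).
Qed.

Lemma serre_z'C w : w * z' = z' * w.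
Proof.
exact: (central_of_gens gen (rel_x_z' q0 rels) (rel_y_z' q0 rels)).
Qed.

Lemma central_ideal_maximal al be (I : set A) : (al != 0) || (be != 0) ->
  two_sided_ideal I -> central_ideal al be `<=` I -> ~ I 1 ->
  I `<=` central_ideal al be.
Proof.
move=> ab0 idI PI I1 u Iu.
have idP : two_sided_ideal (central_ideal al be) by exact: central_ideal_ideal.
have Pz : central_ideal al be (z - al%:A) by exact: central_ideal_z.
have Pz' : central_ideal al be (z' - be%:A) by exact: central_ideal_z'.
have [X SX [n /(_ n (leqnn n)) uE]] := zmon_decomposition q0 qX rels gen u.
(* The representative of [u] free of [z] and [z']; on such elements [f] is injective. *)
pose w := \sum_(i < n) \sum_(j < n) (al ^+ i * be ^+ j) *: X i j.
have Pxw : central_ideal al be (u - w).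
  rewrite uE.
  exact: (central_specialization X n idP Pz Pz').
have subP := ideal_subspace idP.
rewrite -(subrK w u); apply: (subspaceD subP) => //.
have [->|w0] := eqVneq w 0; first by case: idP.
exfalso; have Iw : I w.
  rewrite -[w](subKr u); apply: (subspaceB (ideal_subspace idI)) => //.
  exact: PI.
have Sw : lspan (q_mon x y e3) w.
  have subS := lspan_subspace (q_mon x y e3).
  by do 2!apply: subspace_sum => // ? _; apply: subspaceZ.
have [f [fz fz' finj fcancel]] := faithful_representation ab0.
have [N [F PF]] := qplane_reduction q0 qX rels gen idP Pz Pz' w.
(* If [F] were zero, [f w] times a power of the cancellable [f (x * e3)] would vanish, and [w] with
   it. *)
have F0 : F != 0.
  apply/eqP => F0; have := central_ideal_ker fz fz' PF.
  rewrite F0 /qplane_eval rmorph0 horner0 subr0 rmorphM rmorphXn /= => e.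
  have: f w = 0.
    elim: (N) e => [|m IH]; first by rewrite mulr1.
    by rewrite exprSr mulrA => /fcancel.
  by move/(finj _ Sw)/eqP; rewrite (negPf w0).
(* In the quotient by [I] the class of [w] is zero, hence so is the normally ordered value of [F];
   this yields a vanishing monomial. *)
pose J := ProperTwoSidedIdeal idI I1.
have piJ v : I v -> to_quot J v = 0.
  by move=> Iv; rewrite -[RHS](raddf0 (to_quot J)); apply/to_quot_eq; rewrite subr0.
have piz : to_quot J z = al%:A.
  have /piJ := PI _ Pz.
  by rewrite rmorphB /= (rmorph_alg (to_quot J)) => /eqP; rewrite subr_eq0 => /eqP.
have piz' : to_quot J z' = be%:A.
  have /piJ := PI _ Pz'.
  by rewrite rmorphB /= (rmorph_alg (to_quot J)) => /eqP; rewrite subr_eq0 => /eqP.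
have := serre_elements_morph (to_quot J) rels; rewrite /= piz piz' => relsJ.
have := piJ _ (PI _ PF); rewrite rmorphB rmorphM /= [to_quot J w]piJ // mul0r sub0r.
move=> /eqP; rewrite oppr_eq0 (qplane_eval_morph (to_quot J)) => /eqP e.
have lamX m : (0 < m)%N -> q ^- 2 ^+ m != 1.
  by move=> m0; rewrite exprVn invr_eq1 -exprM qX // muln_gt0.
have lam0 : q ^- 2 != 0 by rewrite invr_neq0 // expf_neq0.
have [i [j]] := qplane_eval_eq0 lam0 lamX (rel_x_e3 q0 relsJ) F0 e.
exact: (no_monomial_zero q0 qX relsJ ab0).
Qed.

End Maximality.

(** * Intersections of primitive ideals *)

Section CentralIntersections.
Variables (K : fieldType) (q : K) (A : algType K) (x y e3 e3bar z z' : A).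
Hypotheses (q0 : q != 0) (qX : forall n, (0 < n)%N -> q ^+ n != 1).
Hypothesis (two0 : 2%:R != 0 :> K).
Hypothesis algA : serre_algebra q x y e3 e3bar z z'.

Let rels := serre_alg_rels algA.
Let gen := serre_alg_gen algA.

(** The coefficients [X] are chosen before the parameters, so belonging to many ideals at once
    becomes polynomial identities in [al] and [be]. *)
Lemma mem_central_ideal (w : A) : exists (X : nat -> nat -> A) n,
  w = \sum_(i < n) \sum_(j < n) X i j * (z ^+ i * z' ^+ j) /\
  forall al be, (al != 0) || (be != 0) -> central_ideal z z' al be w ->
    \sum_(i < n) al ^+ i *: (\sum_(j < n) be ^+ j *: X i j) = 0.
Proof.
have [X SX [n /(_ n (leqnn n)) wE]] := zmon_decomposition q0 qX rels gen w.
exists X, n; split=> // al be ab0 Pw.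
have idP : two_sided_ideal (central_ideal z z' al be) by exact: central_ideal_ideal.
have Pz : central_ideal z z' al be (z - al%:A) by exact: central_ideal_z.
have Pz' : central_ideal z z' al be (z' - be%:A) by exact: central_ideal_z'.
pose v := \sum_(i < n) \sum_(j < n) (al ^+ i * be ^+ j) *: X i j.
have -> : \sum_(i < n) al ^+ i *: (\sum_(j < n) be ^+ j *: X i j) = v.
  by apply: eq_bigr => i _; rewrite scaler_sumr; apply: eq_bigr => j _; rewrite scalerA.
apply: (central_ideal_mon0 q0 qX two0 algA ab0).
  have subS := lspan_subspace (q_mon x y e3).
  by do 2!apply: subspace_sum => // ? _; apply: subspaceZ.
rewrite -[v](subKr w); apply: (subspaceB (ideal_subspace idP)) => //.
rewrite [X in X - v]wE.
exact: (central_specialization X n idP Pz Pz').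
Qed.

Lemma central_intersection0 (w : A) :
  (forall al be, al != 0 -> be != 0 -> central_ideal z z' al be w) -> w = 0.
Proof.
move=> Pw; have [X [n [wE X0]]] := mem_central_ideal w.
rewrite wE big1 // => i _; rewrite big1 // => j _.
suff -> : X i j = 0 by rewrite mul0r.
apply: (vanishing_polynomial_map q0 qX _ (ltn_ord j)) => be be0.
apply: (vanishing_polynomial_map q0 qX (v := fun i => \sum_(j < n) be ^+ j *: X i j)
  _ (ltn_ord i)) => al al0.
by apply: X0; rewrite ?al0 //; apply: Pw.
Qed.

Lemma central_intersection_z' (w : A) :
  (forall al, al != 0 -> central_ideal z z' al 0 w) -> ideal_gen [set z'] w.
Proof.
move=> Pw; have [X [n [wE X0]]] := mem_central_ideal w.
have idJ : two_sided_ideal (ideal_gen [set z']) by exact: ideal_gen_ideal.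
have subJ := ideal_subspace idJ; have [_ _ JM _] := idJ.
(* As [0 ^+ 0 = 1], the sum is the coefficient with [j = 0]. Subtracting it below leaves only terms
   divisible by [z']. *)
have X00 i : (i < n)%N -> \sum_(j < n) 0 ^+ j *: X i j = 0.
  apply: (vanishing_polynomial_map q0 qX (v := fun i => \sum_(j < n) 0 ^+ j *: X i j)) => al al0.
  by apply: X0; rewrite ?al0 //; apply: Pw.
have {}wE : w = \sum_(i < n) \sum_(j < n) (X i j * (z ^+ i * z' ^+ j)
    - (0 ^+ j *: X i j) * z ^+ i).
  rewrite [LHS]wE; apply: eq_bigr => i _.
  by rewrite big_split /= sumrN -mulr_suml (X00 i) // mul0r subr0.
rewrite wE; apply: (subspace_sum subJ) => i _; apply: (subspace_sum subJ) => j _.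
case: (nat_of_ord j) => [|j']; first by rewrite !expr0 scale1r mulr1 subrr; case: idJ.
rewrite expr0n scale0r mul0r subr0 exprSr !mulrA; apply: JM.
exact: ideal_genS.
Qed.

Lemma central_intersection_z (w : A) :
  (forall be, be != 0 -> central_ideal z z' 0 be w) -> ideal_gen [set z] w.
Proof.
move=> Pw; have [X [n [wE X0]]] := mem_central_ideal w.
have idJ : two_sided_ideal (ideal_gen [set z]) by exact: ideal_gen_ideal.
have subJ := ideal_subspace idJ; have [_ _ JM JMr] := idJ.
have X00 j : (j < n)%N -> \sum_(i < n) 0 ^+ i *: X i j = 0.
  apply: (vanishing_polynomial_map q0 qX (v := fun j => \sum_(i < n) 0 ^+ i *: X i j)) => be be0.
  rewrite -[RHS](X0 0 be) ?be0 ?orbT //; last exact: Pw.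
  under eq_bigr => j' _ do rewrite scaler_sumr.
  rewrite exchange_big; apply: eq_bigr => i _; rewrite scaler_sumr.
  by apply: eq_bigr => j' _; rewrite !scalerA mulrC.
have {}wE : w = \sum_(i < n) \sum_(j < n) (X i j * (z ^+ i * z' ^+ j)
    - (0 ^+ i *: X i j) * z' ^+ j).
  under eq_bigr => i _ do rewrite sumrB.
  rewrite sumrB -wE [X in _ - X]exchange_big big1 ?subr0 // => j _.
  by rewrite -mulr_suml (X00 j) // mul0r.
rewrite wE; apply: (subspace_sum subJ) => i _; apply: (subspace_sum subJ) => j _.
case: (nat_of_ord i) => [|i']; first by rewrite !expr0 scale1r mul1r subrr; case: idJ.
rewrite expr0n scale0r mul0r subr0 exprSr.
by apply: (JM _ _); apply: JMr; apply: (JM _ _); exact: ideal_genS.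
Qed.

Lemma central_ideal_z_notin al be : al != 0 -> ~ central_ideal z z' al be z.
Proof.
move=> al0 Pz; have ab0 : (al != 0) || (be != 0) by rewrite al0.
have idP : two_sided_ideal (central_ideal z z' al be) by exact: central_ideal_ideal.
have subP := ideal_subspace idP.
apply: (central_idealN1 q0 qX two0 algA ab0).
have -> : 1 = al^-1 *: (z - (z - al%:A)).
  by rewrite opprB addrC subrK scalerA mulVf // scale1r.
by apply: (subspaceZ subP); apply: (subspaceB subP) => //; exact: central_ideal_z.
Qed.

Lemma central_ideal_z'_notin al be : be != 0 -> ~ central_ideal z z' al be z'.
Proof.
move=> be0 Pz'; have ab0 : (al != 0) || (be != 0) by rewrite be0 orbT.
have idP : two_sided_ideal (central_ideal z z' al be) by exact: central_ideal_ideal.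
have subP := ideal_subspace idP.
apply: (central_idealN1 q0 qX two0 algA ab0).
have -> : 1 = be^-1 *: (z' - (z' - be%:A)).
  by rewrite opprB addrC subrK scalerA mulVf // scale1r.
by apply: (subspaceZ subP); apply: (subspaceB subP) => //; exact: central_ideal_z'.
Qed.

End CentralIntersections.

(** * One-dimensional representations and the ideals generated by e1 or e2 *)

Section Characters.
Variables (K : fieldType) (q : K) (A : algType K) (x y e3 e3bar z z' : A).
Hypotheses (q0 : q != 0) (qX : forall n, (0 < n)%N -> q ^+ n != 1).
Hypothesis algA : serre_algebra q x y e3 e3bar z z'.
Let gen := serre_alg_gen algA.

(** With [a * b = 0] in a commutative target, [e3], [e3bar], [z] and [z'] all go to 0 and the
    relations become trivial. *)
Lemma character_exists (a b : K) : a * b = 0 ->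
  exists f : {lrmorphism A -> K^o}, f x = a /\ f y = b.
Proof.
move=> ab0; have ba0 : b * a = 0 by rewrite mulrC.
have rels : serre_elements q (a : K^o) b 0 0 0 0.
  apply: serre_elements_intro => //; rewrite ?(ab0, ba0, mulr0, mul0r, scaler0) ?subr0 ?addr0 ?scaler0 //.
by have [f [fx fy _ _ _]] := serre_alg_univ algA rels; exists f.
Qed.

Definition char_ideal (a b : K) : set A := ideal_gen [set x - a%:A; y - b%:A].

Lemma char_ideal_ideal a b : two_sided_ideal (char_ideal a b).
Proof. exact: ideal_gen_ideal. Qed.

Lemma char_ideal_scalar a b w : exists k : K, char_ideal a b (w - k%:A).
Proof.
have idP : two_sided_ideal (char_ideal a b) by exact: char_ideal_ideal.
have subP := ideal_subspace idP; have [P0 _ PM PMr] := idP.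
have Px : char_ideal a b (x - a%:A) by apply: ideal_genS; left.
have Py : char_ideal a b (y - b%:A) by apply: ideal_genS; right.
have mulP c k u l : char_ideal a b (c - k%:A) -> char_ideal a b (u - l%:A) ->
    char_ideal a b (c * u - (k * l)%:A).
  move=> Pc Pu; have -> : c * u - (k * l)%:A = c * (u - l%:A) + (c - k%:A) * l%:A.
    by rewrite mulrBr mulrBl mulr_algl scalerA addrA subrK.
  by apply: (subspaceD subP); [exact: PM | exact: PMr].
move: w; apply: gen => [|||].
- split=> [|k u v [l Pu] [m Pv]]; first by exists 0; rewrite scale0r subrr.
  exists (k * l + m); rewrite scalerDl -scalerA opprD addrACA -scalerBr.
  by apply: (subspaceD subP) => //; apply: (subspaceZ subP).
- by exists 1; rewrite scale1r subrr.
- by move=> w [k Pw]; exists (a * k); apply: mulP.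
- by move=> w [k Pw]; exists (b * k); apply: mulP.
Qed.

Lemma char_ideal_maximal a b (I : set A) :
  two_sided_ideal I -> char_ideal a b `<=` I -> ~ I 1 -> I `<=` char_ideal a b.
Proof.
move=> idI PI I1 w Iw; have [k Pw] := char_ideal_scalar a b w.
have [k0|k0] := eqVneq k 0; first by rewrite k0 scale0r subr0 in Pw.
have subI := ideal_subspace idI.
case: I1; have -> : 1 = k^-1 *: (w - (w - k%:A)).
  by rewrite opprB addrC subrK scalerA mulVf // scale1r.
by apply: (subspaceZ subI); apply: (subspaceB subI) => //; exact: PI.
Qed.

Lemma char_ideal_ker (f : {lrmorphism A -> K^o}) a b w :
  f x = a -> f y = b -> char_ideal a b w -> f w = 0.
Proof.
move=> fx fy; move: w; apply: ideal_gen_sub; first exact: morph_ker_ideal.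
by move=> _ [->|->] /=; rewrite rmorphB /= ?fx ?fy (rmorph_alg f) /GRing.scale /= mulr1 subrr.
Qed.

Lemma char_idealN1 a b : a * b = 0 -> ~ char_ideal a b 1.
Proof.
move=> /character_exists[f [fx fy]] /(char_ideal_ker fx fy).
by rewrite rmorph1 => /eqP; rewrite oner_eq0.
Qed.

(** Modulo [J], [w] is a polynomial [p] in [c], and [f t] reads off [p.[t]]; this is zero for all
    non-zero [t], so [p = 0]. *)
Lemma char_intersection (c : A) (f : K -> {lrmorphism A -> K^o}) (J : set A) w :
  two_sided_ideal J -> (forall v, exists p, J (v - horner_alg c p)) ->
  (forall t v, J v -> f t v = 0) -> (forall t, f t c = t) ->
  (forall t, t != 0 -> f t w = 0) -> J w.
Proof.
move=> idJ Jc fJ fc fw; have [p Jp] := Jc w.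
suff p0 : p = 0 by rewrite p0 rmorph0 subr0 in Jp.
have pt t : t != 0 -> p.[t] = 0.
  move=> t0; have := fJ t _ Jp; rewrite rmorphB /= fw // sub0r => /eqP.
  rewrite oppr_eq0 => /eqP <-.
  elim/poly_ind: (p) => [|r k IH]; first by rewrite !rmorph0 horner0.
  rewrite !rmorphD !rmorphM /= hornerMXaddC horner_algX horner_algC IH fc (rmorph_alg (f t)).
  by rewrite /GRing.scale /= mulr1.
apply/polyP => i; rewrite coef0; case: (ltnP i (size p)) => [lti|]; last exact: nth_default.
apply: (@vanishing_polynomial_map _ q q0 qX K^o _ (fun i => p`_i) _ _ lti) => t t0.
rewrite -[RHS](pt t t0) horner_coef; apply: eq_bigr => j _.
by rewrite /GRing.scale /= mulrC.
Qed.

Lemma char_intersection_x w :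
  (forall b, b != 0 -> char_ideal 0 b w) -> ideal_gen [set x] w.
Proof.
move=> Pw; have chP t := cid (character_exists (mul0r t)).
have idJ : two_sided_ideal (ideal_gen [set x]) by exact: ideal_gen_ideal.
have subJ := ideal_subspace idJ; have [_ _ JM JMr] := idJ.
apply: (@char_intersection y (fun t => sval (chP t))) => // [|t|t|t t0].
- apply: gen => [|||].
  + split=> [|k u v [p Pu] [r Pv]]; first by exists 0; rewrite rmorph0 subrr; case: idJ.
    exists (k *: p + r); rewrite -mul_polyC rmorphD rmorphM /= horner_algC mulr_algl.
    rewrite opprD addrACA -scalerBr.
    by apply: (subspaceD subJ) => //; apply: (subspaceZ subJ).
  + by exists 1; rewrite rmorph1 subrr; case: idJ.
  + by move=> v _; exists 0; rewrite rmorph0 subr0; apply: JMr; exact: ideal_genS.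
  + move=> v [p Pv]; exists ('X * p); rewrite rmorphM /= horner_algX -mulrBr.
    exact: JM.
- apply: ideal_gen_sub; first exact: morph_ker_ideal.
  by move=> _ ->; case: (svalP (chP t)).
- by case: (svalP (chP t)).
- by have [fx fy] := svalP (chP t); apply: (char_ideal_ker fx fy); apply: Pw.
Qed.

Lemma char_intersection_y w :
  (forall a, a != 0 -> char_ideal a 0 w) -> ideal_gen [set y] w.
Proof.
move=> Pw; have chP t := cid (character_exists (mulr0 t)).
have idJ : two_sided_ideal (ideal_gen [set y]) by exact: ideal_gen_ideal.
have subJ := ideal_subspace idJ; have [_ _ JM JMr] := idJ.
apply: (@char_intersection x (fun t => sval (chP t))) => // [|t|t|t t0].
- apply: gen => [|||].
  + split=> [|k u v [p Pu] [r Pv]]; first by exists 0; rewrite rmorph0 subrr; case: idJ.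
    exists (k *: p + r); rewrite -mul_polyC rmorphD rmorphM /= horner_algC mulr_algl.
    rewrite opprD addrACA -scalerBr.
    by apply: (subspaceD subJ) => //; apply: (subspaceZ subJ).
  + by exists 1; rewrite rmorph1 subrr; case: idJ.
  + move=> v [p Pv]; exists ('X * p); rewrite rmorphM /= horner_algX -mulrBr.
    exact: JM.
  + by move=> v _; exists 0; rewrite rmorph0 subr0; apply: JMr; exact: ideal_genS.
- apply: ideal_gen_sub; first exact: morph_ker_ideal.
  by move=> _ ->; case: (svalP (chP t)).
- by case: (svalP (chP t)).
- by have [fx fy] := svalP (chP t); apply: (char_ideal_ker fx fy); apply: Pw.
Qed.

End Characters.

Lemma scaler_algCA (K : fieldType) (A : algType K) (M : lmodType A) k (a c : A) (v : M) :
  c *: ((k *: a) *: v) = k%:A *: (c *: (a *: v)).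
Proof. by rewrite !(scalerA (_ : A)) mulr_algl -scalerAr. Qed.

(** * Quantum plane quotients, by e3 and by e3bar *)

Section QuantumPlaneQuotient.
Variables (K : fieldType) (q : K) (A : algType K) (x y e3 e3bar z z' : A) (lam : K).
Hypotheses (q0 : q != 0) (qX : forall n, (0 < n)%N -> q ^+ n != 1).
Hypothesis algA : serre_algebra q x y e3 e3bar z z'.
Hypothesis lamE : lam = q ^+ 2 \/ lam = q ^- 2.
Let gen := serre_alg_gen algA.

Let lam0 : lam != 0.
Proof. by case: lamE => ->; rewrite ?invr_neq0 ?expf_neq0. Qed.

Let lamX n : (0 < n)%N -> lam ^+ n != 1.
Proof.
by move=> n0; case: lamE => ->; rewrite ?exprVn ?invr_eq1 -exprM qX // muln_gt0.
Qed.

(** The generator is [e3] for [lam = q ^+ 2] and [e3bar] for [lam = q ^- 2]; one argument serves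
    both strata. *)
Definition qplane_ideal : set A := ideal_gen [set x * y - lam *: (y * x)].

Lemma qplane_ideal_ideal : two_sided_ideal qplane_ideal.
Proof. exact: ideal_gen_ideal. Qed.

Let idJ := qplane_ideal_ideal.
Let subJ := ideal_subspace idJ.

Let Jxy : qplane_ideal (x * y - lam *: (y * x)).
Proof. exact: ideal_genS. Qed.

Lemma qplane_ideal_span w : exists F, qplane_ideal (w - qplane_eval x y F).
Proof.
have [J0 _ JM JMr] := idJ.
have Jyx n : qplane_ideal (y * x ^+ n - lam^-1 ^+ n *: (x ^+ n * y)).
  elim: n => [|n IH]; first by rewrite !expr0 mulr1 mul1r scale1r subrr.
  have -> : y * x ^+ n.+1 - lam^-1 ^+ n.+1 *: (x ^+ n.+1 * y)
    = (y * x ^+ n - lam^-1 ^+ n *: (x ^+ n * y)) * x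
      - lam^-1 ^+ n.+1 *: (x ^+ n * (x * y - lam *: (y * x))).
    rewrite mulrBl mulrBr scalerBr opprB addrA -!mulrA -exprSr (mulrA (x ^+ n) x) -exprSr.
    have lamn : lam^-1 ^+ n.+1 * lam = lam^-1 ^+ n by rewrite exprSr divfK.
    by rewrite -scalerAl -scalerAr scalerA lamn -mulrA subrK.
  apply: (subspaceB subJ); first exact: JMr.
  by apply: (subspaceZ subJ); exact: JM.
pose C := lspan [set v | qplane_ideal v \/ exists i j, v = x ^+ i * y ^+ j].
have subC : subspace C by exact: lspan_subspace.
have CJ v : qplane_ideal v -> C v by move=> Jv; apply: lspan_gen; left.
have Cm i j : C (x ^+ i * y ^+ j) by apply: lspan_gen; right; exists i, j.
have Cw : C w.
  move: w; apply: gen => // [|w|w].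
  - by have := Cm 0%N 0%N; rewrite !expr0 mulr1.
  - apply: (lspan_mull subC) => v [Jv|[i [j ->]]]; first by apply: CJ; exact: JM.
    by rewrite mulrA -exprS.
  - apply: (lspan_mull subC) => v [Jv|[i [j ->]]]; first by apply: CJ; exact: JM.
    rewrite mulrA -(subrK (lam^-1 ^+ i *: (x ^+ i * y)) (y * x ^+ i)) mulrDl.
    apply: (subspaceD subC); first by apply: CJ; exact: JMr.
    by rewrite -scalerAl -mulrA -exprS; apply: (subspaceZ subC).
elim: Cw => [|k u v' [Ju|[i [j ->]]] _ [F JF]].
- by exists 0; rewrite /qplane_eval rmorph0 horner0 subrr.
- exists F; rewrite -addrA; apply: (subspaceD subJ) => //.
  exact: (subspaceZ subJ).
- exists (k%:P *: ('X^i *: 'X^j) + F).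
  by rewrite qplane_eval_is_linear qplane_eval_mon opprD addrACA subrr add0r.
Qed.

(** The kernel of [c] is a submodule by assumption, so it is zero or everything. *)
Lemma normal_acts (c : A) (M : lmodType A) : simple_module M ->
  (forall w (v : M), c *: v = 0 -> c *: (w *: v) = 0) ->
  annihilator M c \/ forall v : M, c *: v = 0 -> v = 0.
Proof.
move=> sM cw; have [|Mc] := pselect (annihilator M c); [by left|right].
move=> v cv; apply: contrapT => /eqP v0; apply: Mc => u.
by have [a ->] := simple_cyclic u sM v0; apply: cw.
Qed.

(** An annihilating element outside the ideal would produce a monomial in [x] and [y] killing [M].
    Both generators are normal modulo the ideal and do not kill [M], so they act injectively. *)
Lemma qplane_ideal_annihilator (M : lmodType A) : simple_module M ->
  qplane_ideal `<=` annihilator M -> ~ annihilator M x -> ~ annihilator M y ->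
  annihilator M = qplane_ideal.
Proof.
move=> sM JM Mx My; apply/seteqP; split=> // u Mu.
have idM := annihilator_ideal M; have subM := ideal_subspace idM.
have [F JF] := qplane_ideal_span u.
have [F0|F0] := eqVneq F 0.
  by rewrite F0 /qplane_eval rmorph0 horner0 subr0 in JF.
exfalso; pose P := ProperTwoSidedIdeal idM (annihilator1 sM).
have piM v : annihilator M v -> to_quot P v = 0.
  by move=> Mv; rewrite -[RHS](raddf0 (to_quot P)); apply/to_quot_eq; rewrite subr0.
have Mpi v : to_quot P v = 0 -> annihilator M v.
  by rewrite -[RHS](raddf0 (to_quot P)) => /to_quot_eq; rewrite subr0.
have e : qplane_eval (to_quot P x) (to_quot P y) F = 0.
  rewrite -(qplane_eval_morph (to_quot P)) /=; apply: piM.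
  by rewrite -[qplane_eval _ _ _](subKr u); apply: (subspaceB subM) => //; apply: JM.
have xyM (v : M) : x *: (y *: v) = (lam *: (y * x)) *: v.
  apply/eqP; rewrite scalerA -subr_eq0 -scalerBl; apply/eqP.
  exact: (JM _ Jxy).
have xy : to_quot P x * to_quot P y = lam *: (to_quot P y * to_quot P x).
  have := piM _ (JM _ Jxy); rewrite rmorphB [X in _ - X]linearZ /= !rmorphM.
  by move/eqP; rewrite subr_eq0 => /eqP.
have [i [j]] := qplane_eval_eq0 lam0 lamX xy F0 e.
rewrite -!(rmorphXn (to_quot P)) -(rmorphM (to_quot P)) => /Mpi Mij.
have xinj : forall v : M, x *: v = 0 -> v = 0.
  have [|//|//] := normal_acts (c := x) sM.
  apply: gen => [|||].
  - split=> [v|k a b Ta Tb v xv] /=; first by rewrite scale0r scaler0.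
    by rewrite scalerDl scalerDr Tb // addr0 scaler_algCA Ta // scaler0.
  - by move=> v; rewrite scale1r.
  - by move=> w IH v xv; rewrite -scalerA IH // scaler0.
  - move=> w IH v xv.
    by rewrite -scalerA xyM -mulr_algl -!scalerA IH // !scaler0.
have yxM (v : M) : y *: (x *: v) = lam^-1%:A *: (x *: (y *: v)).
  by rewrite xyM -[lam *: _]mulr_algl !scalerA mulrA mulr_algl scalerA mulVf // scale1r mul1r.
have yinj : forall v : M, y *: v = 0 -> v = 0.
  have [|//|//] := normal_acts (c := y) sM.
  apply: gen => [|||].
  - split=> [v|k a b Ta Tb v xv] /=; first by rewrite scale0r scaler0.
    by rewrite scalerDl scalerDr Tb // addr0 scaler_algCA Ta // scaler0.
  - by move=> v; rewrite scale1r.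
  - by move=> w IH v yv; rewrite -scalerA yxM IH // !scaler0.
  - by move=> w IH v yv; rewrite -scalerA IH // scaler0.
have injX c n : (forall v : M, c *: v = 0 -> v = 0) ->
    forall v : M, c ^+ n *: v = 0 -> v = 0.
  move=> cinj; elim: n => [|n IH] v; first by rewrite scale1r.
  by rewrite exprS -scalerA => /cinj/IH.
have [v /eqP v0] := simple_neq0 sM; apply: v0.
by apply: (injX y j yinj); apply: (injX x i xinj); rewrite scalerA; apply: Mij.
Qed.

Let lam_rels (B : algType K) (u v : B) : u * v = lam *: (v * u) ->
  serre_elements q u v (u * v - q ^+ 2 *: (v * u)) (u * v - q ^- 2 *: (v * u)) 0 0.
Proof.
move=> uv; set c := u * v - q ^+ 2 *: (v * u).
have cE : c = (lam - q ^+ 2) *: (v * u) by rewrite /c uv -scalerBl.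
apply: serre_elements_intro => //.
- case: lamE => e; rewrite cE e ?subrr ?scale0r ?mulr0 ?mul0r ?scaler0 ?subrr //.
  rewrite -scalerAr -scalerAl -[v * u * v]mulrA uv e -scalerAr !scalerA -scalerBl.
  by rewrite [X in X *: _](_ : _ = 0) ?scale0r //; field.
- case: lamE => e.
    by rewrite cE e subrr scale0r !mul0r scaler0 add0r scaler0.
  by rewrite uv e subrr mulr0 mul0r scaler0 add0r scaler0.
- case: lamE => e; rewrite cE e ?subrr ?scale0r ?mulr0 ?mul0r ?scaler0 //.
  by rewrite -scalerAr -scalerAl mulrA uv e -scalerAl scalerA mulrC -scalerA.
- by rewrite mulr0 mul0r.
Qed.

(** With [x] the shift and [y] the backward shift weighted by [lam ^ (- n)], the product [y * x] is
    diagonal with eigenvalue 1 at 0. *)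
Lemma qplane_ideal_rep : exists f : {lrmorphism A -> lin_end K},
  (forall w, qplane_ideal w -> f w = 0) /\
  f (y * x) (delta K 0) = delta K 0.
Proof.
pose X : lin_end K := band (fun=> 1) (fun=> 0) (fun=> 0).
pose Y : lin_end K := band (fun=> 0) (fun=> 0) (fun n => lam ^ (- n)).
have XY : X * Y = lam *: (Y * X).
  apply: lin_end_eq => u; apply/funext => n.
  rewrite !(lin_end_scaleE, lin_end_mulE) !fctE !bandE.
  have -> : n - 1 + 1 = n by rewrite subrK.
  rewrite opprB addrC expfzDr // expr1z /GRing.scale /=.
  have -> : n + 1 - 1 = n by rewrite addrK.
  by ring.
have [f [fx fy _ _ _]] := serre_alg_univ algA (lam_rels XY).
exists f; split.
  apply: ideal_gen_sub; first exact: morph_ker_ideal.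
  move=> _ -> /=; rewrite rmorphB /= [X in _ - X]linearZ /= !rmorphM /= fx fy XY.
  by rewrite subrr.
rewrite rmorphM /= fx fy; apply/funext => n.
rewrite !bandE !mul0r !add0r !addr0 mul1r.
have -> : n + 1 - 1 = n by rewrite addrK.
rewrite /delta; case: eqP => [->|_]; last by rewrite mulr0.
by rewrite oppr0 expr0z mulr1.
Qed.

(* A simple module with a vector fixed by [y x] is killed by neither [x] nor [y]. *)
Lemma qplane_ideal_primitive : left_primitive qplane_ideal.
Proof.
have [J0 JD JM JMr] := idJ.
pose L0 : set A := [set w | exists u a, qplane_ideal u /\ w = u + a * (y * x - 1)].
have idL0 : left_ideal L0.
  split=> [|_ _ [u [a [Ju ->]]] [v [b [Jv ->]]]|a _ [u [b [Ju ->]]]].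
  - by exists 0, 0; rewrite mul0r addr0.
  - exists (u + v), (a + b); rewrite mulrDl addrACA; split=> //.
    exact: JD.
  - exists (a * u), (a * b); rewrite mulrDr mulrA; split=> //.
    exact: JM.
(* Under [f] every element of [L0] kills the point mass at 0, unlike the identity. *)
have L01 : ~ L0 1.
  move=> [u [a [Ju e]]]; have [f [fJ fyx]] := qplane_ideal_rep.
  have fyx1 : f (y * x - 1) (delta K 0) = 0.
    have -> : f (y * x - 1) = f (y * x) - 1 by rewrite rmorphB rmorph1.
    by rewrite lin_end_addE lin_end_oppE lin_end_oneE fyx subrr.
  have f1 : 1 = f a * f (y * x - 1).
    have := congr1 f e; rewrite rmorph1 rmorphD rmorphM /= => ->.
    by rewrite (fJ u Ju) add0r.
  have := congr1 (fun g : lin_end K => g (delta K 0) 0) f1.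
  rewrite lin_end_mulE fyx1 lin_end0 lin_end_oneE /delta eqxx => /eqP.
  by rewrite oner_eq0.
have [M sM [v v0 Mv]] := exists_simple_module idL0 L01.
have yxv : y *: (x *: v) = v.
  apply/eqP; rewrite -subr_eq0 scalerA -[X in _ - X]scale1r -scalerBl; apply/eqP.
  by apply: Mv; exists 0, 1; rewrite mul1r add0r.
exists M => //; apply/esym/qplane_ideal_annihilator => //.
- move=> u Ju w; have [a ->] := simple_cyclic w sM v0.
  rewrite scalerA; apply: Mv; exists (u * a), 0; rewrite mul0r addr0.
  by split=> //; exact: JMr.
- by move=> Mx; move/eqP: v0; rewrite -yxv Mx scaler0.
- by move=> My; move/eqP: v0; rewrite -yxv My.
Qed.

End QuantumPlaneQuotient.

Section Scalars.
Variables (K : closedFieldType) (q : K) (A : algType K) (x y e3 e3bar z z' : A).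
Hypotheses (q0 : q != 0).
Hypothesis algA : serre_algebra q x y e3 e3bar z z'.
Hypothesis uncountableK : ~ countable [set: K].
Let gen := serre_alg_gen algA.

(** Words in [x] and [y] enumerated by codes of boolean sequences; a number that encodes none gives
    0. *)
Definition gen_word (n : nat) : A :=
  if choice.unpickle n is Some s then \prod_(b <- (s : seq bool)) (if b then x else y) else 0.

Lemma gen_word_span w : lspan (range gen_word) w.
Proof.
have sub := lspan_subspace (range gen_word).
have mul (b : bool) u : lspan (range gen_word) u ->
    lspan (range gen_word) ((if b then x else y) * u).
  apply: (lspan_mull sub) => _ [n _ <-]; rewrite /gen_word.
  case: (choice.unpickle n) => [s|]; last by rewrite mulr0; case: sub.
  by apply: lspan_gen; exists (choice.pickle (b :: s)); rewrite // choice.pickleK big_cons.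
move: w; apply: gen => // [|w|w]; last 2 first.
- exact: (mul true).
- exact: (mul false).
apply: lspan_gen; exists (choice.pickle ([::] : seq bool)) => //.
by rewrite /gen_word choice.pickleK big_nil.
Qed.

(** Commutation is asked on [M] only, which covers [y] on modules killed by [x], and conversely. *)
Lemma acts_by_scalar (M : lmodType A) (c : A) : simple_module M ->
  (forall v : M, c *: (x *: v) = x *: (c *: v)) ->
  (forall v : M, c *: (y *: v) = y *: (c *: v)) ->
  exists a : K, annihilator M (c - a%:A).
Proof.
move=> sM cx cy.
have [|a ca] := central_acts_by_scalar (c := c) uncountableK gen_word_span sM.
  apply: gen => [|v|w IH v|w IH v].
  - split=> [v|k a b Ta Tb v]; first by rewrite !scale0r scaler0.
    by rewrite !scalerDl scalerDr Tb scaler_algCA Ta (scalerA k%:A) mulr_algl.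
  - by rewrite !scale1r.
  - by rewrite -!scalerA -IH cx.
  - by rewrite -!scalerA -IH cy.
by exists a => v; rewrite scalerBl ca subrr.
Qed.

End Scalars.

(** * The strata *)

Section Strata.
Variables (K : closedFieldType) (q : K) (A : algType K) (x y e3 e3bar z z' : A).
Hypotheses (q0 : q != 0) (qX : forall n, (0 < n)%N -> q ^+ n != 1).
Hypothesis (two0 : 2%:R != 0 :> K).
Hypothesis algA : serre_algebra q x y e3 e3bar z z'.
Hypothesis uncountableK : ~ countable [set: K].
Variable act : K * K -> {lrmorphism A -> A}.
Hypotheses (act_x : forall h, act h x = h.1 *: x)
  (act_y : forall h, act h y = h.2 *: y).
Let rels := serre_alg_rels algA.
Let gen := serre_alg_gen algA.

(** [Prim_stratum] for the abstract algebra; the two are convertible when [act] is the torus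
    action. *)
Definition torus_stratum (J : set A) : set (set A) :=
  [set P | (prime_ideal P /\ \bigcap_(h in @torus K) (act h @` P) = J)
           /\ left_primitive P].

Lemma act_id (f : {lrmorphism A -> A}) : f x = x -> f y = y -> forall w, f w = w.
Proof.
move=> fx fy; apply: gen => [||w fw|w fw].
- split=> [|k u v fu fv]; first by rewrite rmorph0.
  by rewrite linearP /= fu fv.
- by rewrite rmorph1.
- by rewrite rmorphM /= fx fw.
- by rewrite rmorphM /= fy fw.
Qed.

Lemma actVK h : torus h -> cancel (act (h.1^-1, h.2^-1)) (act h).
Proof.
move=> [h1 h2]; apply: (@act_id (act h \o act (h.1^-1, h.2^-1))) => /=.
- by rewrite act_x linearZ /= act_x scalerA mulVf // scale1r.
- by rewrite act_y linearZ /= act_y scalerA mulVf // scale1r.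
Qed.

Lemma act_xy h : act h (x * y) = (h.1 * h.2) *: (x * y).
Proof. by rewrite rmorphM /= act_x act_y -scalerAl -scalerAr scalerA. Qed.

Lemma act_yx h : act h (y * x) = (h.1 * h.2) *: (y * x).
Proof. by rewrite rmorphM /= act_x act_y -scalerAl -scalerAr scalerA mulrC. Qed.

Lemma act_qcomm h k : act h (x * y - k *: (y * x)) = (h.1 * h.2) *: (x * y - k *: (y * x)).
Proof. by rewrite linearB [X in _ - X]linearZ /= act_xy act_yx scalerBr !scalerA [k * _]mulrC. Qed.

Lemma act_e3 h : act h e3 = (h.1 * h.2) *: e3.
Proof. by rewrite (e3_eq rels) act_qcomm. Qed.

Lemma act_e3bar h : act h e3bar = (h.1 * h.2) *: e3bar.
Proof. by rewrite (e3bar_eq rels) act_qcomm. Qed.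

Lemma act_z h : act h z = (h.1 * h.2 ^+ 2) *: z.
Proof.
rewrite (z_eq rels) linearB [X in _ - X]linearZ /= !rmorphM /= act_y act_e3.
rewrite -!scalerAl -!scalerAr !scalerA scalerBr !scalerA.
by congr (_ *: _ - _ *: _); ring.
Qed.

Lemma act_z' h : act h z' = ((h.1 * h.2) ^+ 2) *: z'.
Proof.
rewrite (z'_eq rels) [LHS]linearZ linearD /= [X in _ *: (_ + X)]linearZ /= !rmorphM /= act_e3 act_e3bar act_z act_x.
rewrite -!scalerAl -!scalerAr !scalerA !scalerDr !scalerA.
by congr (_ *: _ + _ *: _); ring.
Qed.

Definition torus_eigen (w : A) := forall h, @torus K h -> exists2 k : K, k != 0 & act h w = k *: w.

Lemma eigen_x : torus_eigen x. Proof. by move=> h [h1 h2]; exists h.1. Qed.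
Lemma eigen_y : torus_eigen y. Proof. by move=> h [h1 h2]; exists h.2. Qed.
Lemma eigen_z : torus_eigen z.
Proof. by move=> h [h1 h2]; exists (h.1 * h.2 ^+ 2); rewrite ?act_z // mulf_neq0 ?expf_neq0. Qed.
Lemma eigen_z' : torus_eigen z'.
Proof. by move=> h [h1 h2]; exists ((h.1 * h.2) ^+ 2); rewrite ?act_z' // expf_neq0 ?mulf_neq0. Qed.
Lemma eigen_qcomm k : torus_eigen (x * y - k *: (y * x)).
Proof. by move=> h [h1 h2]; exists (h.1 * h.2); rewrite ?act_qcomm // mulf_neq0. Qed.

Lemma bigcap_act_sub (P : set A) : \bigcap_(h in @torus K) (act h @` P) `<=` P.
Proof.
move=> w Pw; have t1 : @torus K (1, 1) by split; rewrite oner_neq0.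
have [u Pu <-] := Pw _ t1.
by rewrite act_id // ?act_x ?act_y ?scale1r.
Qed.

(** Translates of [P] are ideals because the action is invertible, and each contains the
    eigenvectors of [P], rescaled by their eigenvalues. *)
Lemma bigcap_act_gen (P S : set A) : two_sided_ideal P -> S `<=` P ->
  (forall w, S w -> torus_eigen w) ->
  ideal_gen S `<=` \bigcap_(h in @torus K) (act h @` P).
Proof.
move=> idP SP Seig w Sw h th; have [P0 PD PM PMr] := idP.
move: w Sw; apply: ideal_gen_sub.
  split.
  - by exists 0 => //; rewrite rmorph0.
  - move=> _ _ [u Pu <-] [v Pv <-]; exists (u + v); last by rewrite rmorphD.
    exact: PD.
  - move=> a _ [u Pu <-]; exists (act (h.1^-1, h.2^-1) a * u); first exact: PM.
    by rewrite rmorphM /= actVK.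
  - move=> a _ [u Pu <-]; exists (u * act (h.1^-1, h.2^-1) a); first exact: PMr.
    by rewrite rmorphM /= actVK.
move=> w Sw; have [k k0 wk] := Seig w Sw h th.
exists (k^-1 *: w); first by apply: (subspaceZ (ideal_subspace idP)); apply: SP.
by rewrite linearZ /= wk scalerA mulVf // scale1r.
Qed.

Lemma in_stratum (S P : set A) : left_primitive P -> S `<=` P ->
  (forall w, S w -> torus_eigen w) ->
  \bigcap_(h in @torus K) (act h @` P) `<=` ideal_gen S ->
  torus_stratum (ideal_gen S) P.
Proof.
move=> primP SP Seig sub; have primeP := primitive_prime primP.
split=> //; split=> //; apply/seteqP; split=> //.
by apply: bigcap_act_gen => //; case: primeP.
Qed.

Lemma stratum_sub (J P : set A) : torus_stratum J P -> J `<=` P.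
Proof. by move=> [[_ <-] _]; apply: bigcap_act_sub. Qed.

(** Used contrapositively: a generator outside [J] cannot lie in [P], so the matching parameter is
    non-zero. *)
Lemma stratum_eigen (J P : set A) w : torus_stratum J P -> torus_eigen w -> P w -> J w.
Proof.
move=> [[[idP _ _] <-] _] eigw Pw.
apply: (bigcap_act_gen (S := [set w]) idP) => [_ ->//|_ ->//|].
exact: ideal_genS.
Qed.

Lemma stratum_annihilator (J P : set A) : torus_stratum J P ->
  exists2 M : lmodType A, simple_module M & P = annihilator M.
Proof. by case. Qed.

Lemma act_central h al be al' be' w : al = h.1 * h.2 ^+ 2 * al' ->
  be = (h.1 * h.2) ^+ 2 * be' ->
  central_ideal z z' al be w -> central_ideal z z' al' be' (act h w).
Proof.
move=> alE beE.
have idP : two_sided_ideal (central_ideal z z' al' be') by exact: central_ideal_ideal.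
have subP := ideal_subspace idP; have [P0 PD PM PMr] := idP.
move: w; apply: ideal_gen_sub.
  split=> [|u v Pu Pv|a u Pu|a u Pu].
  - by rewrite rmorph0.
  - by rewrite rmorphD; apply: PD.
  - by rewrite rmorphM; apply: PM.
  - by rewrite rmorphM; apply: PMr.
move=> _ [->|->]; rewrite rmorphB /= (rmorph_alg (act h)).
- rewrite act_z alE -(scalerA _ al') -scalerBr; apply: (subspaceZ subP).
  exact: central_ideal_z.
- rewrite act_z' beE -(scalerA _ be') -scalerBr; apply: (subspaceZ subP).
  exact: central_ideal_z'.
Qed.

Lemma act_char h a b a' b' w : a = h.1 * a' -> b = h.2 * b' ->
  char_ideal x y a b w -> char_ideal x y a' b' (act h w).
Proof.
move=> aE bE.
have idP : two_sided_ideal (char_ideal x y a' b') by exact: char_ideal_ideal.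
have subP := ideal_subspace idP; have [P0 PD PM PMr] := idP.
move: w; apply: ideal_gen_sub.
  split=> [|u v Pu Pv|a0 u Pu|a0 u Pu].
  - by rewrite rmorph0.
  - by rewrite rmorphD; apply: PD.
  - by rewrite rmorphM; apply: PM.
  - by rewrite rmorphM; apply: PMr.
move=> _ [->|->]; rewrite rmorphB /= (rmorph_alg (act h)).
- rewrite act_x aE -(scalerA _ a') -scalerBr; apply: (subspaceZ subP).
  by apply: ideal_genS; left.
- rewrite act_y bE -(scalerA _ b') -scalerBr; apply: (subspaceZ subP).
  by apply: ideal_genS; right.
Qed.

(** Required because the torus scales [z'] by the square of [h.1 * h.2]. *)
Lemma exists_sqrt (c : K) : c != 0 -> exists2 s, s != 0 & s ^+ 2 = c.
Proof.
move=> c0; have /closed_rootP[s] : size ('X^2 - c%:P) != 1%N.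
  by rewrite size_XnsubC.
rewrite rootE !hornerE subr_eq0 => /eqP sE; exists s => //.
by apply: contraNneq c0 => s0; rewrite -sE s0 expr0n.
Qed.

Lemma central_ideal_primitive al be : (al != 0) || (be != 0) ->
  left_primitive (central_ideal z z' al be).
Proof.
move=> ab0; apply: maximal_primitive.
- exact: central_ideal_ideal.
- exact: (central_idealN1 q0 qX two0 algA ab0).
- by move=> I idI PI I1; apply: (central_ideal_maximal q0 qX two0 algA ab0).
Qed.

Lemma char_ideal_primitive a b : a * b = 0 -> left_primitive (char_ideal x y a b).
Proof.
move=> ab0; apply: maximal_primitive.
- exact: char_ideal_ideal.
- exact: (char_idealN1 q0 algA ab0).
- by move=> I idI PI I1; apply: (char_ideal_maximal algA).
Qed.

Lemma annihilator_scalars (M : lmodType A) : simple_module M ->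
  exists al be, central_ideal z z' al be `<=` annihilator M.
Proof.
move=> sM; have zC := serre_zC q0 algA; have z'C := serre_z'C q0 algA.
have [||al Mal] := acts_by_scalar algA uncountableK (c := z) sM.
- by move=> v; rewrite !scalerA zC.
- by move=> v; rewrite !scalerA zC.
have [||be Mbe] := acts_by_scalar algA uncountableK (c := z') sM.
- by move=> v; rewrite !scalerA z'C.
- by move=> v; rewrite !scalerA z'C.
exists al, be; apply: ideal_gen_sub; first exact: annihilator_ideal.
by move=> _ [->|->].
Qed.

Lemma annihilator_central (M : lmodType A) al be : simple_module M ->
  (al != 0) || (be != 0) -> central_ideal z z' al be `<=` annihilator M ->
  annihilator M = central_ideal z z' al be.
Proof.
move=> sM ab0 PM; apply/seteqP; split=> //.
apply: (central_ideal_maximal q0 qX two0 algA ab0) => //.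
  exact: annihilator_ideal.
exact: annihilator1.
Qed.

Lemma annihilator_char (M : lmodType A) a b : simple_module M ->
  char_ideal x y a b `<=` annihilator M -> annihilator M = char_ideal x y a b.
Proof.
move=> sM PM; apply/seteqP; split=> //.
apply: (char_ideal_maximal algA) => //.
  exact: annihilator_ideal.
exact: annihilator1.
Qed.

Lemma central_ideal_al0 al : central_ideal z z' al 0 = ideal_gen [set z - al%:A; z'].
Proof. by rewrite /central_ideal scale0r subr0. Qed.

Lemma central_ideal_0be be : central_ideal z z' 0 be = ideal_gen [set z; z' - be%:A].
Proof. by rewrite /central_ideal scale0r subr0. Qed.

Lemma mem_annihilator_central (M : lmodType A) al be :
  central_ideal z z' al be `<=` annihilator M ->
  (al = 0 -> annihilator M z) /\ (be = 0 -> annihilator M z').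
Proof.
move=> PM; split=> e.
  by have := PM _ (@central_ideal_z _ _ z z' al be); rewrite e scale0r subr0.
by have := PM _ (@central_ideal_z' _ _ z z' al be); rewrite e scale0r subr0.
Qed.

Let Cstar : set K := [set c | c != 0].

Lemma stratum_0 : torus_stratum (ideal_gen [set 0])
  = [set ideal_gen [set z - al%:A; z' - be%:A] | al in Cstar & be in Cstar].
Proof.
apply/seteqP; split=> [P SP|_ [al al0 [be be0 <-]]].
- have [M sM PE] := stratum_annihilator SP.
  have [al [be PM]] := annihilator_scalars sM.
  have [Mz Mz'] := mem_annihilator_central PM.
  (* A larger ideal with both parameters non-zero witnesses that [J] contains neither [z] nor
     [z']. *)
  have J11 : ideal_gen [set 0] `<=` central_ideal z z' 1 1.
    apply: ideal_gen_sub; first exact: central_ideal_ideal.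
    by move=> _ ->; have [] := @central_ideal_ideal _ _ z z' 1 1.
  have al0 : al != 0.
    apply/eqP => /Mz Pz; rewrite -PE in Pz.
    have := J11 _ (stratum_eigen SP eigen_z Pz).
    exact: (central_ideal_z_notin q0 qX two0 algA (oner_neq0 K)).
  have be0 : be != 0.
    apply/eqP => /Mz' Pz'; rewrite -PE in Pz'.
    have := J11 _ (stratum_eigen SP eigen_z' Pz').
    exact: (central_ideal_z'_notin q0 qX two0 algA (oner_neq0 K)).
  exists al => //; exists be => //; rewrite PE; apply/esym/annihilator_central => //.
  by rewrite al0.
- have ab0 : (al != 0) || (be != 0) by apply/orP; left.
  apply: in_stratum.
  + exact: central_ideal_primitive.
  + by move=> _ ->; have [] := @central_ideal_ideal _ _ z z' al be.
  + by move=> _ -> h _; exists 1; rewrite ?oner_neq0 // rmorph0 scaler0.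
  move=> w Pw; suff -> : w = 0 by exact: ideal_genS.
  apply: (central_intersection0 q0 qX two0 algA) => al' be' al'0 be'0.
  have [|s s0 sE] := @exists_sqrt (be / be'); first by rewrite mulf_neq0 ?invr_neq0.
  (* Solves [h1 * h2 = s] and [h1 * h2 ^+ 2 = al / al'], so that this torus element carries one pair
     of parameters to the other. *)
  pose h2 := al / al' / s; have h20 : h2 != 0 by rewrite !mulf_neq0 ?invr_neq0.
  have th : @torus K (s / h2, h2) by split=> //=; rewrite mulf_neq0 ?invr_neq0.
  have [u Pu <-] := Pw _ th; apply: act_central Pu => /=.
    by rewrite /h2; field; rewrite s0 al'0 al0.
  by rewrite divfK // sE divfK.
Qed.

Lemma stratum_z' : torus_stratum (ideal_gen [set z'])
  = [set ideal_gen [set z - al%:A; z'] | al in Cstar].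
Proof.
apply/seteqP; split=> [P SP|_ [al al0 <-]].
- have [M sM PE] := stratum_annihilator SP.
  have [al [be PM]] := annihilator_scalars sM.
  have Mz' : annihilator M z'.
    by rewrite -PE; apply: (stratum_sub SP); exact: ideal_genS.
  have {}PM : central_ideal z z' al 0 `<=` annihilator M.
    rewrite central_ideal_al0; apply: ideal_gen_sub; first exact: annihilator_ideal.
    by move=> _ [->|->] //; apply: PM; exact: central_ideal_z.
  have [Mz _] := mem_annihilator_central PM.
  have J10 : ideal_gen [set z'] `<=` central_ideal z z' 1 0.
    rewrite central_ideal_al0; apply: ideal_gen_sub; first exact: ideal_gen_ideal.
    by move=> _ ->; apply: ideal_genS; right.
  have al0 : al != 0.
    apply/eqP => /Mz Pz; rewrite -PE in Pz.
    have := J10 _ (stratum_eigen SP eigen_z Pz).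
    exact: (central_ideal_z_notin q0 qX two0 algA (oner_neq0 K)).
  exists al => //; rewrite PE -central_ideal_al0; apply/esym/annihilator_central => //.
  by rewrite al0.
- have ab0 : (al != 0) || (0 != 0 :> K) by apply/orP; left.
  rewrite -central_ideal_al0; apply: in_stratum.
  + exact: central_ideal_primitive.
  + by move=> _ ->; rewrite central_ideal_al0; apply: ideal_genS; right.
  + by move=> _ ->; exact: eigen_z'.
  move=> w Pw; apply: (central_intersection_z' q0 qX two0 algA) => al' al'0.
  have th : @torus K (al / al', 1).
    by split=> /=; rewrite ?oner_neq0 // mulf_neq0 ?invr_neq0.
  have [u Pu <-] := Pw _ th; apply: act_central Pu => /=; last by rewrite mulr0.
  by rewrite expr1n mulr1 divfK.
Qed.

Lemma stratum_z : torus_stratum (ideal_gen [set z])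
  = [set ideal_gen [set z; z' - be%:A] | be in Cstar].
Proof.
apply/seteqP; split=> [P SP|_ [be be0 <-]].
- have [M sM PE] := stratum_annihilator SP.
  have [al [be PM]] := annihilator_scalars sM.
  have Mz : annihilator M z.
    by rewrite -PE; apply: (stratum_sub SP); exact: ideal_genS.
  have {}PM : central_ideal z z' 0 be `<=` annihilator M.
    rewrite central_ideal_0be; apply: ideal_gen_sub; first exact: annihilator_ideal.
    by move=> _ [->|->] //; apply: PM; exact: central_ideal_z'.
  have [_ Mz'] := mem_annihilator_central PM.
  have J01 : ideal_gen [set z] `<=` central_ideal z z' 0 1.
    rewrite central_ideal_0be; apply: ideal_gen_sub; first exact: ideal_gen_ideal.
    by move=> _ ->; apply: ideal_genS; left.
  have be0 : be != 0.
    apply/eqP => /Mz' Pz'; rewrite -PE in Pz'.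
    have := J01 _ (stratum_eigen SP eigen_z' Pz').
    exact: (central_ideal_z'_notin q0 qX two0 algA (oner_neq0 K)).
  exists be => //; rewrite PE -central_ideal_0be; apply/esym/annihilator_central => //.
  by rewrite be0 orbT.
- have ab0 : (0 != 0 :> K) || (be != 0) by apply/orP; right.
  rewrite -central_ideal_0be; apply: in_stratum.
  + exact: central_ideal_primitive.
  + by move=> _ ->; rewrite central_ideal_0be; apply: ideal_genS; left.
  + by move=> _ ->; exact: eigen_z.
  move=> w Pw; apply: (central_intersection_z q0 qX two0 algA) => be' be'0.
  have [|s s0 sE] := @exists_sqrt (be / be'); first by rewrite mulf_neq0 ?invr_neq0.
  have th : @torus K (s, 1) by split=> //=; rewrite oner_neq0.
  have [u Pu <-] := Pw _ th; apply: act_central Pu => /=; first by rewrite mulr0.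
  by rewrite mulr1 sE divfK.
Qed.

Lemma stratum_qplane lam : lam = q ^+ 2 \/ lam = q ^- 2 ->
  torus_stratum (qplane_ideal x y lam) = [set qplane_ideal x y lam].
Proof.
move=> lamE; apply/seteqP; split=> [P SP|_ ->].
- have [M sM PE] := stratum_annihilator SP.
  have JP := stratum_sub SP.
  (* The characters with values (1, 0) and (0, 1) kill the ideal, so it contains neither [x] nor
     [y], and by [stratum_eigen] neither does [P]. *)
  have notin (a b : K) : a * b = 0 -> exists f : {lrmorphism A -> K^o},
      [/\ f x = a, f y = b & forall w, qplane_ideal x y lam w -> f w = 0].
    move=> ab0; have [f [fx fy]] := character_exists q0 algA ab0.
    exists f; split=> //; apply: ideal_gen_sub; first exact: morph_ker_ideal.
    move=> _ -> /=; rewrite rmorphB [X in _ - X]linearZ /= !rmorphM /= fx fy.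
    by rewrite ab0 mulrC ab0 scaler0 subrr.
  rewrite /= PE; apply: (qplane_ideal_annihilator q0 qX algA lamE sM).
  + by rewrite -PE.
  + rewrite -PE => /(stratum_eigen SP eigen_x).
    have [f [fx _ fJ]] := notin 1 0 (mulr0 1).
    by move=> /fJ; rewrite fx => /eqP; rewrite oner_eq0.
  + rewrite -PE => /(stratum_eigen SP eigen_y).
    have [f [_ fy fJ]] := notin 0 1 (mul0r 1).
    by move=> /fJ; rewrite fy => /eqP; rewrite oner_eq0.
- apply: in_stratum.
  + exact: (qplane_ideal_primitive q0 qX algA lamE).
  + by move=> _ ->; exact: ideal_genS.
  + by move=> _ ->; exact: eigen_qcomm.
  + exact: bigcap_act_sub.
Qed.

Lemma stratum_e3 : torus_stratum (ideal_gen [set e3]) = [set ideal_gen [set e3]].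
Proof. by rewrite (e3_eq rels); apply: stratum_qplane; left. Qed.

Lemma stratum_e3bar :
  torus_stratum (ideal_gen [set e3bar]) = [set ideal_gen [set e3bar]].
Proof. by rewrite (e3bar_eq rels); apply: stratum_qplane; right. Qed.

Lemma char_ideal_0b b : char_ideal x y 0 b = ideal_gen [set x; y - b%:A].
Proof. by rewrite /char_ideal scale0r subr0. Qed.

Lemma char_ideal_a0 a : char_ideal x y a 0 = ideal_gen [set x - a%:A; y].
Proof. by rewrite /char_ideal scale0r subr0. Qed.

Lemma char_notin (S : set A) (f : {lrmorphism A -> K^o}) w :
  (forall v, S v -> f v = 0) -> ideal_gen S w -> f w = 0.
Proof. by move=> fS; move: w; apply: ideal_gen_sub => //; exact: morph_ker_ideal. Qed.

Lemma stratum_x : torus_stratum (ideal_gen [set x])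
  = [set ideal_gen [set x; y - b%:A] | b in Cstar].
Proof.
apply/seteqP; split=> [P SP|_ [b b0 <-]].
- have [M sM PE] := stratum_annihilator SP.
  have Mx : annihilator M x.
    by rewrite -PE; apply: (stratum_sub SP); exact: ideal_genS.
  have [|//|b Mb] := acts_by_scalar algA uncountableK (c := y) sM.
    by move=> v; rewrite !Mx scaler0.
  exists b; rewrite /Cstar /=.
    apply/eqP => b0; rewrite b0 scale0r subr0 -PE in Mb.
    (* The character with values (0, 1) shows that [y] is not in the ideal of [x]. *)
    have [f [fx fy]] := character_exists q0 algA (mul0r 1).
    have := stratum_eigen SP eigen_y Mb; move=> /(char_notin (f := f)).
    rewrite fy => e; have /eqP := e (fun v vx => etrans (congr1 f vx) fx).
    by rewrite oner_eq0.
  rewrite PE -char_ideal_0b; apply/esym/annihilator_char => //.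
  rewrite char_ideal_0b; apply: ideal_gen_sub; first exact: annihilator_ideal.
  by move=> _ [->|->].
- rewrite -char_ideal_0b; apply: in_stratum.
  + exact: (char_ideal_primitive (mul0r b)).
  + by move=> _ ->; rewrite char_ideal_0b; apply: ideal_genS; left.
  + by move=> _ ->; exact: eigen_x.
  move=> w Pw; apply: (char_intersection_x q0 qX algA) => b' b'0.
  have th : @torus K (1, b / b').
    by split=> /=; rewrite ?oner_neq0 // mulf_neq0 ?invr_neq0.
  have [u Pu <-] := Pw _ th; apply: act_char Pu => /=; first by rewrite mulr0.
  by rewrite divfK.
Qed.

Lemma stratum_y : torus_stratum (ideal_gen [set y])
  = [set ideal_gen [set x - a%:A; y] | a in Cstar].
Proof.
apply/seteqP; split=> [P SP|_ [a a0 <-]].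
- have [M sM PE] := stratum_annihilator SP.
  have My : annihilator M y.
    by rewrite -PE; apply: (stratum_sub SP); exact: ideal_genS.
  have [//| |a Ma] := acts_by_scalar algA uncountableK (c := x) sM.
    by move=> v; rewrite !My scaler0.
  exists a; rewrite /Cstar /=.
    apply/eqP => a0; rewrite a0 scale0r subr0 -PE in Ma.
    have [f [fx fy]] := character_exists q0 algA (mulr0 1).
    have := stratum_eigen SP eigen_x Ma; move=> /(char_notin (f := f)).
    rewrite fx => e; have /eqP := e (fun v vy => etrans (congr1 f vy) fy).
    by rewrite oner_eq0.
  rewrite PE -char_ideal_a0; apply/esym/annihilator_char => //.
  rewrite char_ideal_a0; apply: ideal_gen_sub; first exact: annihilator_ideal.
  by move=> _ [->|->].
- rewrite -char_ideal_a0; apply: in_stratum.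
  + exact: (char_ideal_primitive (mulr0 a)).
  + by move=> _ ->; rewrite char_ideal_a0; apply: ideal_genS; right.
  + by move=> _ ->; exact: eigen_y.
  move=> w Pw; apply: (char_intersection_y q0 qX algA) => a' a'0.
  have th : @torus K (a / a', 1).
    by split=> /=; rewrite ?oner_neq0 // mulf_neq0 ?invr_neq0.
  have [u Pu <-] := Pw _ th; apply: act_char Pu => /=; last by rewrite mulr0.
  by rewrite divfK.
Qed.

Lemma stratum_xy : torus_stratum (ideal_gen [set x; y]) = [set ideal_gen [set x; y]].
Proof.
have JE : ideal_gen [set x; y] = char_ideal x y 0 0.
  by rewrite char_ideal_a0 scale0r subr0.
apply/seteqP; split=> [P SP|_ ->].
- have [M sM PE] := stratum_annihilator SP.
  rewrite /= JE PE; apply: annihilator_char => //.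
  by rewrite -JE -PE; apply: stratum_sub.
- apply: in_stratum.
  + by rewrite JE; exact: (char_ideal_primitive (mul0r 0)).
  + by move=> w Sw; exact: ideal_genS.
  + by move=> _ [->|->]; [exact: eigen_x | exact: eigen_y].
  + exact: bigcap_act_sub.
Qed.

End Strata.

(** * Uncountability of the complex numbers and conclusion *)

Lemma uncountable_real (R : realType) : ~ countable [set: R].
Proof.
move=> /(sub_countable (subset_card_le (@subsetT _ [set` Interval (BLeft (0 : R)) (BRight 1)]))).
(* A countable set is null, whereas the unit interval has measure 1. *)
move=> /lebesgue_measure.countable_lebesgue_measure0.
rewrite lebesgue_measure.lebesgue_measure_itv /=.
rewrite constructive_ereal.lte_fin Num.Theory.ltr01 oppr0.
by rewrite constructive_ereal.adde0 => -[] /eqP; rewrite oner_eq0.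
Qed.

Lemma uncountable_complex (R : realType) : ~ countable [set: R[i]].
Proof.
move=> /countable_injP[f finj]; apply: (@uncountable_real R).
apply/countable_injP; exists (f \o real_complex R) => u v _ _ /= e.
by have [] := finj _ _ (mem_setT _) (mem_setT _) e.
Qed.

Section UplusStrata.
Variables (K : closedFieldType) (q : K).
Hypotheses (q0 : q != 0) (qX : forall n, (0 < n)%N -> q ^+ n != 1).
Hypothesis (two0 : 2%:R != 0 :> K).
Hypothesis uncountableK : ~ countable [set: K].

Definition Uplus_act (h : K * K) : {lrmorphism Uplus q -> Uplus q} := @torus_act _ q h.

Lemma Prim_stratumE (J : set (Uplus q)) : Prim_stratum J = torus_stratum Uplus_act J.
Proof. by []. Qed.

Lemma Uplus_Prim_strata :
  let Cstar : set K := [set c | c != 0] in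
  Prim_stratum (ideal_gen [set 0 : Uplus q])
    = [set ideal_gen [set z q - alpha%:A; z' q - beta%:A]
         | alpha in Cstar & beta in Cstar] /\
  Prim_stratum (ideal_gen [set z' q])
    = [set ideal_gen [set z q - alpha%:A; z' q] | alpha in Cstar] /\
  Prim_stratum (ideal_gen [set z q])
    = [set ideal_gen [set z q; z' q - beta%:A] | beta in Cstar] /\
  Prim_stratum (ideal_gen [set e3 q]) = [set ideal_gen [set e3 q]] /\
  Prim_stratum (ideal_gen [set e3bar q]) = [set ideal_gen [set e3bar q]] /\
  Prim_stratum (ideal_gen [set e1 q])
    = [set ideal_gen [set e1 q; e2 q - beta%:A] | beta in Cstar] /\
  Prim_stratum (ideal_gen [set e2 q])
    = [set ideal_gen [set e1 q - alpha%:A; e2 q] | alpha in Cstar] /\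
  Prim_stratum (ideal_gen [set e1 q; e2 q])
    = [set ideal_gen [set e1 q; e2 q]].
Proof.
have act_x h : Uplus_act h (e1 q) = h.1 *: e1 q := torus_act_e1 q h.
have act_y h : Uplus_act h (e2 q) = h.2 *: e2 q := torus_act_e2 q h.
have algU := Uplus_serre_algebra q.
move=> Cstar.
split; first exact: (etrans (Prim_stratumE _) (stratum_0 q0 qX two0 algU uncountableK act_x act_y)).
split; first exact: (etrans (Prim_stratumE _) (stratum_z' q0 qX two0 algU uncountableK act_x act_y)).
split; first exact: (etrans (Prim_stratumE _) (stratum_z q0 qX two0 algU uncountableK act_x act_y)).
split; first exact: (etrans (Prim_stratumE _) (stratum_e3 q0 qX algU act_x act_y)).
split; first exact: (etrans (Prim_stratumE _) (stratum_e3bar q0 qX algU act_x act_y)).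
split; first exact: (etrans (Prim_stratumE _) (stratum_x q0 qX algU uncountableK act_x act_y)).
split; first exact: (etrans (Prim_stratumE _) (stratum_y q0 qX algU uncountableK act_x act_y)).
exact: (etrans (Prim_stratumE _) (stratum_xy q0 algU act_x act_y)).
Qed.

End UplusStrata.

Theorem proposition2p6 (R : realType) (q : R[i])
    (q_neq0 : q != 0)
    (q_not_root_of_unity : forall n : nat, (0 < n)%N -> q ^+ n != 1) :
  let Cstar : set R[i] := [set c | c != 0] in
  Prim_stratum (ideal_gen [set 0 : Uplus q])
    = [set ideal_gen [set z q - alpha%:A; z' q - beta%:A]
         | alpha in Cstar & beta in Cstar] /\
  Prim_stratum (ideal_gen [set z' q])
    = [set ideal_gen [set z q - alpha%:A; z' q] | alpha in Cstar] /\
  Prim_stratum (ideal_gen [set z q])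
    = [set ideal_gen [set z q; z' q - beta%:A] | beta in Cstar] /\
  Prim_stratum (ideal_gen [set e3 q]) = [set ideal_gen [set e3 q]] /\
  Prim_stratum (ideal_gen [set e3bar q]) = [set ideal_gen [set e3bar q]] /\
  Prim_stratum (ideal_gen [set e1 q])
    = [set ideal_gen [set e1 q; e2 q - beta%:A] | beta in Cstar] /\
  Prim_stratum (ideal_gen [set e2 q])
    = [set ideal_gen [set e1 q - alpha%:A; e2 q] | alpha in Cstar] /\
  Prim_stratum (ideal_gen [set e1 q; e2 q])
    = [set ideal_gen [set e1 q; e2 q]].
Proof.
have two0 : 2%:R != 0 :> R[i] by rewrite Num.Theory.pnatr_eq0.
exact: (Uplus_Prim_strata q_neq0 q_not_root_of_unity two0 (@uncountable_complex R)).
Qed.
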